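(* Let $p>3$ and let $V:(0,\infty)\times[0,T]\to\mathbb R$ be a piecewise strong solution (for this $p$) of the condor variational inequality. Then $V$ coincides with the value function of the optimal stopping problem, i.e. for all $(s,t)\in(0,\infty)\times[0,T]$, $$V(s,t)=\sup_{\theta\in\mathcal T_{t,T}}\mathbb E\left[e^{-r(\theta-t)}V_0(S_\theta)\,\middle|\,S_t=s\right].$$ Moreover, for every $(s,t)\in(0,\infty)\times[0,T)$, with $S_t=s$, the stopping time $$\tau^*:=\inf\{u\in[t,T]:(S_u,u)\in\mathcal E_V\},\qquad \mathcal E_V:=\{(s,t)\in(0,\infty)\times[0,T]:V(s,t)=V_0(s)\},$$ is optimal, i.e. it attains this supremum.
   Context: Constants: $0<K_1<k_1<k_2<K_2$, $\sigma>0$, $r>0$, $q\ge0$, $T>0$. The asset price satisfies $\mathrm dS_t=(r-q)S_t\,\mathrm dt+\sigma S_t\,\mathrm dW_t$ with $W$ a standard Brownian motion; $\mathcal T_{t,T}$ is the set of stopping times with values in $[t,T]$. The payoff is $$V_0(s)=(s-K_1)^++(K_2-s)^+-(k_1-s)^+-(s-k_2)^+,\qquad s>0,$$ and $Y_0(x):=V_0(e^x)$. Put $\mathcal Lu:=\frac{\sigma^2}{2}\partial_{xx}u+\left(r-q-\frac{\sigma^2}{2}\right)\partial_xu-ru$. Let $I_-=(-\infty,\ln k_1)$, $I_+=(\ln k_2,\infty)$, with corner points $x_-:=\ln K_1$, $x_+:=\ln K_2$. For $1<p<\infty$, $\mathcal W_p(I_\pm\times(0,T])$ is the set of $u\in C(\overline{I_\pm}\times[0,T])$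 such that, for all $R,\rho>0$, $u,\partial_xu,\partial_{xx}u,\partial_\tau u$ (weak derivatives) belong to $L^p$ of $\left((I_\pm\cap(-R,R))\times(0,T)\right)\setminus B_\rho(x_\pm,0)$, where $B_\rho(x_\pm,0)$ is the open disc of radius $\rho$ centered at $(x_\pm,0)$. A piecewise strong solution in the variables $(x,\tau)$, for given $p$, is a bounded $Y\in C(\mathbb R\times[0,T])$ such that $Y=K_2-K_1$ on $[\ln k_1,\ln k_2]\times[0,T]$ and, on each of $I_-\times(0,T]$ and $I_+\times(0,T]$, the restriction of $Y$ lies in $\mathcal W_p(I_\pm\times(0,T])$, satisfies $Y\ge Y_0$, $\partial_\tau Y-\mathcal LY\ge0$ almost everywhere, $\partial_\tau Y-\mathcal LY=0$ almost everywhere on $\{Y>Y_0\}$, $Y(\cdot,0)=Y_0$, and takes the value $K_2-K_1$ at the finite endpoint of $I_\pm$ for all $\tau\in[0,T]$. A piecewise strong solution $V$ of the condor variational inequality is a function $V(s,t)=Y(\ln s,T-t)$ with $Y$ of this kind. *)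

(* Defs.v *)
From HB Require Import structures.
From mathcomp Require Import all_boot all_order all_algebra.
From mathcomp Require Import all_classical all_reals all_analysis.

Set Implicit Arguments.
Unset Strict Implicit.
Unset Printing Implicit Defensive.

Import Order.TTheory GRing.Theory Num.Theory.
Import numFieldNormedType.Exports.

Local Open Scope classical_set_scope.
Local Open Scope ring_scope.

Definition condor_payoff (R : realType) (K1 k1 k2 K2 s : R) : R :=
  Num.max (s - K1) 0 + Num.max (K2 - s) 0
  - Num.max (k1 - s) 0 - Num.max (s - k2) 0.

Section weak_derivatives.
Context {R : realType}.
Implicit Types (D : set (R * R)) (u g phi : R * R -> R).

Definition dx phi : R * R -> R := fun z => 'D_((1, 0) : R * R) phi z.
Definition dtau phi : R * R -> R := fun z => 'D_((0, 1) : R * R) phi z.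

Fixpoint Ck (k : nat) phi : Prop :=
  continuous phi /\
  if k is k'.+1 then
    [/\ forall z, derivable phi z ((1, 0) : R * R),
        forall z, derivable phi z ((0, 1) : R * R),
        Ck k' (dx phi) & Ck k' (dtau phi)]
  else True.

Definition test_function D phi : Prop :=
  (forall k, Ck k phi) /\
  exists K, [/\ compact K, K `<=` D & forall z, ~ K z -> phi z = 0].

Definition locally_integrable2 D g : Prop :=
  measurable_fun D g /\
  forall K, K `<=` D -> compact K ->
    (lebesgue_measure \x lebesgue_measure)%E.-integrable K (EFin \o g).

Definition weak_derivative D (a b : nat) u g : Prop :=
  locally_integrable2 D g /\
  forall phi, test_function D phi ->
    \int[(lebesgue_measure \x lebesgue_measure)%E]_(z in D)
       (u z * iter a dx (iter b dtau phi) z) =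
    (-1) ^+ (a + b) *
    \int[(lebesgue_measure \x lebesgue_measure)%E]_(z in D) (g z * phi z).

Definition in_Lp (p : R) (A : set (R * R)) g : Prop :=
  measurable_fun A g /\
  (\int[(lebesgue_measure \x lebesgue_measure)%E]_(z in A)
     (`|g z| `^ p)%:E < +oo)%E.

Definition disc (c : R * R) (rho : R) : set (R * R) :=
  [set z | (z.1 - c.1) ^+ 2 + (z.2 - c.2) ^+ 2 < rho ^+ 2].

(* [u] is in W_p(I x (0,T]) with corner point [(c, 0)], and [ux], [uxx],
   [ut] are its weak derivatives on the open set I x (0,T).  Only the values
   of [u] on the closure of I x (0,T] are constrained. *)
Definition in_Wp (p T : R) (I : set R) (c : R) u ux uxx ut : Prop :=
  [/\ {within closure I `*` `[0, T], continuous u},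
      weak_derivative (I `*` `]0, T[) 1 0 u ux,
      weak_derivative (I `*` `]0, T[) 2 0 u uxx,
      weak_derivative (I `*` `]0, T[) 0 1 u ut &
      forall L rho : R, 0 < L -> 0 < rho ->
        let A := ((I `&` `]-L, L[) `*` `]0, T[) `\` disc (c, 0) rho in
        [/\ in_Lp p A u, in_Lp p A ux, in_Lp p A uxx & in_Lp p A ut]].

End weak_derivatives.

Section piecewise_strong_solution.
Context {R : realType}.
Variables (K1 k1 k2 K2 sigma r q T p : R).

Definition log_payoff (x : R) : R := condor_payoff K1 k1 k2 K2 (expR x).

(* The operator L, in terms of the values of u, its first and its second
   x-derivative at a point. *)
Definition Lop (u ux uxx : R) : R :=
  sigma ^+ 2 / 2 * uxx + (r - q - sigma ^+ 2 / 2) * ux - r * u.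

(* Strong solution on I x (0,T], where I has the finite endpoint [e] and
   contains the corner point [c]. *)
Definition strong_solution_on (I : set R) (e c : R) (Y : R * R -> R) : Prop :=
  exists Yx Yxx Yt : R * R -> R,
    [/\ in_Wp p T I c Y Yx Yxx Yt,
        forall x tau, I x -> 0 < tau <= T -> log_payoff x <= Y (x, tau),
        {ae (lebesgue_measure \x lebesgue_measure)%E, forall z : R * R,
           (I `*` `]0, T]) z -> 0 <= Yt z - Lop (Y z) (Yx z) (Yxx z)},
        {ae (lebesgue_measure \x lebesgue_measure)%E, forall z : R * R,
           (I `*` `]0, T]) z -> log_payoff z.1 < Y z ->
           Yt z - Lop (Y z) (Yx z) (Yxx z) = 0} &
        (forall x, I x -> Y (x, 0) = log_payoff x) /\
        (forall tau, 0 <= tau <= T -> Y (e, tau) = K2 - K1)].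

Definition log_piecewise_strong_solution (Y : R * R -> R) : Prop :=
  [/\ {within [set: R] `*` `[0, T], continuous Y},
      exists M, forall x tau, 0 <= tau <= T -> `|Y (x, tau)| <= M,
      forall x tau, ln k1 <= x <= ln k2 -> 0 <= tau <= T ->
        Y (x, tau) = K2 - K1,
      strong_solution_on `]-oo, ln k1[ (ln k1) (ln K1) Y &
      strong_solution_on `]ln k2, +oo[ (ln k2) (ln K2) Y].

Definition piecewise_strong_solution (V : R -> R -> R) : Prop :=
  exists2 Y : R * R -> R, log_piecewise_strong_solution Y &
    forall s t, 0 < s -> 0 <= t <= T -> V s t = Y (ln s, T - t).

Definition exercise_set (V : R -> R -> R) : set (R * R) :=
  [set z | [/\ 0 < z.1, 0 <= z.2 <= T &
               V z.1 z.2 = condor_payoff K1 k1 k2 K2 z.1]].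

End piecewise_strong_solution.

Section stochastic.
Context {R : realType} {d : measure_display} {Omega : measurableType d}.
Variable P : probability Omega R.
Implicit Types (F : R -> set (set Omega)) (W S H : R -> Omega -> R).

(* Filtrations are indexed by the times u >= 0; values at u < 0 are ignored. *)
Definition filtration F : Prop :=
  [/\ forall u, 0 <= u -> sigma_algebra setT (F u),
      forall u, 0 <= u -> F u `<=` measurable &
      forall u v, 0 <= u -> u <= v -> F u `<=` F v].

Definition measurable_wrt (G : set (set Omega)) (X : Omega -> R) : Prop :=
  forall B : set R, measurable B -> G (X @^-1` B).

Definition brownian_motion F W : Prop :=
  [/\ {ae P, forall w, W 0 w = 0},
      forall w, {within `[0, +oo[, continuous (fun u => W u w)},
      forall u, 0 <= u -> measurable_wrt (F u) (W u),
      forall u v (A : set Omega) (B : set R), 0 <= u -> u <= v ->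
        F u A -> measurable B ->
        P (A `&` ((W v \- W u) @^-1` B)) =
        (P A * P ((W v \- W u)%R @^-1` B))%E &
      forall u v (B : set R), 0 <= u -> u < v -> measurable B ->
        P ((W v \- W u) @^-1` B) =
        normal_prob 0 (Num.sqrt (v - u)) B].

Record step_process := StepProcess {
  step_size : nat ;
  step_time : nat -> R ;
  step_coef : nat -> Omega -> R }.

Definition step_val (X : step_process) (v : R) (w : Omega) : R :=
  \sum_(i < step_size X)
    step_coef X i w * \1_(`]step_time X i, step_time X i.+1]) v.

Definition step_integral W (X : step_process) (w : Omega) : R :=
  \sum_(i < step_size X)
    step_coef X i w * (W (step_time X i.+1) w - W (step_time X i) w).

Definition simple_on F (a b : R) (X : step_process) : Prop :=
  [/\ step_time X 0 = a,
      step_time X (step_size X) = b,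
      forall i, (i < step_size X)%N -> step_time X i <= step_time X i.+1,
      forall i, (i < step_size X)%N ->
        measurable_wrt (F (step_time X i)) (step_coef X i) &
      forall i, (i < step_size X)%N ->
        exists M, forall w, `|step_coef X i w| <= M].

Definition cvg_prob0 (X : nat -> Omega -> \bar R) : Prop :=
  forall eps : R, 0 < eps ->
    (fun n => P [set w | (eps%:E <= X n w)%E]) @ \oo --> 0%E.

(* [J] is (a version of) the Ito integral of [H] with respect to [W] over
   [a, b]: the limit in probability of integrals of simple processes [X n]
   such that int_a^b |H - X n|^2 dv tends to 0 in probability.  Meant for
   adapted [H] with continuous paths, for which that integral is measurable. *)
Definition ito_integral F W (a b : R) H (J : Omega -> R) : Prop :=
  measurable_fun setT J /\
  exists X : nat -> step_process,
    [/\ forall n, simple_on F a b (X n),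
        cvg_prob0 (fun n w =>
          (\int[lebesgue_measure]_(v in `[a, b])
             ((H v w - step_val (X n) v w) ^+ 2)%:E)%E) &
        cvg_prob0 (fun n w => (`|step_integral W (X n) w - J w|)%:E)].

(* Positive continuous adapted solution on [t, T] of
   dS = (r - q) S du + sigma S dW,  S_t = s. *)
Definition price_process F W (r q sigma T t s : R) S : Prop :=
  [/\ forall u w, t <= u <= T -> 0 < S u w,
      forall w, {within `[t, T], continuous (fun u => S u w)},
      forall u, t <= u <= T -> measurable_wrt (F u) (S u),
      {ae P, forall w, S t w = s} &
      forall u, t <= u <= T ->
        exists2 J, ito_integral F W t u (fun v w => sigma * S v w) J &
          {ae P, forall w,
             S u w = S t w
               + \int[lebesgue_measure]_(v in `[t, u]) ((r - q) * S v w)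
               + J w}].

Definition stopping_times F (t T : R) : set (Omega -> R) :=
  [set theta | (forall w, t <= theta w <= T) /\
               (forall u, 0 <= u -> F u [set w | theta w <= u])].

Definition stopped_reward (r t : R) (g : R -> R) S (theta : Omega -> R)
    : \bar R :=
  expectation P (fun w => expR (- r * (theta w - t)) * g (S (theta w) w)).

Definition optimal_value F (r t T : R) (g : R -> R) S : \bar R :=
  ereal_sup [set stopped_reward r t g S theta
            | theta in stopping_times F t T].

Definition first_entry (E : set (R * R)) (t T : R) S (w : Omega) : R :=
  inf [set u | t <= u <= T /\ E (S u w, u)].

End stochastic.

(* Main.v *)
(* Ito's formula is avoided: Riemann sums for the Ito integral and the quadratic
   variation of [W] show that [ln S] is a Brownian motion with drift. The
   operator has constant coefficients, so mollifying [Y] by a kernel supported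
   in a small box gives a smooth function satisfying the same (in)equality at
   every point whose box lies in the region where [Y] does. A third order Taylor
   expansion along a fine time grid then yields Dynkin's inequality for the
   mollified function up to a stopping time; letting the mesh and then the box
   shrink yields it for [Y], up to the first exit from a set [psi > 0] with
   [psi] continuous. With [psi = K2 - K1 - payoff] this gives the upper bound:
   at the exit time the payoff has reached its maximum [K2 - K1], and since [r
   >= 0] waiting longer cannot pay. With [psi = Y - payoff], where the equation
   holds exactly, the inequality applies to [Y] and to [- Y], so the first entry
   into the exercise set attains the bound. Neither [psi] is positive on [ln k1,
   ln k2], hence the kinks of [Y] at the endpoints never matter. *)

Require Import Defs.
From HB Require Import structures.
From mathcomp Require Import all_boot all_order all_algebra.
From mathcomp Require Import all_classical all_reals all_analysis.
From mathcomp Require Import measurable_realfun.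
From mathcomp Require Import ring lra zify.

Set Implicit Arguments.
Unset Strict Implicit.
Unset Printing Implicit Defensive.

Import Order.TTheory GRing.Theory Num.Theory.
Import numFieldNormedType.Exports.

Local Open Scope classical_set_scope.
Local Open Scope ring_scope.

(** * Gaussian increments *)

(** Ito integrals come one upper limit at a time, up to null sets, as limits in probability along
    unspecified simple processes. Hence two scales: on a coarse grid of n cells finitely many
    integrals are chosen, and each is replaced by Riemann sums on a grid m times finer, m depending
    on n. The relative error in a coarse cell is a stochastic sum whose integrand, a price ratio
    minus one, is small by path continuity but not uniformly in w; truncation by accumulated energy
    bounds it in probability without moments of the price. Conditional expectations are replaced by
    multiplying with the indicator of an event of [F u] and using independence of the next
    increment. A time step delta costs an error of order delta^(3/2), so a whole grid costs the
    square root of its mesh. The mollified equation needs room for the box. So the exit is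
    approximated from inside, by exits from sets where psi and the remaining time exceed 1/(n+1) and
    |ln S| is below n+1; uniform continuity on a compact set gives both the room and the closeness
    to [Y]. *)

Section random_variables.
Context {R : realType} {d : measure_display} {Omega : measurableType d}.
Variable P : probability Omega R.
Implicit Types X Y Z : Omega -> R.

Definition rv_integrable X := P.-integrable setT (EFin \o X).

Lemma rv_integrable_measurable X : rv_integrable X -> measurable_fun setT X.
Proof. by move=> /integrableP[/measurable_EFinP]. Qed.

Lemma rv_integrable_bounded X (M : R) :
  measurable_fun setT X -> (forall w, `|X w| <= M) -> rv_integrable X.
Proof.
move=> mX bX; apply: measurable_bounded_integrable => //.
  by rewrite /= probability_setT ltry.
by exists M; split; [exact: num_real|move=> x Mx w _; exact: le_trans (bX w) (ltW Mx)].
Qed.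

Lemma rv_integrable_cst (c : R) : rv_integrable (fun=> c).
Proof. exact: (@rv_integrable_bounded _ `|c|). Qed.

Lemma rv_integrableD X Y : rv_integrable X -> rv_integrable Y ->
  rv_integrable (fun w => X w + Y w).
Proof.
move=> iX iY; have := integrableD measurableT iX iY.
by apply: eq_integrable => // w _.
Qed.

Lemma rv_integrableZ (c : R) X : rv_integrable X ->
  rv_integrable (fun w => c * X w).
Proof.
move=> iX; have := integrableZl measurableT c iX.
by apply: eq_integrable => // w _.
Qed.

Lemma rv_integrableB X Y : rv_integrable X -> rv_integrable Y ->
  rv_integrable (fun w => X w - Y w).
Proof.
move=> iX iY; have := integrableB measurableT iX iY.
by apply: eq_integrable => // w _.
Qed.

Lemma rv_integrable_le X Y : measurable_fun setT X -> rv_integrable Y ->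
  (forall w, `|X w| <= Y w) -> rv_integrable X.
Proof.
move=> mX iY XY; apply: le_integrable iY => //; first exact/measurable_EFinP.
by move=> w _ /=; rewrite lee_fin (le_trans (XY w))// ler_norm.
Qed.

Lemma rv_integrableM_bounded X Y (M : R) : measurable_fun setT X ->
  (forall w, `|X w| <= M) -> rv_integrable Y -> rv_integrable (fun w => X w * Y w).
Proof.
move=> mX bX iY.
apply: (@rv_integrable_le _ (fun w => M * `|Y w|)).
- by apply: measurable_funM => //; exact: rv_integrable_measurable.
- apply: rv_integrableZ; have := integrable_norm iY.
  by apply: eq_integrable.
- by move=> w; rewrite normrM ler_wpM2r.
Qed.

Lemma rv_integrable_sum (I : Type) (s : seq I) (Q : pred I) (X : I -> Omega -> R) :
  (forall i, Q i -> rv_integrable (X i)) ->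
  rv_integrable (fun w => \sum_(i <- s | Q i) X i w).
Proof.
move=> iX; elim: s => [|i s ih].
  under [X in rv_integrable X]funext do rewrite big_nil.
  exact: rv_integrable_cst.
under [X in rv_integrable X]funext do rewrite big_cons.
by case: (boolP (Q i)) => // Qi; apply: rv_integrableD => //; exact: iX.
Qed.

Definition mean X : R := \int[P]_w X w.

Lemma meanD X Y : rv_integrable X -> rv_integrable Y ->
  mean (fun w => X w + Y w) = mean X + mean Y.
Proof. by move=> iX iY; rewrite /mean RintegralD. Qed.

Lemma meanB X Y : rv_integrable X -> rv_integrable Y ->
  mean (fun w => X w - Y w) = mean X - mean Y.
Proof. by move=> iX iY; rewrite /mean RintegralB. Qed.

Lemma meanZ (c : R) X : rv_integrable X -> mean (fun w => c * X w) = c * mean X.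
Proof. by move=> iX; rewrite /mean RintegralZl. Qed.

Lemma mean_cst (c : R) : mean (fun=> c) = c.
Proof. rewrite /mean Rintegral_cst//; transitivity (c * fine 1%E); last by rewrite mulr1.
by congr (_ * fine _); exact: probability_setT. Qed.

Lemma mean_sum (I : Type) (s : seq I) (Q : pred I) (X : I -> Omega -> R) :
  (forall i, Q i -> rv_integrable (X i)) ->
  mean (fun w => \sum_(i <- s | Q i) X i w) = \sum_(i <- s | Q i) mean (X i).
Proof.
move=> iX; elim: s => [|i s ih].
  by rewrite big_nil -[RHS](mean_cst 0); congr mean; apply/funext => w; rewrite big_nil.
rewrite big_cons; under [X in mean X]funext do rewrite big_cons.
case: (boolP (Q i)) => // Qi; rewrite meanD ?ih//; first exact: iX.
exact: rv_integrable_sum.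
Qed.

Lemma mean_le X Y : rv_integrable X -> rv_integrable Y ->
  (forall w, X w <= Y w) -> mean X <= mean Y.
Proof. by move=> iX iY XY; apply: le_Rintegral. Qed.

Lemma mean_ge0 X : (forall w, 0 <= X w) -> 0 <= mean X.
Proof. by move=> X0; apply: Rintegral_ge0. Qed.

Lemma mean_norm_le X : rv_integrable X -> `|mean X| <= mean (fun w => `|X w|).
Proof. by move=> iX; exact: le_normr_Rintegral. Qed.

Lemma mean_ae X Y : measurable_fun setT X -> measurable_fun setT Y ->
  {ae P, forall w, X w = Y w} -> mean X = mean Y.
Proof.
move=> mX mY XY; congr fine; apply: ae_eq_integral => //.
- exact/measurable_EFinP.
- exact/measurable_EFinP.
- by apply: filterS XY => w + _ => ->.
Qed.

Lemma rv_integrable_ae X Y : rv_integrable X -> measurable_fun setT Y ->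
  {ae P, forall w, X w = Y w} -> rv_integrable Y.
Proof.
move=> iX mY XY; apply/integrableP; split; first exact/measurable_EFinP.
have /integrableP[mX] := iX.
congr (_ < _)%E; apply: ae_eq_integral => //.
- exact: measurableT_comp.
- by apply: measurableT_comp => //; exact/measurable_EFinP.
- by apply: filterS XY => w + _ /= => ->.
Qed.

Lemma rv_integrable_indic (A : set Omega) : measurable A -> rv_integrable \1_A.
Proof.
move=> mA; apply: (@rv_integrable_bounded _ 1) => [|w]; first exact: measurable_indic.
by rewrite indicE; case: (_ \in _); rewrite ?normr0 ?normr1.
Qed.

Lemma prob_mean (A : set Omega) : measurable A -> P A = (mean \1_A)%:E.
Proof.
move=> mA; rewrite /mean /Rintegral integral_indic// setIT fineK//.
exact: fin_num_measure.
Qed.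

Lemma mean_cvg (X_ : nat -> Omega -> R) X (M : R) :
  (forall n, measurable_fun setT (X_ n)) ->
  (forall n w, `|X_ n w| <= M) ->
  (forall w, X_ n w @[n --> \oo] --> X w) ->
  mean (X_ n) @[n --> \oo] --> mean X.
Proof.
move=> mX bX cX.
have mX' : measurable_fun setT X by apply: (measurable_fun_cvg mX) => w _; exact: cX.
have cE w : (X_ n w)%:E @[n --> \oo] --> (X w)%:E.
  by apply: cvg_EFin; [exact: nearW|exact: cX].
have [iX _ cI] := @dominated_convergence _ _ _ P setT measurableT
  (fun n => EFin \o X_ n) (EFin \o X) (fun=> M%:E)
  (fun n => (measurable_EFinP _ _).2 (mX n)) ((measurable_EFinP _ _).2 mX')
  (aeW _ (fun w _ => cE w)) (rv_integrable_cst M) (aeW _ (fun w n _ => bX n w)).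
have iXf : (\int[P]_x (EFin \o X) x)%E \is a fin_num by exact: integrable_fin_num.
apply: fine_cvg; rewrite /mean /Rintegral fineK//; exact: cI.
Qed.
End random_variables.

(** One weight for all growth conditions: fourth moments of increments are the highest that the
    quadratic variation and the Taylor remainders call for. *)
Lemma norm_powM_le {R : realDomainType} (j : nat) (x : R) : (j <= 4)%N ->
  `|x ^+ j| <= 1 + x ^+ 4.
Proof.
move=> j4; rewrite normrX.
have x4 : x ^+ 4 = `|x| ^+ 4 by rewrite -normrX ger0_norm// exprn_even_ge0.
have [x1|x1] := leP `|x| 1.
  by rewrite (@le_trans _ _ 1)//; [exact: exprn_ile1|rewrite lerDl exprn_even_ge0].
by rewrite x4 (le_trans (ler_weXn2l (ltW x1) j4))// lerDr.
Qed.

Section real_derivatives.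
Context {R : realType}.
Implicit Types (f g : R -> R) (x a b c : R).

Lemma is_derive_funX k x : is_derive x 1 (fun y : R => y ^+ k) (k%:R * x ^+ k.-1).
Proof.
have -> : (fun y : R => y ^+ k) = (id : R -> R) ^+ k by rewrite exprfctE.
by apply: is_derive_eq; rewrite /GRing.scale/= mulr1.
Qed.

Lemma is_derive_funM f g x a b : is_derive x 1 f a -> is_derive x 1 g b ->
  is_derive x 1 (fun y => f y * g y) (a * g x + f x * b).
Proof.
move=> df dg; apply: is_derive_eq.
by rewrite addrC mulrC; congr (_ + _); rewrite /GRing.scale.
Qed.

Lemma is_derive_funD f g x a b : is_derive x 1 f a -> is_derive x 1 g b ->
  is_derive x 1 (fun y => f y + g y) (a + b).
Proof. by move=> df dg; apply: is_derive_eq. Qed.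

Lemma is_derive_funZ f x a c : is_derive x 1 f a ->
  is_derive x 1 (fun y => c * f y) (c * a).
Proof. by move=> df; apply: is_derive_eq; rewrite /GRing.scale/=; ring. Qed.

Lemma is_derive_expR_comp f x a : is_derive x 1 f a ->
  is_derive x 1 (fun y => expR (f y)) (expR (f x) * a).
Proof. by move=> df; exact: (is_derive1_comp (is_derive_expR _)). Qed.

End real_derivatives.

Section improper_integral.
Context {R : realType}.
Local Notation mu := (@lebesgue_measure R).
Implicit Types f g G : R -> R.

Lemma Rintegral_symitv_cvg g : mu.-integrable setT (EFin \o g) ->
  \int[mu]_(x in `[- n%:R, n%:R]) g x @[n --> \oo] --> \int[mu]_x g x.
Proof.
move=> ig; have mg := measurable_int _ ig.
have ifin : (\int[mu]_x (g x)%:E)%E \is a fin_num by exact: integrable_fin_num.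
pose I (n : nat) : set R := [set` `[(- n%:R : R), n%:R]].
have [] // := @dominated_convergence _ _ _ mu setT measurableT
    (fun n => (EFin \o g) \_ (I n)) (EFin \o g) (fun x => `|(g x)%:E|%E).
- move=> n; have mI : measurable (I n) by exact: measurable_itv.
  exact: ((measurable_restrictT _ mI).1 (measurable_funS measurableT (@subsetT _ _) mg)).
- apply: aeW => x _; apply: cvg_near_cst.
  exists (Num.truncn `|x|).+1 => // n /= xn.
  rewrite patchE mem_set//= /I /= in_itv/= -ler_norml (le_trans (ltW (truncnS_gt _)))//.
  by rewrite ler_nat.
- exact: integrable_abse.
- apply: aeW => x n _; rewrite patchE; case: ifP => // _.
  by rewrite abse0.
move=> _ _ h; apply: fine_cvg; rewrite fineK//.
apply: cvg_trans h; apply: near_eq_cvg; apply: nearW => n.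
by rewrite [RHS]integral_mkcond.
Qed.

(** The fundamental theorem on [-n, n]. Integrability of [g] makes the symmetric integrals converge,
    so the decay of [G] is asked along integers only. *)
Lemma Rintegral_deriv_eq0 G g : (forall x : R, is_derive x 1 G (g x)) ->
  continuous g -> mu.-integrable setT (EFin \o g) ->
  G n%:R - G (- n%:R) @[n --> \oo] --> 0 ->
  \int[mu]_x g x = 0.
Proof.
move=> dG cg ig G0.
have <- := cvg_lim (@Rhausdorff R) (Rintegral_symitv_cvg ig).
apply: cvg_lim => //.
apply: cvg_trans G0; apply: near_eq_cvg; near=> n.
have n0 : (0 < n)%N by near: n; exact: nbhs_infty_gt.
have G_cont : continuous G.
  by move=> x; apply: differentiable_continuous; apply/derivable1_diffP; have [] := dG x.
rewrite /Rintegral (@continuous_FTC2 _ g G)//.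
- by have : (0 : R) < n%:R by [rewrite ltr0n]; lra.
- exact: continuous_subspaceT.
- split => [x _||]; first by have [] := dG x.
  + by apply: cvg_at_right_filter; exact: G_cont.
  + by apply: cvg_at_left_filter; exact: G_cont.
- by move=> x _; rewrite derive1E; apply: derive_val.
Unshelve. all: by end_near. Qed.

End improper_integral.

Section normal_moments.
Context {R : realType}.
Local Notation mu := (@lebesgue_measure R).
Variable s : R.
Hypothesis s_gt0 : 0 < s.

Local Notation phi := (normal_pdf 0 s).

Let s_neq0 : s != 0. Proof. by rewrite gt_eqF. Qed.

Let phiE x : phi x = normal_peak s * expR (- (2 * s ^+ 2)^-1 * x ^+ 2).
Proof.
rewrite normal_pdfE//= /normal_fun subr0; congr (_ * expR _); field.
by rewrite s_neq0.
Qed.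

Let is_derive_phi (x : R) : is_derive x 1 phi (- (s ^+ 2)^-1 * x * phi x).
Proof.
have -> : phi = (fun x => normal_peak s * expR (- (2 * s ^+ 2)^-1 * x ^+ 2)).
  by apply/funext => y; rewrite phiE.
have h := is_derive_funZ (normal_peak s) (is_derive_expR_comp
  (is_derive_funZ (- (2 * s ^+ 2)^-1) (is_derive_funX 2 x))).
apply: (is_derive_eq h) => /=; rewrite expr1; field.
by rewrite s_neq0.
Qed.

Let is_derive_Xphi (k : nat) (x : R) : is_derive x 1 (fun y => y ^+ k * phi y)
  (k%:R * x ^+ k.-1 * phi x - (s ^+ 2)^-1 * (x ^+ k.+1 * phi x)).
Proof.
have -> : k%:R * x ^+ k.-1 * phi x - (s ^+ 2)^-1 * (x ^+ k.+1 * phi x) =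
    k%:R * x ^+ k.-1 * phi x + x ^+ k * (- (s ^+ 2)^-1 * x * phi x).
  by rewrite [x ^+ k.+1]exprSr; ring.
exact: (is_derive_funM (is_derive_funX k x) (is_derive_phi x)).
Qed.

Let phi_ge0 x : 0 <= phi x. Proof. exact: normal_pdf_ge0. Qed.

(** With y = x^2 / (4 s^2) the density is a multiple of exp(-2y). One factor exp(-y) absorbs the
    polynomial, the other is a normal density of deviation sqrt 2 * s. The constant 64 is 16 * 4,
    from x^4 = 16 s^4 y^2 and y^2 <= 4 exp y, the square of 1 + y/2 <= exp(y/2). *)
Let X4phi_le : exists2 C : R, 0 <= C &
  forall x, (1 + x ^+ 4) * phi x <= C * normal_pdf 0 (Num.sqrt 2 * s) x.
Proof.
pose s2 := Num.sqrt 2 * s.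
have s2_neq0 : s2 != 0 by rewrite mulf_neq0// gt_eqF// sqrtr_gt0.
have pk := normal_peak_gt0 s2_neq0.
exists ((1 + 64 * s ^+ 4) * normal_peak s / normal_peak s2).
  apply: divr_ge0; last exact: ltW.
  by rewrite mulr_ge0 ?normal_peak_ge0// addr_ge0// mulr_ge0// exprn_even_ge0.
move=> x; rewrite phiE (normal_pdfE _ s2_neq0) /normal_fun -/s2 subr0.
set y := x ^+ 2 / (4 * s ^+ 2).
have y0 : 0 <= y by rewrite divr_ge0 ?sqr_ge0// mulr_ge0 ?sqr_ge0.
have -> : - (2 * s ^+ 2)^-1 * x ^+ 2 = - y - y by rewrite /y; field.
have -> : - x ^+ 2 / (s2 ^+ 2 *+ 2) = - y.
  by rewrite /y /s2 exprMn sqr_sqrtr//; field.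
rewrite expRD.
rewrite [leRHS](_ : _ = (1 + 64 * s ^+ 4) * normal_peak s * expR (- y)); last first.
  by field; rewrite gt_eqF.
rewrite [leLHS](_ : _ = ((1 + x ^+ 4) * expR (- y)) * (normal_peak s * expR (- y))); last by ring.
rewrite -[leRHS]mulrA; apply: ler_wpM2r; first by rewrite mulr_ge0 ?normal_peak_ge0 ?expR_ge0.
have -> : x ^+ 4 = 16 * s ^+ 4 * y ^+ 2 by rewrite /y; field.
rewrite expRN ler_pdivrMr ?expR_gt0//.
have e1 : 1 <= expR y by rewrite -expR0 ler_expR.
have e2 : y ^+ 2 <= 4 * expR y.
  have -> : expR y = expR (y / 2) ^+ 2 by rewrite -expRM_natl; congr expR; field.
  have h : 1 + y / 2 <= expR (y / 2) by exact: expR_ge1Dx.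
  have : y / 2 <= expR (y / 2) by lra.
  move=> h2; have : (y / 2) ^+ 2 <= expR (y / 2) ^+ 2 by rewrite ler_pXn2r// nnegrE; lra.
  by rewrite expr_div_n; lra.
have s4 : 0 <= s ^+ 4 by rewrite exprn_even_ge0.
nra.
Qed.

Let phi_cont : continuous phi.
Proof. exact: continuous_normal_pdf. Qed.

Let mphi : measurable_fun setT phi.
Proof. exact: measurable_normal_pdf. Qed.

Lemma integrable_normal_pdf_growth (g : R -> R) (A : R) : measurable_fun setT g ->
  (forall x, `|g x| <= A * (1 + x ^+ 4)) ->
  mu.-integrable setT (fun x => (g x * phi x)%:E).
Proof.
move=> mg bg; have [C C0 hC] := X4phi_le.
apply: (@le_integrable _ _ _ mu setT measurableT _
  (fun x => (A * C)%:E * (normal_pdf 0 (Num.sqrt 2 * s) x)%:E)%E).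
- by apply/measurable_EFinP; exact: measurable_funM.
- move=> x _ /=; rewrite lee_fin normrM (ger0_norm (phi_ge0 x)).
  have A0 : 0 <= A.
    rewrite -(pmulr_lge0 _ (_ : 0 < 1 + x ^+ 4)); last first.
      by rewrite ltr_pwDl// exprn_even_ge0.
    exact: le_trans (bg x).
  apply: le_trans (ler_norm _).
  apply: (le_trans (ler_wpM2r (phi_ge0 x) (bg x))).
  by rewrite -!mulrA ler_wpM2l.
- by apply: integrableZl => //; exact: integrable_normal_pdf.
Qed.

(** Multiplying by one more factor n still leaves a power at most 4, which is bounded against the
    density; hence decay like 1/n. *)
Let powM_phi_cvg (k : nat) : (k <= 3)%N -> forall e : R, 0 < e ->
  \forall n \near \oo, `|n%:R ^+ k * phi n%:R| <= e.
Proof.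
move=> k3 e e0; have [C C0 hC] := X4phi_le.
have s2 : Num.sqrt 2 * s != 0 by rewrite mulf_neq0// gt_eqF// sqrtr_gt0.
pose B := C * normal_peak (Num.sqrt 2 * s).
exists (Num.truncn (B / e)).+1 => // n /= hn.
have n0 : 0 < n%:R :> R by rewrite ltr0n (leq_trans _ hn).
have n1 : 1 <= n%:R :> R by rewrite ler1n (leq_trans _ hn).
rewrite ger0_norm ?mulr_ge0 ?exprn_ge0// -(ler_pM2l n0) mulrA -exprS.
apply: (@le_trans _ _ B).
  apply: (le_trans _ (le_trans (hC n%:R) _)).
    rewrite ler_wpM2r//; apply: (@le_trans _ _ (n%:R ^+ 4)); last by rewrite lerDr.
    by rewrite ler_weXn2l.
  by rewrite ler_wpM2l// normal_pdf_ub.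
rewrite -ler_pdivrMr// (le_trans (ltW (truncnS_gt _)))//.
by rewrite ler_nat.
Qed.

(** The integrand is the derivative of x^k phi(x), which vanishes at infinity. For k = 0 the
    meaningless predecessor exponent is killed by the factor [k%:R]. *)
Lemma normal_moment_rec (k : nat) : (k <= 3)%N ->
  \int[mu]_x (k%:R * x ^+ k.-1 * phi x - (s ^+ 2)^-1 * (x ^+ k.+1 * phi x)) = 0.
Proof.
move=> k3; apply: (@Rintegral_deriv_eq0 _ (fun x => x ^+ k * phi x)).
- exact: is_derive_Xphi.
- have -> : (fun x => k%:R * x ^+ k.-1 * phi x - (s ^+ 2)^-1 * (x ^+ k.+1 * phi x)) =
    (fun x => (k%:R * x ^+ k.-1 - (s ^+ 2)^-1 * x ^+ k.+1) * phi x).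
    by apply/funext => x; ring.
  move=> x; apply: cvgM; last exact: phi_cont.
  apply: cvgB; apply: cvgM; (try exact: cvg_cst); exact: exprn_continuous.
- have -> : EFin \o (fun x => k%:R * x ^+ k.-1 * phi x - (s ^+ 2)^-1 * (x ^+ k.+1 * phi x)) =
    (fun x => ((k%:R * x ^+ k.-1 - (s ^+ 2)^-1 * x ^+ k.+1) * phi x)%:E).
    by apply/funext => x /=; congr EFin; ring.
  apply: (@integrable_normal_pdf_growth _ (k%:R + (s ^+ 2)^-1)).
    apply: measurable_funB; apply: measurable_funM => //; exact: exprn_measurable.
  move=> x; apply: (le_trans (ler_normB _ _)); rewrite !normrM mulrDl.
  rewrite (ger0_norm (ler0n _ _)) [ `|(s ^+ 2)^-1|]ger0_norm ?invr_ge0 ?sqr_ge0//.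
  apply: lerD; apply: ler_wpM2l; rewrite ?invr_ge0 ?sqr_ge0//; apply: norm_powM_le.
    by case: k k3 => // k; lia.
  by lia.
- have h (e : R) : 0 < e -> \forall n \near \oo,
      `|n%:R ^+ k * phi n%:R - (- n%:R) ^+ k * phi (- n%:R)| <= e.
    move=> e0; have e2 : 0 < e / 2 by rewrite divr_gt0.
    near=> n; have hn : `|n%:R ^+ k * phi n%:R| <= e / 2.
      by near: n; exact: powM_phi_cvg.
    have phiN : phi (- n%:R) = phi n%:R by rewrite !phiE sqrrN.
    rewrite phiN (le_trans (ler_normB _ _))// [leRHS](splitr e).
    by rewrite lerD// normrM normrX normrN -normrX -normrM.
  apply/cvgrPdist_le => e e0; near=> n; rewrite sub0r normrN.
  by near: n; exact: h.
Unshelve. all: by end_near. Qed.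

Let integrable_mom (k : nat) : (k <= 4)%N ->
  mu.-integrable setT (fun x => (x ^+ k * phi x)%:E).
Proof.
move=> k4; apply: (@integrable_normal_pdf_growth _ 1); first exact: exprn_measurable.
by move=> x; rewrite mul1r; exact: norm_powM_le.
Qed.

Lemma normal_moments : [/\ \int[mu]_x (x ^+ 1 * phi x) = 0,
  \int[mu]_x (x ^+ 2 * phi x) = s ^+ 2 & \int[mu]_x (x ^+ 4 * phi x) = 3 * s ^+ 4].
Proof.
have s2 : s ^+ 2 != 0 by rewrite expf_neq0.
have step (k : nat) : (k <= 3)%N ->
    \int[mu]_x (x ^+ k.+1 * phi x) = s ^+ 2 * (k%:R * \int[mu]_x (x ^+ k.-1 * phi x)).
  move=> k3; have := normal_moment_rec k3.
  have ia := integrable_mom (leq_trans (leq_pred k) (leq_trans k3 (isT : (3 <= 4)%N))).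
  have ib := integrable_mom (k3 : (k.+1 <= 4)%N).
  rewrite RintegralB//=; last 2 first.
  - have := integrableZl measurableT k%:R ia; apply: eq_integrable => // x _ /=.
    by rewrite -EFinM mulrA.
  - by have := integrableZl measurableT (s ^+ 2)^-1 ib; exact: eq_integrable.
  under eq_Rintegral do rewrite -mulrA.
  rewrite RintegralZl// RintegralZl// => /eqP; rewrite subr_eq0 => /eqP ->.
  by rewrite mulrA divff// mul1r.
have m0 : \int[mu]_x (x ^+ 0 * phi x) = 1.
  rewrite /Rintegral; under eq_integral do rewrite expr0 mul1r.
  by rewrite integral_normal_pdf.
have m2 : \int[mu]_x (x ^+ 2 * phi x) = s ^+ 2 by rewrite (step 1%N)// m0 !mulr1.
split; [by rewrite (step 0%N)// mul0r mulr0| exact: m2|].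
by rewrite (step 3%N)// m2; ring.
Qed.

End normal_moments.

Section normal_law.
Context {R : realType}.
Local Notation mu := (@lebesgue_measure R).

(** The Radon-Nikodym derivative and the explicit density have the same integral over every
    measurable set, so they agree almost everywhere. *)
Lemma ge0_integral_normal_prob (m s : R) (f : R -> \bar R) :
  measurable_fun setT f -> (forall x, (0 <= f x)%E) ->
  (\int[normal_prob m s]_x f x = \int[mu]_x (f x * (normal_pdf m s x)%:E))%E.
Proof.
move=> mf f0; have dom := normal_prob_dominates m s.
rewrite -(Radon_Nikodym_SigmaFinite.change_of_variables dom)//.
have ig := Radon_Nikodym_SigmaFinite.f_integrable dom.
have mpdf : measurable_fun setT (fun x => (normal_pdf m s x)%:E).
  by apply/measurable_EFinP; exact: measurable_normal_pdf.
apply: ae_eq_integral => //.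
- by apply: emeasurable_funM => //; exact: (measurable_int _ ig).
- by apply: emeasurable_funM.
- apply: ae_eqe_mul2l; apply: (integral_ae_eq _ ig) => // E _ mE.
  by rewrite -Radon_Nikodym_SigmaFinite.f_integral.
Qed.

Context {d : measure_display} {Omega : measurableType d}.
Variables (P : probability Omega R) (s : R) (D : Omega -> R).
Hypotheses (s_gt0 : 0 < s) (mD : measurable_fun setT D).
Hypothesis lawD : forall B, measurable B -> P (D @^-1` B) = normal_prob 0 s B.

Let ge0_integral_law (f : R -> \bar R) :
  measurable_fun setT f -> (forall x, (0 <= f x)%E) ->
  (\int[P]_w f (D w) = \int[mu]_x (f x * (normal_pdf 0 s x)%:E))%E.
Proof.
move=> mf f0; rewrite -ge0_integral_normal_prob//.
pose X : {mfun Omega >-> measurableTypeR R} := HB.pack (D : Omega -> measurableTypeR R)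
  (isMeasurableFun.Build _ _ Omega (measurableTypeR R) D mD).
transitivity (\int[pushforward P X]_x f x)%E.
  by rewrite ge0_integral_pushforward// => x _.
exact: (@eq_measure_integral _ _ _ setT (normal_prob 0 s) (distribution P X) f
  (fun B mB _ => lawD mB)).
Qed.

Lemma rv_integrable_normal (g : R -> R) (A : R) : measurable_fun setT g ->
  (forall x, `|g x| <= A * (1 + x ^+ 4)) -> rv_integrable P (g \o D).
Proof.
move=> mg bg; apply/integrableP; split.
  by apply/measurable_EFinP; exact: measurableT_comp.
rewrite (ge0_integral_law (f := fun x => (`|g x|)%:E))//; last first.
  by apply/measurable_EFinP; exact: measurableT_comp.
have := @integrable_normal_pdf_growth R s s_gt0 (fun x => `|g x|) A.
case/(_ _ _)/integrableP => [|x|_].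
- exact: measurableT_comp.
- by rewrite normr_id.
- congr (_ < _)%E; apply: eq_integral => x _.
  by rewrite gee0_abs// lee_fin mulr_ge0 ?normal_pdf_ge0.
Qed.

(** The change of variables is available for nonnegative integrands. Adding [h], the bound itself,
    makes [g] nonnegative, and the contribution of [h] is subtracted again. *)
Lemma mean_normal (g : R -> R) (A : R) : measurable_fun setT g ->
  (forall x, `|g x| <= A * (1 + x ^+ 4)) ->
  mean P (g \o D) = \int[mu]_x (g x * normal_pdf 0 s x).
Proof.
move=> mg bg.
pose h x := A * (1 + x ^+ 4).
have mh : measurable_fun setT h.
  by apply: measurable_funM => //; apply: measurable_funD => //; exact: exprn_measurable.
have h0 x : 0 <= h x by exact: le_trans (bg x).
have bh x : `|h x| <= A * (1 + x ^+ 4) by rewrite ger0_norm.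
have H (f : R -> R) : measurable_fun setT f -> (forall x, 0 <= f x) ->
    mean P (f \o D) = \int[mu]_x (f x * normal_pdf 0 s x).
  move=> mf f0; rewrite /mean /Rintegral.
  rewrite (ge0_integral_law (f := EFin \o f))//.
  exact/measurable_EFinP.
have ig := rv_integrable_normal mg bg.
have ih := rv_integrable_normal mh bh.
have ig' := integrable_normal_pdf_growth s_gt0 mg bg.
have ih' := integrable_normal_pdf_growth s_gt0 mh bh.
have := H (fun x => g x + h x) (measurable_funD mg mh).
rewrite [LHS](_ : _ = mean P (g \o D) + mean P (h \o D)); last first.
  by rewrite -meanD.
rewrite (H h)// => /(_ _) e; apply: (@addIr _ (\int[mu]_x (h x * normal_pdf 0 s x))).
rewrite e; last first.
  by move=> x; have := bg x; rewrite ler_norml -/(h x) => /andP[]; lra.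
rewrite -RintegralD//; congr Rintegral; apply/funext => x; exact: mulrDl.
Qed.

End normal_law.

Section independence.
Context {R : realType} {d : measure_display} {Omega : measurableType d}.
Variables (P : probability Omega R) (X Y : Omega -> R).
Hypotheses (iX : rv_integrable P X) (iY : rv_integrable P Y).
Hypothesis indep : forall A B : set R, measurable A -> measurable B ->
  P (X @^-1` A `&` Y @^-1` B) = (P (X @^-1` A) * P (Y @^-1` B))%E.

Local Notation T := (measurableTypeR R).
Let mX : measurable_fun setT (X : Omega -> T).
Proof. exact: rv_integrable_measurable iX. Qed.
Let mY : measurable_fun setT (Y : Omega -> T).
Proof. exact: rv_integrable_measurable iY. Qed.
Let mXY : measurable_fun setT (fun w => (X w, Y w) : T * T).
Proof. exact/measurable_fun_pairP. Qed.

Let fX : {mfun Omega >-> T} := HB.pack (X : Omega -> T)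
  (isMeasurableFun.Build _ _ _ _ _ mX).
Let fY : {mfun Omega >-> T} := HB.pack (Y : Omega -> T)
  (isMeasurableFun.Build _ _ _ _ _ mY).
Let fXY : {mfun Omega >-> (T * T)%type} := HB.pack (fun w => (X w, Y w) : T * T)
  (isMeasurableFun.Build _ _ _ _ _ mXY).

Let m1 : probability T R := distribution P fX.
Let m2 : probability T R := distribution P fY.

(** Independence says that the law of the pair and the product of the laws agree on rectangles,
    which determines the measure; Fubini then yields the product rule. *)
Let joint (f : T * T -> \bar R) :
  (\int[distribution P fXY]_z f z = \int[m1 \x m2]_z f z)%E.
Proof.
apply: eq_measure_integral => A mA _; apply/esym.
by apply: product_measure_unique => // B C mB mC; exact: indep.
Qed.

Let f : T * T -> R := fun z => z.1 * z.2.
Let mf : measurable_fun setT f.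
Proof. by apply: measurable_funM; [exact: measurable_fst|exact: measurable_snd]. Qed.

Let m1_integrable : m1.-integrable setT (EFin : T -> \bar R).
Proof. by apply: integrable_pushforward. Qed.

Let m2_integrable : m2.-integrable setT (EFin : T -> \bar R).
Proof. by apply: integrable_pushforward. Qed.

Let f_integrable : (m1 \x m2)%E.-integrable setT (EFin \o f).
Proof.
apply/integrable12ltyP; first exact/measurable_EFinP.
have [_ fin1] := integrableP _ _ _ m1_integrable.
have [mid fin2] := integrableP _ _ _ m2_integrable.
have fin2' : (\int[m2]_y `|y%:E|)%E \is a fin_num.
  by rewrite ge0_fin_numE// integral_ge0.
have inner x : (\int[m2]_y `|(EFin \o f) (x, y)| = `|x|%:E * \int[m2]_y `|y%:E|)%E.
  rewrite -ge0_integralZl//; last exact: measurableT_comp.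
  by apply: eq_integral => y _; rewrite /= normrM.
under eq_integral do rewrite inner.
rewrite /= -(fineK fin2') ge0_integralZr ?lee_fin ?fine_ge0 ?integral_ge0//.
  by rewrite lte_mul_pinfty ?integral_ge0 ?ge0_fin_numE ?integral_ge0// ltry.
by apply: measurableT_comp => //; exact: measurable_int m1_integrable.
Qed.

Lemma rv_integrableM_indep : rv_integrable P (fun w => X w * Y w).
Proof.
have [_ fin] := integrableP _ _ _ f_integrable.
apply/integrableP; split.
  apply/measurable_EFinP; apply: measurable_funM.
    exact: rv_integrable_measurable iX.
  exact: rv_integrable_measurable iY.
move: fin; rewrite -joint ge0_integral_pushforward//.
by do 2 apply: measurableT_comp => //.
Qed.

Lemma mean_indep : mean P (fun w => X w * Y w) = mean P X * mean P Y.
Proof.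
have mf' : measurable_fun setT (EFin \o f) by exact/measurable_EFinP.
transitivity (fine (\int[distribution P fXY]_z (f z)%:E)).
  by rewrite integral_pushforward//; exact: rv_integrableM_indep.
rewrite joint -integral12_prod_meas1//.
have mE : measurable_fun setT (EFin : T -> \bar R) by exact/measurable_EFinP.
have m2Y : (\int[m2]_y y%:E = \int[P]_w (Y w)%:E)%E.
  exact: (integral_pushforward mY mE iY measurableT).
have m1X : (\int[m1]_y y%:E = \int[P]_w (X w)%:E)%E.
  exact: (integral_pushforward mX mE iX measurableT).
have inner x : (fubini_F m2 (EFin \o f) x = x%:E * (\int[m2]_y y%:E))%E.
  by rewrite -integralZl.
under eq_integral do rewrite inner.
have fin2 : (\int[m2]_y y%:E)%E \is a fin_num by exact: integrable_fin_num.
have fin1 : (\int[m1]_y y%:E)%E \is a fin_num by exact: integrable_fin_num.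
rewrite /= -(fineK fin2) integralZr// fineM// {1}/mean.
by rewrite m1X m2Y.
Qed.

End independence.

Section sub_sigma_algebra.
Context {R : realType} {d : measure_display} {Omega : measurableType d}.
Variable G : set (set Omega).
Hypotheses (G_sigma : sigma_algebra setT G) (G_sub : G `<=` measurable).
Implicit Types X Y : Omega -> R.

(** Regarding [G] as the sigma-algebra of a type of its own makes all closure properties of
    measurable functions available for adaptedness. *)
Lemma measurable_wrtP X :
  measurable_wrt G X <-> measurable_fun setT (X : g_sigma_algebraType G -> R).
Proof.
have GE : <<s G >> = G by exact: sigma_algebra_id.
split=> [h _ B mB|h B mB].
  by rewrite setTI /measurable/= GE; exact: h.
have := h measurableT B mB.
by rewrite setTI /measurable/= GE.
Qed.

Lemma measurable_wrt_measurable X : measurable_wrt G X -> measurable_fun setT X.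
Proof. by move=> h _ B mB; rewrite setTI; exact/G_sub/h. Qed.

Lemma measurable_wrt_comp X (g : R -> R) : measurable_fun setT g ->
  measurable_wrt G X -> measurable_wrt G (g \o X).
Proof.
move=> mg mX B mB; apply: (mX (g @^-1` B)).
by have := mg measurableT B mB; rewrite setTI.
Qed.

Lemma measurable_wrt_cst (c : R) : measurable_wrt G (fun=> c).
Proof. by apply/measurable_wrtP. Qed.

Lemma measurable_wrtD X Y : measurable_wrt G X -> measurable_wrt G Y ->
  measurable_wrt G (fun w => X w + Y w).
Proof.
by move=> /measurable_wrtP hX /measurable_wrtP hY; apply/measurable_wrtP/measurable_funD.
Qed.

Lemma measurable_wrtB X Y : measurable_wrt G X -> measurable_wrt G Y ->
  measurable_wrt G (fun w => X w - Y w).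
Proof.
by move=> /measurable_wrtP hX /measurable_wrtP hY; apply/measurable_wrtP/measurable_funB.
Qed.

Lemma measurable_wrtM X Y : measurable_wrt G X -> measurable_wrt G Y ->
  measurable_wrt G (fun w => X w * Y w).
Proof.
by move=> /measurable_wrtP hX /measurable_wrtP hY; apply/measurable_wrtP/measurable_funM.
Qed.

Lemma measurable_wrt_sum (I : Type) (s : seq I) (Q : pred I) (X : I -> Omega -> R) :
  (forall i, Q i -> measurable_wrt G (X i)) ->
  measurable_wrt G (fun w => \sum_(i <- s | Q i) X i w).
Proof.
move=> mX; elim: s => [|i s ih].
  by under [X in measurable_wrt _ X]funext do rewrite big_nil; exact: measurable_wrt_cst.
under [X in measurable_wrt _ X]funext do rewrite big_cons.
by case: (boolP (Q i)) => // Qi; apply: measurable_wrtD => //; exact: mX.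
Qed.

Lemma measurable_wrt_indic (A : set Omega) : G A -> measurable_wrt G (\1_A : Omega -> R).
Proof.
move=> GA; apply/measurable_wrtP; apply: measurable_indic.
exact: sub_sigma_algebra.
Qed.

Lemma sub_sigma_algebraT : G setT.
Proof. by case: G_sigma => G0 GC _; rewrite -[X in G X]setD0; exact: GC. Qed.

Lemma sub_sigma_algebraC (A : set Omega) : G A -> G (~` A).
Proof. by case: G_sigma => _ GC _; rewrite -setTD; exact: GC. Qed.

Lemma sub_sigma_algebra_bigcup (A : nat -> set Omega) : (forall i, G (A i)) ->
  G (\bigcup_i A i).
Proof. by case: G_sigma => _ _; apply. Qed.

Lemma sub_sigma_algebraU (A B : set Omega) : G A -> G B -> G (A `|` B).
Proof.
move=> GA GB; rewrite -bigcup2E; apply: sub_sigma_algebra_bigcup => -[|[|i]]//=.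
by case: G_sigma.
Qed.

Lemma sub_sigma_algebra_bigcap (A : nat -> set Omega) : (forall i, G (A i)) ->
  G (\bigcap_i A i).
Proof.
move=> GA; rewrite -[X in G X]setCK setC_bigcap.
by apply/sub_sigma_algebraC/sub_sigma_algebra_bigcup => i; exact: sub_sigma_algebraC.
Qed.

End sub_sigma_algebra.

Section brownian_increments.
Context {R : realType} {d : measure_display} {Omega : measurableType d}.
Variables (P : probability Omega R) (F : R -> set (set Omega)) (W : R -> Omega -> R).
Hypotheses (F_filt : filtration F) (W_bm : brownian_motion P F W).

Lemma filtration_sigma (u : R) : 0 <= u -> sigma_algebra setT (F u).
Proof. by case: F_filt => h _ _; exact: h. Qed.

Lemma filtration_sub (u : R) : 0 <= u -> F u `<=` measurable.
Proof. by case: F_filt => _ h _; exact: h. Qed.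

Lemma measurable_wrt_le (u v : R) (X : Omega -> R) : 0 <= u -> u <= v ->
  measurable_wrt (F u) X -> measurable_wrt (F v) X.
Proof. by case: F_filt => _ _ h u0 uv mX B mB; exact/(h u)/mX. Qed.

Lemma brownian_adapted (u : R) : 0 <= u -> measurable_wrt (F u) (W u).
Proof. by case: W_bm => _ _ h _ _; exact: h. Qed.

Lemma increment_adapted (u v : R) : 0 <= u -> u <= v ->
  measurable_wrt (F v) (fun w => W v w - W u w).
Proof.
move=> u0 uv; apply: measurable_wrtB.
- by apply: filtration_sigma; exact: le_trans uv.
- by apply: brownian_adapted; exact: le_trans uv.
- by apply: measurable_wrt_le uv _ => //; exact: brownian_adapted.
Qed.

Lemma measurable_increment (u v : R) : 0 <= u -> u <= v ->
  measurable_fun setT (fun w => W v w - W u w).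
Proof.
move=> u0 uv; have v0 := le_trans u0 uv.
apply: (measurable_wrt_measurable (G := F v)); first exact: filtration_sub.
exact: increment_adapted.
Qed.

Section increment_moments.
Variables u v : R.
Hypotheses (u0 : 0 <= u) (uv : u <= v).
Let dW w := W v w - W u w.

Let mdW : measurable_fun setT dW. Proof. exact: measurable_increment. Qed.

Let law (ltuv : u < v) B : measurable B -> P (dW @^-1` B) = normal_prob 0 (Num.sqrt (v - u)) B.
Proof. by move=> mB; case: W_bm => _ _ _ _ h; exact: h. Qed.

Lemma rv_integrable_increment (g : R -> R) (A : R) : measurable_fun setT g ->
  (forall x, `|g x| <= A * (1 + x ^+ 4)) -> rv_integrable P (fun w => g (W v w - W u w)).
Proof.
move=> mg bg; move: uv; rewrite le_eqVlt => /predU1P[uvE|ltuv].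
  rewrite uvE; under [X in rv_integrable _ X]funext do rewrite subrr.
  exact: rv_integrable_cst.
by apply: (rv_integrable_normal (s := Num.sqrt (v - u)) _ _ (law ltuv) mg bg) => //;
  rewrite sqrtr_gt0 subr_gt0.
Qed.

Lemma rv_integrable_incrementX (k : nat) : (k <= 4)%N ->
  rv_integrable P (fun w => (W v w - W u w) ^+ k).
Proof.
move=> k4; apply: (@rv_integrable_increment (fun x => x ^+ k) 1).
  exact: exprn_measurable.
by move=> x; rewrite mul1r; exact: norm_powM_le.
Qed.

Lemma increment_moments : [/\ mean P (fun w => W v w - W u w) = 0,
  mean P (fun w => (W v w - W u w) ^+ 2) = v - u &
  mean P (fun w => (W v w - W u w) ^+ 4) = 3 * (v - u) ^+ 2].
Proof.
move: uv; rewrite le_eqVlt => /predU1P[uvE|ltuv].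
  rewrite uvE; split; rewrite ?subrr ?expr0n ?mulr0 -[RHS](mean_cst P 0);
  by congr mean; apply/funext => w; rewrite subrr ?expr0n.
have s0 : 0 < Num.sqrt (v - u) by rewrite sqrtr_gt0 subr_gt0.
have mom (k : nat) : (k <= 4)%N -> mean P (fun w => (W v w - W u w) ^+ k) =
    \int[lebesgue_measure]_x (x ^+ k * normal_pdf 0 (Num.sqrt (v - u)) x).
  move=> k4; apply: (mean_normal (g := fun x => x ^+ k) (A := 1) s0 mdW (law ltuv)).
    exact: exprn_measurable.
  by move=> x; rewrite mul1r; exact: norm_powM_le.
have [m1 m2 m4] := normal_moments s0.
have sq : Num.sqrt (v - u) ^+ 2 = v - u by rewrite sqr_sqrtr// subr_ge0 ltW.
split.
- have -> : (fun w => W v w - W u w) = (fun w => (W v w - W u w) ^+ 1).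
    by apply/funext => w; rewrite expr1.
  rewrite mom// -[RHS]m1; congr Rintegral.
- by rewrite mom// m2.
- by rewrite mom// m4 -[in RHS]sq -exprM.
Qed.

(** This replaces conditioning on [F u]: whatever is known at time [u] factors out of a mean with a
    function of the next increment. *)
Lemma rv_integrableM_increment (Z : Omega -> R) (g : R -> R) :
  measurable_wrt (F u) Z -> rv_integrable P Z ->
  measurable_fun setT g -> rv_integrable P (fun w => g (W v w - W u w)) ->
  rv_integrable P (fun w => Z w * g (W v w - W u w)) /\
  mean P (fun w => Z w * g (W v w - W u w)) =
  mean P Z * mean P (fun w => g (W v w - W u w)).
Proof.
move=> mZ iZ mg ig.
have ind (A B : set R) : measurable A -> measurable B ->
    P (Z @^-1` A `&` (g \o dW) @^-1` B) =
    (P (Z @^-1` A) * P ((g \o dW) @^-1` B))%E.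
  move=> mA mB; have mgB : measurable (g @^-1` B).
    by have := mg measurableT B mB; rewrite setTI.
  case: W_bm => _ _ _ h _; exact: (h u v (Z @^-1` A) (g @^-1` B) u0 uv (mZ _ mA) mgB).
split; first exact: rv_integrableM_indep.
exact: mean_indep.
Qed.

End increment_moments.
End brownian_increments.

Section second_moment.
Context {R : realType} {d : measure_display} {Omega : measurableType d}.
Variable P : probability Omega R.

Lemma mean_sqr_orthogonal (N : nat) (Q : pred 'I_N) (Z : 'I_N -> Omega -> R) :
  (forall i j, rv_integrable P (fun w => Z i w * Z j w)) ->
  (forall i j : 'I_N, (i < j)%N -> mean P (fun w => Z i w * Z j w) = 0) ->
  rv_integrable P (fun w => (\sum_(i < N | Q i) Z i w) ^+ 2) /\
  mean P (fun w => (\sum_(i < N | Q i) Z i w) ^+ 2) =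
  \sum_(i < N | Q i) mean P (fun w => Z i w ^+ 2).
Proof.
move=> iZ oZ.
have E : (fun w => (\sum_(i < N | Q i) Z i w) ^+ 2) =
    (fun w => \sum_(i < N | Q i) \sum_(j < N | Q j) Z i w * Z j w).
  apply/funext => w; rewrite expr2 big_distrl/=; apply: eq_bigr => i _.
  by rewrite big_distrr.
rewrite E; split.
  by apply: rv_integrable_sum => i _; apply: rv_integrable_sum.
rewrite mean_sum; last by move=> i _; apply: rv_integrable_sum.
apply: eq_bigr => i Qi; rewrite mean_sum// (bigD1 i)//= big1 ?addr0.
  by congr mean; apply/funext => w; rewrite expr2.
move=> j /andP[_ ji]; case: (ltngtP i j) => [ij|ij|/val_inj ij].
- exact: oZ.
- by rewrite -[RHS](oZ _ _ ij); congr mean; apply/funext => w; rewrite mulrC.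
- by rewrite ij eqxx in ji.
Qed.

Definition prob (A : set Omega) : R := fine (P A).

Lemma probE (A : set Omega) : measurable A -> P A = (prob A)%:E.
Proof. by move=> mA; rewrite /prob fineK//; exact: fin_num_measure. Qed.

Lemma prob_ge0 (A : set Omega) : 0 <= prob A.
Proof. exact: fine_ge0. Qed.

Lemma prob_le (A B : set Omega) : measurable A -> measurable B -> A `<=` B ->
  prob A <= prob B.
Proof.
by move=> mA mB AB; rewrite -lee_fin -!probE//; apply: le_measure; rewrite ?inE.
Qed.

Lemma prob_setU (A B : set Omega) : measurable A -> measurable B ->
  prob (A `|` B) <= prob A + prob B.
Proof.
move=> mA mB; rewrite -lee_fin EFinD -!probE//; last exact: measurableU.
exact: measureU2.
Qed.

Lemma prob_le_setU (A B C : set Omega) : measurable A -> measurable B -> measurable C ->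
  A `<=` B `|` C -> prob A <= prob B + prob C.
Proof.
move=> mA mB mC ABC; apply: le_trans (prob_setU mB mC).
by apply: prob_le => //; exact: measurableU.
Qed.

Lemma measurable_ge_rv (X : Omega -> R) (e : R) : measurable_fun setT X ->
  measurable [set w | e <= X w].
Proof. by move=> mX; rewrite -[X in measurable X]setTI; exact: measurable_fun_le. Qed.

Lemma measurable_gt_rv (X : Omega -> R) (e : R) : measurable_fun setT X ->
  measurable [set w | e < X w].
Proof. move=> mX; have -> : [set w | e < X w] = ~` (setT `&` [set w | X w <= e]).
  by rewrite setTI; apply/seteqP; split=> w /=; rewrite ltNge => /negP.
by apply: measurableC; exact: measurable_fun_le. Qed.

Lemma prob_markov (X : Omega -> R) (e : R) : rv_integrable P X ->
  (forall w, 0 <= X w) -> 0 < e -> prob [set w | e <= X w] <= mean P X / e.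
Proof.
move=> iX X0 e0; have mX := rv_integrable_measurable iX.
have mA := measurable_ge_rv e mX.
rewrite ler_pdivlMr// -lee_fin EFinM -probE// prob_mean// -EFinM lee_fin.
rewrite mulrC -meanZ; last exact: rv_integrable_indic.
apply: mean_le => //; first by apply: rv_integrableZ; exact: rv_integrable_indic.
move=> w; rewrite indicE; case: (boolP (_ \in _)) => [|_]; rewrite ?mulr0// mulr1.
by rewrite inE.
Qed.

Lemma prob_cvg0 (X : nat -> Omega -> R) (e : R) : 0 < e ->
  (forall n, measurable_fun setT (X n)) ->
  (forall w, X n w @[n --> \oo] --> 0) ->
  prob [set w | e <= `|X n w|] @[n --> \oo] --> 0.
Proof.
move=> e0 mX cX.
have mA n : measurable [set w | e <= `|X n w|].
  by apply: measurable_ge_rv; exact: measurableT_comp.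
have -> : (fun n => prob [set w | e <= `|X n w|]) =
    (fun n => mean P \1_[set w | e <= `|X n w|]).
  by apply/funext => n; rewrite /prob prob_mean.
rewrite -(mean_cst P 0); apply: (@mean_cvg _ _ _ P _ _ 1).
- by move=> n; exact: measurable_indic.
- by move=> n w; rewrite indicE; case: (_ \in _); rewrite ?normr0 ?normr1.
- move=> w; apply: cvg_near_cst.
  have /cvgrPdist_lt/(_ _ e0) := cX w; apply: filterS => n.
  rewrite sub0r normrN => h; rewrite indicE memNset//= .
  by apply/negP; rewrite -ltNge.
Qed.

End second_moment.

(** * Simple Ito integrals and Riemann sums *)

Section truncated_ito_sums.
Context {R : realType} {d : measure_display} {Omega : measurableType d}.
Variables (P : probability Omega R) (F : R -> set (set Omega)) (W : R -> Omega -> R).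
Hypotheses (F_filt : filtration F) (W_bm : brownian_motion P F W).
Variables (N : nat) (g : nat -> R) (h : nat -> Omega -> R) (eta : R).
Hypotheses (g0 : 0 <= g 0%N) (g_le : forall i, (i < N)%N -> g i <= g i.+1).
Hypothesis h_adapted : forall i, (i < N)%N -> measurable_wrt (F (g i)) (h i).
Hypothesis eta_ge0 : 0 <= eta.

Let delta i := g i.+1 - g i.
Let dW i w := W (g i.+1) w - W (g i) w.
Definition energy (n : nat) (w : Omega) : R := \sum_(i < n) h i w ^+ 2 * (g i.+1 - g i).
(* Dropping the terms beyond energy [eta] makes the sum square integrable and
   alters it only where the total energy exceeds [eta]. *)
Let c i : set Omega := [set w | energy i.+1 w <= eta].
(** The last factor discards cells of length zero: there the energy does not control [h], and the
    increment of [W] vanishes anyway. Without those cells [k i] is bounded. *)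
Let k i w : R := h i w * \1_(c i) w * (0 < delta i)%R%:R.

Let g_homo i j : (i <= j)%N -> (j <= N)%N -> g i <= g j.
Proof.
elim: j => [|j ih]; first by rewrite leqn0 => /eqP ->.
rewrite leq_eqVlt => /predU1P[->//|]; rewrite ltnS => ij jN.
by apply: le_trans (g_le jN); apply: ih => //; exact: ltnW.
Qed.

Let gN_ge0 i : (i <= N)%N -> 0 <= g i.
Proof. by move=> iN; apply: le_trans g0 _; exact: g_homo. Qed.

Let delta_ge0 i : (i < N)%N -> 0 <= delta i.
Proof. by move=> iN; rewrite subr_ge0 g_le. Qed.

Let h_adapted_le i j : (i <= j)%N -> (j < N)%N -> measurable_wrt (F (g j)) (h i).
Proof.
move=> ij jN; have iN := leq_ltn_trans ij jN.
apply: (measurable_wrt_le F_filt _ _ (h_adapted iN)); first exact: gN_ge0 (ltnW iN).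
exact: g_homo (ltnW jN).
Qed.

Let F_sigma i : (i <= N)%N -> sigma_algebra setT (F (g i)).
Proof. by move=> iN; apply: (filtration_sigma F_filt); exact: gN_ge0. Qed.

(** The energy through cell [i] involves only [h 0], ..., [h i], all known at the left end of that
    cell. The truncation therefore does not anticipate. *)
Lemma energy_adapted i : (i < N)%N -> measurable_wrt (F (g i)) (energy i.+1).
Proof.
move=> iN; have Fs := F_sigma (ltnW iN); apply: measurable_wrt_sum => // j _.
apply: measurable_wrtM => //; last exact: measurable_wrt_cst.
have hj : measurable_wrt (F (g i)) (h j).
  by apply: h_adapted_le => //; rewrite -ltnS ltn_ord.
by apply: (measurable_wrt_comp (g := fun x => x ^+ 2)) => //; exact: exprn_measurable.
Qed.

Let c_adapted i : (i < N)%N -> F (g i) (c i).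
Proof.
move=> iN; apply: (energy_adapted iN (B := `]-oo, eta]%classic)) => //.
Qed.

Let k_adapted i : (i < N)%N -> measurable_wrt (F (g i)) (k i).
Proof.
move=> iN; have Fs := F_sigma (ltnW iN).
apply: measurable_wrtM => //; last exact: measurable_wrt_cst.
apply: measurable_wrtM => //; first exact: h_adapted.
by apply: measurable_wrt_indic => //; exact: c_adapted.
Qed.

Let energyS n w : energy n.+1 w = energy n w + h n w ^+ 2 * delta n.
Proof. by rewrite /energy big_ord_recr. Qed.

Let energy_le m n w : (m <= n)%N -> (n <= N)%N -> energy m w <= energy n w.
Proof.
elim: n => [|n ih]; first by rewrite leqn0 => /eqP ->.
rewrite leq_eqVlt => /predU1P[->//|]; rewrite ltnS => mn nN.
rewrite energyS; apply: (le_trans (ih mn (ltnW nN))); rewrite lerDl.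
by rewrite mulr_ge0 ?sqr_ge0// delta_ge0.
Qed.

Let energy_ge0 n w : (n <= N)%N -> 0 <= energy n w.
Proof. by move=> nN; have := @energy_le 0 n w; rewrite {1}/energy big_ord0; apply. Qed.

Let k2delta i w : (i < N)%N -> k i w ^+ 2 * delta i =
  if energy i.+1 w <= eta then h i w ^+ 2 * delta i else (0 : R).
Proof.
move=> iN; rewrite /k indicE; case: ifPn => Ei; last first.
  rewrite memNset; last exact/negP.
  by rewrite mulr0 mul0r expr0n/= mul0r.
rewrite mem_set//= mulr1; case: ltP => [_|d0]; first by rewrite mulr1.
have -> : delta i = 0 by apply/eqP; rewrite eq_le d0 delta_ge0.
by rewrite !mulr0.
Qed.

(** Energy is nondecreasing, so the retained cells form an initial segment. The induction needs both
    bounds: a retained cell gets the second one from the first. *)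
Let sum_k2_le n w : (n <= N)%N ->
  \sum_(i < n) k i w ^+ 2 * delta i <= energy n w /\
  \sum_(i < n) k i w ^+ 2 * delta i <= eta.
Proof.
elim: n => [_|n ih nN]; first by rewrite /energy !big_ord0.
rewrite big_ord_recr/= k2delta//; have [ih1 ih2] := ih (ltnW nN).
case: ifPn => Ei; rewrite energyS; last first.
  rewrite addr0; split => //; apply: (le_trans ih1).
  by rewrite lerDl mulr_ge0 ?sqr_ge0// delta_ge0.
split; first by rewrite lerD2r.
by apply: le_trans Ei; rewrite energyS lerD2r.
Qed.

Let k2delta_le i w : (i < N)%N -> k i w ^+ 2 * delta i <= eta.
Proof.
move=> iN; rewrite k2delta//; case: ifPn => // Ei.
apply: le_trans Ei; rewrite energyS lerDr.
by rewrite energy_ge0// ltnW.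
Qed.

Let k_bounded i : (i < N)%N -> exists M, forall w, `|k i w| <= M.
Proof.
move=> iN; have [d0|d0] := ltP 0 (delta i); last first.
  by exists 0 => w; rewrite /k ltNge d0/= mulr0 normr0.
exists (1 + eta / delta i) => w.
have h1 : k i w ^+ 2 <= eta / delta i by rewrite ler_pdivlMr// k2delta_le.
have : `|k i w| <= 1 + k i w ^+ 2.
  rewrite -[k i w ^+ 2]real_normK ?num_real//.
  by have := sqr_ge0 (`|k i w| - 1); have := normr_ge0 (k i w); nra.
by move=> h2; apply: (le_trans h2); rewrite lerD2l.
Qed.

Let Z (i : 'I_N) w := k i w * dW i w.

Let mk i : (i < N)%N -> measurable_fun setT (k i).
Proof.
move=> iN; apply: (measurable_wrt_measurable (G := F (g i))); last exact: k_adapted.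
by apply: (filtration_sub F_filt); exact: gN_ge0 (ltnW iN).
Qed.

Let idW i : (i < N)%N -> rv_integrable P (dW i).
Proof.
move=> iN; have := @rv_integrable_incrementX _ _ _ P F W F_filt W_bm _ _ (gN_ge0 (ltnW iN)) (g_le iN) 1 isT.
by under [X in rv_integrable _ X]funext do rewrite expr1.
Qed.

(** For i < j the product of [k j] with the whole term [i] is known at time [g j], and the increment
    over cell [j] has mean zero. *)
Let ZZ (i j : 'I_N) : (i < j)%N ->
  rv_integrable P (fun w => Z i w * Z j w) /\ mean P (fun w => Z i w * Z j w) = 0.
Proof.
move=> ij.
have iN := ltn_ord i; have jN := ltn_ord j.
have Fs := F_sigma (ltnW jN).
pose Y w := k j w * (k i w * dW i w).
have mY : measurable_wrt (F (g j)) Y.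
  apply: measurable_wrtM => //; first exact: k_adapted.
  have gij : g i.+1 <= g j by apply: g_homo => //; exact: ltnW.
  apply: measurable_wrtM => //.
    apply: (measurable_wrt_le F_filt (gN_ge0 (ltnW iN)) _ (k_adapted iN)).
    exact: g_homo (ltnW ij) (ltnW jN).
  apply: (measurable_wrt_le F_filt (gN_ge0 iN) gij).
  by apply: (increment_adapted F_filt W_bm) => //; [exact: gN_ge0 (ltnW iN)|exact: g_le].
have [Mi bi] := k_bounded iN; have [Mj bj] := k_bounded jN.
have iY : rv_integrable P Y.
  apply: rv_integrableM_bounded bj _ => //; first exact: mk.
  by apply: rv_integrableM_bounded bi _ => //; [exact: mk|exact: idW].
have [] := @rv_integrableM_increment _ _ _ P F W W_bm (g j) (g j.+1)
  (gN_ge0 (ltnW jN)) (g_le jN) Y id mY iY (@measurable_id _ _ _) (idW jN).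
have [m1 _ _] := increment_moments F_filt W_bm (gN_ge0 (ltnW jN)) (g_le jN).
rewrite /= m1 mulr0.
have -> : (fun w => Y w * (W (g j.+1) w - W (g j) w)) = (fun w => Z i w * Z j w).
  by apply/funext => w; rewrite /Y /Z /dW; ring.
by [].
Qed.

Let Z2 (i : 'I_N) : rv_integrable P (fun w => Z i w * Z i w) /\
  mean P (fun w => Z i w ^+ 2) = mean P (fun w => k i w ^+ 2 * delta i).
Proof.
have iN := ltn_ord i; have [M bM] := k_bounded iN.
have Fs := F_sigma (ltnW iN).
have mk2 : measurable_wrt (F (g i)) (fun w => k i w ^+ 2).
  apply: (measurable_wrt_comp (g := fun x => x ^+ 2)); first exact: exprn_measurable.
  exact: k_adapted.
have ik2 : rv_integrable P (fun w => k i w ^+ 2).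
  apply: (@rv_integrable_bounded _ _ _ _ _ (M ^+ 2)) => [|w].
    exact: measurable_funX (mk iN).
  by rewrite normrX ler_pXn2r// nnegrE// (le_trans _ (bM w)).
have [_ m2 _] := increment_moments F_filt W_bm (gN_ge0 (ltnW iN)) (g_le iN).
have [] := @rv_integrableM_increment _ _ _ P F W W_bm (g i) (g i.+1)
  (gN_ge0 (ltnW iN)) (g_le iN) (fun w => k i w ^+ 2) (fun x => x ^+ 2) mk2 ik2
  (exprn_measurable _) (rv_integrable_incrementX F_filt W_bm (gN_ge0 (ltnW iN)) (g_le iN) (isT : (2 <= 4)%N)).
rewrite m2 => iZ mZ.
have E : (fun w => k i w ^+ 2 * (W (g i.+1) w - W (g i) w) ^+ 2) = (fun w => Z i w ^+ 2).
  by apply/funext => w; rewrite /Z /dW [RHS]exprMn.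
split.
  by move: iZ; rewrite E; under [X in rv_integrable _ X]funext do rewrite expr2.
move: mZ; rewrite E => ->.
rewrite mulrC -meanZ//; congr mean; apply/funext => w; exact: mulrC.
Qed.

(** The Ito isometry for the truncated sum, for several blocks of cells at once; the condition on
    [Q] says that no cell lies in two blocks. A single block controls an integral, one block per
    coarse cell controls a sum of squares. *)
Lemma truncated_ito : exists k' : nat -> Omega -> R,
  [/\ forall w, energy N w <= eta -> forall i, (i < N)%N ->
        k' i w * (W (g i.+1) w - W (g i) w) = h i w * (W (g i.+1) w - W (g i) w),
      forall Q : pred 'I_N, rv_integrable P
         (fun w => (\sum_(i < N | Q i) k' i w * (W (g i.+1) w - W (g i) w)) ^+ 2) &
      forall (m : nat) (Q : 'I_m -> pred 'I_N), (forall i, \sum_(j < m) (Q j i : nat) <= 1)%N ->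
        mean P (fun w => \sum_(j < m)
          (\sum_(i < N | Q j i) k' i w * (W (g i.+1) w - W (g i) w)) ^+ 2) <= eta].
Proof.
have ort Q := @mean_sqr_orthogonal _ _ _ P N Q Z.
have iZ (i j : 'I_N) : rv_integrable P (fun w => Z i w * Z j w).
  case: (ltngtP i j) => [ij|ij|/val_inj ->].
  - by have [] := ZZ ij.
  - by have [+ _] := ZZ ij; under [X in rv_integrable _ X]funext do rewrite mulrC.
  - by have [] := Z2 j.
have oZ (i j : 'I_N) : (i < j)%N -> mean P (fun w => Z i w * Z j w) = 0.
  by move=> ij; have [] := ZZ ij.
exists k; split.
- move=> w Ew i iN; rewrite /k indicE mem_set; last first.
    by rewrite /c/=; apply: le_trans Ew; exact: energy_le.
  rewrite mulr1; case: ltP => [_|d0]; first by rewrite mulr1.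
  have -> : g i.+1 = g i.
    by apply/eqP; rewrite -subr_eq0 eq_le d0 delta_ge0.
  by rewrite subrr !mulr0.
- by move=> Q; have [] := ort Q iZ oZ.
- move=> m Q Q1; rewrite mean_sum; last by move=> j _; have [] := ort (Q j) iZ oZ.
  under eq_bigr => j _ do rewrite (ort (Q j) iZ oZ).2.
  under eq_bigr => j _ do rewrite big_mkcond/=.
  rewrite exchange_big/=.
  apply: (@le_trans _ _ (\sum_(i < N) mean P (fun w => k i w ^+ 2 * delta i))).
    apply: ler_sum => i _; rewrite -big_mkcond/= sumr_const.
    rewrite (Z2 i).2 -[leRHS]mulr1n ler_wpMn2l//.
      by apply: mean_ge0 => w; rewrite mulr_ge0 ?sqr_ge0// delta_ge0.
    rewrite -sum1_card big_mkcond/=; apply: leq_trans (Q1 i).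
    by apply: leq_sum => j _; rewrite unfold_in; case: (Q j i).
  rewrite -mean_sum; last first.
    move=> i _; apply: (@rv_integrable_bounded _ _ _ _ _ eta) => [|w].
      by apply: measurable_funM => //; apply: measurable_funX; exact: mk.
    by rewrite ger0_norm ?k2delta_le// mulr_ge0 ?sqr_ge0 ?delta_ge0.
  rewrite -(mean_cst P eta); apply: mean_le.
  + apply: rv_integrable_sum => i _; apply: (@rv_integrable_bounded _ _ _ _ _ eta) => [|w].
      by apply: measurable_funM => //; apply: measurable_funX; exact: mk.
    by rewrite ger0_norm ?k2delta_le// mulr_ge0 ?sqr_ge0 ?delta_ge0.
  + exact: rv_integrable_cst.
  + by move=> w; have [] := @sum_k2_le N w (leqnn N).
Qed.

End truncated_ito_sums.

(** An estimate of Lenglart type. Where the energy is at most [eta] the sum equals its truncated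
    version, to which Markov's inequality and the isometry apply. No moments of [h] are required. *)
Lemma truncated_ito_prob {R : realType} {d : measure_display} {Omega : measurableType d}
  (P : probability Omega R) (F : R -> set (set Omega)) (W : R -> Omega -> R)
  (N : nat) (g : nat -> R) (h : nat -> Omega -> R) (eta eps : R)
  (m : nat) (Q : 'I_m -> pred 'I_N) :
  filtration F -> brownian_motion P F W -> 0 <= g 0%N ->
  (forall i, (i < N)%N -> g i <= g i.+1) ->
  (forall i, (i < N)%N -> measurable_wrt (F (g i)) (h i)) ->
  (forall i, \sum_(j < m) (Q j i : nat) <= 1)%N -> 0 <= eta -> 0 < eps ->
  prob P [set w | eps <= \sum_(j < m)
      (\sum_(i < N | Q j i) h i w * (W (g i.+1) w - W (g i) w)) ^+ 2] <=
  prob P [set w | eta < energy g h N w] + eta / eps.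
Proof.
move=> F_filt W_bm g0 gle ah Q1 eta0 eps0.
have [k [kE ik /(_ m Q Q1) mk]] := truncated_ito F_filt W_bm g0 gle ah eta0.
pose Z w := \sum_(j < m) (\sum_(i < N | Q j i) k i w * (W (g i.+1) w - W (g i) w)) ^+ 2.
have iZ : rv_integrable P Z by apply: rv_integrable_sum => j _; exact: ik.
have gg i : (i <= N)%N -> 0 <= g i.
  by elim: i => // i ih iN; apply: le_trans (ih (ltnW iN)) (gle i iN).
have mh i : (i < N)%N -> measurable_fun setT (h i).
  move=> iN; apply: (measurable_wrt_measurable _ (ah i iN)).
  by apply: (filtration_sub F_filt); exact: gg (ltnW iN).
have mE : measurable_fun setT (energy g h N).
  by apply: measurable_sum => i; apply: measurable_funM => //; apply: measurable_funX; exact: mh.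
apply: (@le_trans _ _ (prob P [set w | eta < energy g h N w] + prob P [set w | eps <= Z w])).
  apply: prob_le_setU.
  - apply: measurable_ge_rv; apply: measurable_sum => j; apply: measurable_funX.
    under [X in measurable_fun _ X]funext do rewrite big_mkcond.
    apply: measurable_sum => i; case: (boolP (Q j i)) => _; last exact: measurable_cst.
    apply: measurable_funM; first exact: mh.
    by apply: (measurable_increment F_filt W_bm); [exact: gg (ltnW (ltn_ord i))|exact: gle].
  - exact: measurable_gt_rv.
  - by apply: measurable_ge_rv; exact: rv_integrable_measurable iZ.
  - move=> w /= hw; have [hE|hE] := ltP eta (energy g h N w); [by left|right].
    apply: (le_trans hw); rewrite le_eqVlt; apply/orP; left; apply/eqP.
    apply: eq_bigr => j _; congr (_ ^+ 2); apply: eq_bigr => i _.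
    by rewrite kE.
rewrite lerD2l; apply: (le_trans (prob_markov iZ _ eps0)).
  by move=> w; apply: sumr_ge0 => j _; exact: sqr_ge0.
by rewrite ler_pM2r ?invr_gt0.
Qed.

(** * Grids, common refinements and telescoping sums *)

Section step_grids.
Context {R : realType}.
Implicit Types (g : nat -> R) (N : nat).

Definition grid_on (a b : R) N g :=
  [/\ g 0%N = a, g N = b & forall i, (i < N)%N -> g i <= g i.+1].

Lemma grid_homo a b N g i j : grid_on a b N g ->
  (i <= j)%N -> (j <= N)%N -> g i <= g j.
Proof.
move=> [_ _ gle]; elim: j => [|j ih]; first by rewrite leqn0 => /eqP ->.
rewrite leq_eqVlt => /predU1P[->//|]; rewrite ltnS => ij jN.
by apply: le_trans (gle _ jN); apply: ih => //; exact: ltnW.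
Qed.

Lemma grid_in a b N g j : grid_on a b N g -> (j <= N)%N -> a <= g j <= b.
Proof.
move=> gg jN; have h1 := grid_homo gg (leq0n j) jN; have h2 := grid_homo gg jN (leqnn N).
by have [<- <- _] := gg; rewrite h1 h2.
Qed.

Lemma grid_lt_inv a b N g i j : grid_on a b N g -> (i <= N)%N ->
  g i < g j -> (i < j)%N.
Proof.
move=> gg iN gij; rewrite ltnNge; apply/negP => ji.
by have := grid_homo gg ji iN; rewrite leNgt gij.
Qed.

Lemma grid_cell a b N g v : grid_on a b N g -> a < v <= b ->
  exists2 j, (j < N)%N & g j < v <= g j.+1.
Proof.
move=> [ga gb _] /andP[av vb].
have : g N >= v by rewrite gb.
have : g 0%N < v by rewrite ga.
move=> h0; elim: N {ga gb} => [|n ih] hn; first by rewrite leNgt h0 in hn.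
have [vn|nv] := leP v (g n); last by exists n => //; rewrite nv.
by have [j jn hj] := ih vn; exists j => //; exact: ltnW.
Qed.

Lemma grid_sum_indic a b N g j (c : nat -> R) v : grid_on a b N g -> (j < N)%N ->
  g j < v <= g j.+1 ->
  \sum_(i < N) c i * \1_(`]g i, g i.+1]) v = c j.
Proof.
move=> gg jN /andP[jv vj]; rewrite (bigD1 (Ordinal jN))//= indicE mem_set/=; last first.
  by rewrite in_itv/= jv vj.
rewrite mulr1 big1 ?addr0// => i ij; rewrite indicE memNset ?mulr0//=.
rewrite in_itv/= => /andP[iv vi].
have h1 : (i < j.+1)%N by apply: (grid_lt_inv gg (ltnW (ltn_ord i))); exact: lt_le_trans iv vj.
have h2 : (j < i.+1)%N by apply: (grid_lt_inv gg (ltnW jN)); exact: lt_le_trans jv vi.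
by move/eqP: ij; apply; apply: val_inj => /=; apply/eqP; rewrite eqn_leq -ltnS h1 -ltnS h2.
Qed.

(** Nodes may coincide, so a cell after node [j] can still pass the test; it is then degenerate and
    contributes nothing. *)
Lemma grid_telescope a b N g (f : R -> R) j : grid_on a b N g -> (j <= N)%N ->
  \sum_(i < N) (g i.+1 <= g j)%R%:R * (f (g i.+1) - f (g i)) = f (g j) - f a.
Proof.
move=> gg jN; have [<- _ gle] := gg.
rewrite -(big_mkord xpredT (fun i => (g i.+1 <= g j)%R%:R * (f (g i.+1) - f (g i)))).
rewrite (big_cat_nat (leq0n j) jN)//= [X in _ + X]big1_seq ?addr0; last first.
  move=> i; rewrite mem_index_iota => /andP[_ /andP[ji iN]].
  case: leP => [h|]; rewrite ?mul0r// mul1r.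
  have -> : g i.+1 = g i; last by rewrite subrr.
  apply/eqP; rewrite eq_le gle// andbT (le_trans h)//.
  exact: (grid_homo gg ji (ltnW iN)).
rewrite -(telescope_sumr (fun i => f (g i)) (leq0n j)).
apply: eq_big_nat => i /andP[_ ij]; rewrite (grid_homo gg ij jN) mul1r//.
Qed.

(* Neither endpoint of a step lies strictly inside a cell of the grid. *)
Definition refines (t : nat -> R) n N g :=
  forall i, (i <= n)%N -> exists2 j, (j <= N)%N & t i = g j.

(** Step processes live on left-open intervals, so the right end is the node that represents a
    cell. *)
Lemma refines_indic a b N g s t j k l v : grid_on a b N g ->
  (k <= N)%N -> (l <= N)%N -> (j < N)%N -> s = g k -> t = g l -> g j < v <= g j.+1 ->
  \1_(`]s, t]) v = \1_(`]s, t]) (g j.+1) :> R.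
Proof.
move=> gg kN lN jN -> -> /andP[jv vj]; rewrite !indicE.
have -> // : (v \in `]g k, g l]%classic) = (g j.+1 \in `]g k, g l]%classic).
apply/idP/idP; rewrite !inE/= !in_itv/= => /andP[h1 h2]; apply/andP; split.
- exact: lt_le_trans h1 vj.
- by apply: (grid_homo gg _ lN); apply: (grid_lt_inv gg (ltnW jN)); exact: lt_le_trans jv h2.
- apply: le_lt_trans jv; apply: (grid_homo gg _ (ltnW jN)).
  by rewrite -ltnS; apply: (grid_lt_inv gg kN).
- exact: le_trans vj h2.
Qed.

(** The grid is the sorted list of all nodes of both; repetitions are kept. *)
Lemma common_grid a b (t t' : nat -> R) n n' : grid_on a b n t -> grid_on a b n' t' ->
  exists N g, [/\ grid_on a b N g, refines t n N g & refines t' n' N g].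
Proof.
move=> gt gt'.
pose s := sort <=%R ([seq t i | i <- iota 0 n.+1] ++ [seq t' i | i <- iota 0 n'.+1]).
have ms x : x \in s -> a <= x <= b.
  rewrite mem_sort mem_cat => /orP[] /mapP[i]; rewrite mem_iota add0n ltnS => /andP[_ iN] ->.
    have [<- <- _] := gt; by rewrite (grid_homo gt)//= (grid_homo gt).
  have [<- <- _] := gt'; by rewrite (grid_homo gt')//= (grid_homo gt').
have ts i : (i <= n)%N -> t i \in s.
  by move=> iN; rewrite mem_sort mem_cat map_f// mem_iota.
have ts' i : (i <= n')%N -> t' i \in s.
  by move=> iN; rewrite mem_sort mem_cat orbC map_f// mem_iota.
have ss : sorted <=%R s by apply: sort_sorted; exact: le_total.
have s0 : (0 < size s)%N by have := ts 0%N isT; case: (s).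
pose g i := nth b s i.
have gle i j : (i <= j)%N -> (j < size s)%N -> g i <= g j.
  move=> ij js; apply: (sorted_leq_nth le_trans le_refl) => //; rewrite inE//.
  exact: leq_ltn_trans js.
have ex x : x \in s -> exists2 j, (j <= (size s).-1)%N & x = g j.
  move=> xs; exists (index x s); last by rewrite /g nth_index.
  by rewrite -ltnS prednK// index_mem.
exists (size s).-1, g; split; [split|by move=> i /ts/ex|by move=> i /ts'/ex].
- have [<- _ _] := gt; have [j jN tj] := ex _ (ts 0%N isT).
  apply/eqP; rewrite eq_le; apply/andP; split.
    by rewrite tj; apply: gle => //; rewrite -(prednK s0) ltnS.
  by have [ta _ _] := gt; rewrite ta; have /andP[] := ms (g 0%N) (mem_nth _ s0).
- have [_ <- _] := gt; have [j jN tj] := ex _ (ts n (leqnn n)).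
  apply/eqP; rewrite eq_le; apply/andP; split; last first.
    by rewrite tj; apply: gle => //; rewrite (prednK s0).
  have [_ tb _] := gt; rewrite tb.
  have gs : g (size s).-1 \in s by apply: mem_nth; rewrite prednK.
  by have /andP[] := ms _ gs.
- by move=> i iN; apply: gle => //; rewrite -ltn_predRL.
Qed.

End step_grids.

Lemma indic_oc {R : realType} (s t v : R) : \1_(`]s, t]) v = (s < v <= t)%R%:R :> R.
Proof.
rewrite indicE; congr (nat_of_bool _)%:R.
by apply/idP/idP; rewrite inE/= in_itv.
Qed.

Section step_processes.
Context {R : realType} {d : measure_display} {Omega : measurableType d}.
Local Notation mu := (@lebesgue_measure R).
Local Notation step_process := (@step_process R d Omega).
Implicit Types (X Y : step_process) (W H : R -> Omega -> R).
Variables (P : probability Omega R) (F : R -> set (set Omega)).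

Definition step_grid a b X := grid_on a b (step_size X) (step_time X).

Definition step_refines X N g := refines (step_time X) (step_size X) N g.

Definition adapted_steps X := forall i, (i < step_size X)%N ->
  measurable_wrt (F (step_time X i)) (step_coef X i).

(** The indicator of a step is the difference of two tests of the form [g j.+1 <= g l], and each of
    them telescopes. *)
Lemma step_integral_grid W a b X N g w : step_grid a b X -> grid_on a b N g ->
  step_refines X N g ->
  step_integral W X w =
  \sum_(j < N) step_val X (g j.+1) w * (W (g j.+1) w - W (g j) w).
Proof.
move=> gX gg rX; under [RHS]eq_bigr do rewrite /step_val big_distrl/=.
rewrite exchange_big/=; apply: eq_bigr => i _.
have iX := ltn_ord i.
under eq_bigr do rewrite -mulrA.
rewrite -big_distrr/=; congr (_ * _).
have [k kN tk] := rX i (ltnW iX); have [l lN tl] := rX i.+1 iX.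
have tt : step_time X i <= step_time X i.+1 by have [_ _] := gX; exact.
have E (j : 'I_N) : \1_(`]step_time X i, step_time X i.+1]) (g j.+1) =
    (g j.+1 <= g l)%R%:R - (g j.+1 <= g k)%R%:R :> R.
  rewrite indic_oc tk tl; move: tt; rewrite tk tl => tt.
  case: (ltP (g k)) => [h|h]; first by rewrite /= subr0.
  by rewrite /= (le_trans h tt) subrr.
under eq_bigr do rewrite E mulrBl.
rewrite sumrB (grid_telescope (fun u => W u w) gg lN) (grid_telescope (fun u => W u w) gg kN).
by rewrite -tl -tk; lra.
Qed.

Lemma step_val_cell a b X N g j v w : step_grid a b X -> grid_on a b N g ->
  step_refines X N g -> (j < N)%N -> g j < v <= g j.+1 ->
  step_val X v w = step_val X (g j.+1) w.
Proof.
move=> gX gg rX jN jv; apply: eq_bigr => i _; congr (_ * _).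
have [k kN tk] := rX i (ltnW (ltn_ord i)); have [l lN tl] := rX i.+1 (ltn_ord i).
exact: (refines_indic gg kN lN jN tk tl jv).
Qed.

(** A step that is active at the right end of a cell starts before that point, hence, its start
    being a node, no later than the left end. *)
Lemma step_val_adapted a b X N g j : filtration F -> 0 <= a -> step_grid a b X ->
  grid_on a b N g ->
  step_refines X N g -> adapted_steps X -> (j < N)%N ->
  measurable_wrt (F (g j)) (step_val X (g j.+1)).
Proof.
move=> F_filt a0 gX gg rX aX jN.
have gj0 : 0 <= g j.
  by have [ga _ _] := gg; rewrite (le_trans a0)// -ga (grid_homo gg)// ltnW.
have Fs := filtration_sigma F_filt gj0.
apply: measurable_wrt_sum => // i _; have iX := ltn_ord i.
rewrite indic_oc; case: (boolP (_ < _ <= _)) => [|_]; last first.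
  by under [X in measurable_wrt _ X]funext do rewrite mulr0; exact: measurable_wrt_cst.
move=> /andP[h _].
under [X in measurable_wrt _ X]funext do rewrite mulr1.
have [k kN tk] := rX i (ltnW iX).
apply: (measurable_wrt_le F_filt _ _ (aX i iX)).
  by have [ga _ _] := gX; rewrite (le_trans a0)// -ga (grid_homo gX)// ltnW.
rewrite tk; apply: (grid_homo gg _ (ltnW jN)).
by rewrite -ltnS; apply: (grid_lt_inv gg kN); rewrite -tk.
Qed.

Lemma measurable_step_val X w : measurable_fun setT (fun v => step_val X v w).
Proof.
by apply: measurable_sum => i; apply: measurable_funM => //; exact: measurable_indic.
Qed.

Lemma integral_cells a b N g (f : R -> R) : grid_on a b N g ->
  measurable_fun setT f -> (forall v, 0 <= f v) ->
  (forall j v, (j < N)%N -> g j < v <= g j.+1 -> f v = f (g j.+1)) ->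
  (\int[mu]_(v in `]a, b]) (f v)%:E =
   (\sum_(j < N) f (g j.+1) * (g j.+1 - g j))%:E)%E.
Proof.
move=> gg mf f0 fc.
have mfE D : measurable_fun D (EFin \o f).
  by apply/measurable_EFinP; exact: (measurable_funS measurableT (@subsetT _ _) mf).
suff h n : (n <= N)%N -> (\int[mu]_(v in `]g 0%N, g n]) (f v)%:E =
    (\sum_(j < n) f (g j.+1) * (g j.+1 - g j))%:E)%E.
  by have := h N (leqnn N); have [-> -> _] := gg.
elim: n => [_|n ih nN]; first by rewrite set_itvoc0 integral_set0 big_ord0.
have h0n : g 0%N <= g n by apply: (grid_homo gg) => //; exact: ltnW.
have hnn : g n <= g n.+1 by have [_ _] := gg; exact.
rewrite [in RHS]big_ord_recr [in RHS]EFinD -(ih (ltnW nN)).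
rewrite (@itv_bndbnd_setU _ _ _ (BRight (g n)))// ge0_integral_setU//=; last 3 first.
  exact: mfE.
  by move=> v _; rewrite lee_fin.
  apply/disj_setPS => v [/=]; rewrite !in_itv/= => /andP[_ h1] /andP[h2 _].
  by move: h1; rewrite leNgt h2.
congr (_ + _)%E.
under eq_integral => v vn.
  rewrite (fc n v)//; last by move: vn; rewrite inE/= in_itv.
  over.
rewrite integral_cst//= lebesgue_measure_itv/= lte_fin EFinM.
case: ltP => [_|h]; first by rewrite EFinN -EFinB.
have -> : g n.+1 = g n by apply/eqP; rewrite eq_le hnn h.
by rewrite subrr.
Qed.

Lemma simple_on_steps a b X : simple_on F a b X -> step_grid a b X /\ adapted_steps X.
Proof. by move=> [h1 h2 h3 h4 _]. Qed.

Definition riemann_steps H (a b : R) (N : nat) : step_process :=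
  StepProcess N (fun i => a + (b - a) * (i%:R / N%:R))
    (fun i => H (a + (b - a) * (i%:R / N%:R))).

Lemma riemann_steps_grid H a b N : a <= b -> (0 < N)%N ->
  step_grid a b (riemann_steps H a b N).
Proof.
move=> ab N0; have N0' : 0 < N%:R :> R by rewrite ltr0n.
split => [||i iN] /=.
- by rewrite mul0r mulr0 addr0.
- by rewrite divff ?gt_eqF// mulr1 subrKC.
- by rewrite lerD2l ler_wpM2l ?subr_ge0// ler_pM2r ?invr_gt0// ler_nat.
Qed.

Lemma riemann_steps_adapted H a b N : a <= b -> (0 < N)%N ->
  (forall v, a <= v <= b -> measurable_wrt (F v) (H v)) ->
  adapted_steps (riemann_steps H a b N).
Proof.
move=> ab N0 aH i iN; apply: aH.
exact: (grid_in (riemann_steps_grid H ab N0) (ltnW iN)).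
Qed.

Lemma riemann_steps_near H (a b : R) N (v : R) w : a <= b -> (0 < N)%N -> a < v <= b ->
  exists2 u, a <= u <= b /\ `|v - u| <= (b - a) / N%:R &
    step_val (riemann_steps H a b N) v w = H u w.
Proof.
move=> ab N0 vab; have gr := riemann_steps_grid H ab N0.
have [j jN jv] := grid_cell gr vab.
exists (step_time (riemann_steps H a b N) j); last first.
  exact: (grid_sum_indic (fun i => step_coef (riemann_steps H a b N) i w) gr jN jv).
have N0' : 0 < N%:R :> R by rewrite ltr0n.
split; first exact: (grid_in gr (ltnW jN)).
move: jv => /andP[h1 h2]; rewrite ger0_norm ?subr_ge0 ?(ltW h1)//.
rewrite lerBlDr; apply: (le_trans h2) => /=.
by rewrite -natr1 le_eqVlt; apply/orP; left; apply/eqP; ring.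
Qed.

(** Left-open like the steps themselves; the missing endpoint is a null set, so this agrees with the
    closed interval in [ito_integral]. *)
Definition step_dist X Y a b w : R :=
  \int[mu]_(v in `]a, b]) ((step_val X v w - step_val Y v w) ^+ 2).

Section two_processes.
Variables (W : R -> Omega -> R) (X Y : step_process) (a b : R).
Hypotheses (F_filt : filtration F) (W_bm : brownian_motion P F W).
Hypotheses (a0 : 0 <= a) (gX : step_grid a b X) (gY : step_grid a b Y).
Hypotheses (aX : adapted_steps X) (aY : adapted_steps Y).

Let msq w : measurable_fun setT (fun v => (step_val X v w - step_val Y v w) ^+ 2).
Proof.
by apply: measurable_funX; apply: measurable_funB; exact: measurable_step_val.
Qed.

Let grid_rep : exists N g, [/\ grid_on a b N g, step_refines X N g, step_refines Y N g &
  forall w, step_dist X Y a b w = energy g (fun j w => step_val X (g j.+1) w - step_val Y (g j.+1) w) N w /\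
   (\int[mu]_(v in `]a, b]) ((step_val X v w - step_val Y v w) ^+ 2)%:E)%E = (step_dist X Y a b w)%:E].
Proof.
have [N [g [gg rX rY]]] := common_grid gX gY; exists N, g; split => // w.
rewrite /step_dist /Rintegral.
rewrite (@integral_cells _ _ _ _ (fun v => (step_val X v w - step_val Y v w) ^+ 2) gg)//.
- by move=> v; exact: sqr_ge0.
- move=> j v jN jv; congr (_ ^+ 2).
  by rewrite (step_val_cell _ gX gg rX jN jv) (step_val_cell _ gY gg rY jN jv).
Qed.

Let diff_adapted N g j : grid_on a b N g -> step_refines X N g -> step_refines Y N g ->
  (j < N)%N -> measurable_wrt (F (g j)) (fun w => step_val X (g j.+1) w - step_val Y (g j.+1) w).
Proof.
move=> gg rX rY jN.
have gj0 : 0 <= g j.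
  by have [ga _ _] := gg; rewrite (le_trans a0)// -ga (grid_homo gg)// ltnW.
apply: measurable_wrtB; first exact: filtration_sigma.
  exact: step_val_adapted gX gg rX aX jN.
exact: step_val_adapted gY gg rY aY jN.
Qed.

Let grid_ge0 N g j : grid_on a b N g -> (j <= N)%N -> 0 <= g j.
Proof.
by move=> gg jN; apply: (le_trans a0); have /andP[] := grid_in gg jN.
Qed.

Let diff_measurable N g j : grid_on a b N g -> step_refines X N g -> step_refines Y N g ->
  (j < N)%N -> measurable_fun setT (fun w => step_val X (g j.+1) w - step_val Y (g j.+1) w).
Proof.
move=> gg rX rY jN; apply: (measurable_wrt_measurable (G := F (g j))).
  by apply: (filtration_sub F_filt); exact: grid_ge0 gg (ltnW jN).
exact: diff_adapted gg rX rY jN.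
Qed.

Lemma measurable_step_dist : measurable_fun setT (step_dist X Y a b).
Proof.
have [N [g [gg rX rY h]]] := grid_rep.
have -> : step_dist X Y a b =
    energy g (fun j w => step_val X (g j.+1) w - step_val Y (g j.+1) w) N.
  by apply/funext => w; have [] := h w.
apply: measurable_sum => j; apply: measurable_funM => //; apply: measurable_funX.
exact: diff_measurable gg rX rY (ltn_ord j).
Qed.

Lemma measurable_step_integralB :
  measurable_fun setT (fun w => step_integral W X w - step_integral W Y w).
Proof.
have [N [g [gg rX rY h]]] := grid_rep.
under [X in measurable_fun _ X]funext => w.
  rewrite (step_integral_grid _ _ gX gg rX) (step_integral_grid _ _ gY gg rY) -sumrB.
  under eq_bigr do rewrite -mulrBl.
  over.
apply: measurable_sum => j; apply: measurable_funM; first exact: diff_measurable gg rX rY (ltn_ord j).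
apply: (measurable_increment F_filt W_bm); first exact: grid_ge0 gg (ltnW (ltn_ord j)).
by have [_ _] := gg; exact.
Qed.

(** On a common grid the difference of the integrals is one stochastic sum whose energy is
    [step_dist]; truncation and Markov's inequality finish. *)
Lemma step_integral_dist (eps eta : R) : 0 < eps -> 0 <= eta ->
  prob P [set w | eps <= (step_integral W X w - step_integral W Y w) ^+ 2] <=
  prob P [set w | eta < step_dist X Y a b w] + eta / eps.
Proof.
move=> eps0 eta0; have [N [g [gg rX rY h]]] := grid_rep.
pose D j w := step_val X (g j.+1) w - step_val Y (g j.+1) w.
have g0 : 0 <= g 0%N by exact: grid_ge0 gg (leq0n _).
have gle i : (i < N)%N -> g i <= g i.+1 by have [_ _] := gg; exact.
have aD i : (i < N)%N -> measurable_wrt (F (g i)) (D i) by move=> iN; exact: diff_adapted gg rX rY iN.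
have [k [kE ik /(_ 1%N (fun _ => xpredT))]] := truncated_ito F_filt W_bm g0 gle aD eta0.
rewrite big_ord1 => /(_ (fun=> leqnn _)).
under [X in mean _ X]funext do rewrite big_ord1.
move=> mk; pose Z w := \sum_(i < N) k i w * (W (g i.+1) w - W (g i) w).
have iZ : rv_integrable P (fun w => Z w ^+ 2) := ik xpredT.
have mE := measurable_gt_rv eta measurable_step_dist.
have mI : measurable_fun setT (fun w => (step_integral W X w - step_integral W Y w) ^+ 2).
  by apply: measurable_funX; exact: measurable_step_integralB.
apply: (@le_trans _ _ (prob P [set w | eta < step_dist X Y a b w] +
    prob P [set w | eps <= Z w ^+ 2])).
  apply: prob_le_setU => //; first exact: measurable_ge_rv.
    by apply: measurable_ge_rv; exact: rv_integrable_measurable iZ.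
  move=> w /= hw; have [hE|hE] := ltP eta (step_dist X Y a b w); [by left|right].
  rewrite /Z; have [E _] := h w; rewrite E in hE.
  under eq_bigr => i _ do rewrite (kE w hE i (ltn_ord i)) /D.
  move: hw; rewrite (step_integral_grid _ _ gX gg rX) (step_integral_grid _ _ gY gg rY) -sumrB.
  by under [X in _ -> _ <= X ^+ 2]eq_bigr do rewrite mulrBl.
rewrite lerD2l; apply: (le_trans (prob_markov iZ _ eps0)).
  by move=> w; exact: sqr_ge0.
by rewrite ler_pM2r ?invr_gt0.
Qed.

End two_processes.

End step_processes.

Lemma within_continuous_eps {R : realType} {T : pseudoMetricType R} (A : set T) (f : T -> R) :
  {within A, continuous f} <->
  forall x, A x -> forall e : R, 0 < e -> exists2 dl : R, 0 < dl &
    forall y, A y -> ball x dl y -> `|f x - f y| < e.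
Proof.
split=> [/subspace_continuousP cf x Ax e e0|h].
  have /cvgrPdist_lt/(_ _ e0) := cf x Ax.
  rewrite near_withinE => /nbhs_ballP[dl /= dl0 hdl]; exists dl => // y Ay xy.
  exact: hdl.
apply/subspace_continuousP => x Ax; apply/cvgrPdist_lt => e e0.
have [dl dl0 hdl] := h x Ax e e0.
rewrite near_withinE; apply/nbhs_ballP; exists dl => //= y xy Ay.
exact: hdl.
Qed.

Lemma near_natinv {R : realType} (M e : R) : 0 < e ->
  \forall n \near \oo, M / n.+1%:R < e.
Proof.
move=> e0; exists (Num.truncn (`|M| / e)).+1 => // n /= hn.
rewrite ltr_pdivrMr ?ltr0n// mulrC -ltr_pdivrMr//.
apply: (@le_lt_trans _ _ (`|M| / e)); first by rewrite ler_pM2r ?invr_gt0// ler_norm.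
by apply: (lt_trans (truncnS_gt _)); rewrite ltr_nat.
Qed.

Lemma integrable_bounded {d : measure_display} {T : measurableType d} {R : realType}
    (mu : {measure set T -> \bar R}) (A : set T) (f : T -> R) (M : R) :
  measurable A -> (mu A < +oo)%E -> measurable_fun A f ->
  (forall x, A x -> `|f x| <= M) -> mu.-integrable A (EFin \o f).
Proof.
move=> mA fA mf bf; apply: measurable_bounded_integrable => //.
by exists M; split; [exact: num_real|move=> x Mx w Aw; exact: le_trans (bf w Aw) (ltW Mx)].
Qed.

(** * Riemann sums converge to the Ito integral *)

Section riemann_sums.
Context {R : realType} {d : measure_display} {Omega : measurableType d}.
Local Notation mu := (@lebesgue_measure R).
Variables (P : probability Omega R) (F : R -> set (set Omega)) (W : R -> Omega -> R).
Hypotheses (F_filt : filtration F) (W_bm : brownian_motion P F W).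

Lemma measurable_step_integral (a b : R) (X : @step_process R d Omega) : 0 <= a ->
  step_grid a b X -> adapted_steps F X -> measurable_fun setT (step_integral W X).
Proof.
move=> a0 gX aX; apply: measurable_sum => i; have iX := ltn_ord i.
have t0 : 0 <= step_time X i.
  by apply: (le_trans a0); have /andP[] := grid_in gX (ltnW iX).
apply: measurable_funM.
  by apply: (measurable_wrt_measurable _ (aX i iX)); exact: filtration_sub.
apply: (measurable_increment F_filt W_bm) => //.
by have [_ _] := gX; exact.
Qed.

Variables (a b : R) (H : R -> Omega -> R).
Hypotheses (a0 : 0 <= a) (ab : a <= b).
Hypothesis H_cont : forall w, {within `[a, b], continuous (fun v => H v w)}.
Hypothesis H_adapted : forall v, a <= v <= b -> measurable_wrt (F v) (H v).

Local Notation SP := (riemann_steps H a b).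

Lemma within_continuous_bounded (f : R -> R) : {within `[a, b], continuous f} ->
  exists M : R, forall v, a <= v <= b -> `|f v| <= M.
Proof.
move=> cf; have cf' : {within `[a, b], continuous (fun v => `|f v|)}.
  by move=> x; apply: continuous_comp; [exact: cf|exact: norm_continuous].
have [c _ hc] := EVT_max ab cf'.
by exists `|f c| => v vab; apply: hc; rewrite in_itv.
Qed.

Lemma riemann_steps_cvg v w : a < v <= b ->
  step_val (SP N.+1) v w @[N --> \oo] --> H v w.
Proof.
move=> vab; apply/cvgrPdist_lt => e e0.
have vin : `[a, b]%classic v by rewrite /= in_itv/= ltW//; case/andP: vab.
have [dl dl0 hdl] := (within_continuous_eps _ _).1 (@H_cont w) v vin e e0.
near=> N.
have [u [uab vu] ->] := @riemann_steps_near _ _ _ H a b N.+1 v w ab isT vab.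
apply: hdl => //=; rewrite /ball/= (le_lt_trans vu)//.
by near: N; exact: near_natinv.
Unshelve. all: by end_near. Qed.

Lemma riemann_steps_bounded w : exists M : R, forall N v, a < v <= b ->
  `|step_val (SP N.+1) v w| <= M.
Proof.
have [M hM] := within_continuous_bounded (@H_cont w).
exists M => N v vab.
have [u [uab _] ->] := @riemann_steps_near _ _ _ H a b N.+1 v w ab isT vab.
exact: hM.
Qed.

Lemma step_val_bounded (X : @step_process R d Omega) w :
  exists M : R, forall v, `|step_val X v w| <= M.
Proof.
exists (\sum_(i < step_size X) `|step_coef X i w|) => v.
apply: (le_trans (ler_norm_sum _ _ _)); apply: ler_sum => i _.
by rewrite indic_oc normrM ler_piMr//; case: (_ < _ <= _); rewrite ?normr0 ?normr1.
Qed.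

(** Dominated convergence: a continuous path is bounded on [a, b], and so are its left-point Riemann
    steps, uniformly in the number of cells. *)
Lemma step_dist_cvg (X : @step_process R d Omega) w :
  (\int[mu]_(v in `[a, b]) ((H v w - step_val X v w) ^+ 2)%:E)%E =
    (\int[mu]_(v in `]a, b]) ((H v w - step_val X v w) ^+ 2))%:E /\
  step_dist (SP N.+1) X a b w @[N --> \oo] -->
    \int[mu]_(v in `]a, b]) ((H v w - step_val X v w) ^+ 2).
Proof.
have [M1 hM1] := riemann_steps_bounded w.
have [M2 hM2] := step_val_bounded X w.
pose f N v := (step_val (SP N.+1) v w - step_val X v w) ^+ 2.
pose h v := (H v w - step_val X v w) ^+ 2.
have mf N D : measurable_fun D (f N).
  apply: (@measurable_funS _ _ _ _ setT) => //; apply: measurable_funX.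
  by apply: measurable_funB; exact: measurable_step_val.
have fh v : a < v <= b -> f N v @[N --> \oo] --> h v.
  move=> vab; have c : step_val (SP N.+1) v w - step_val X v w @[N --> \oo] -->
      H v w - step_val X v w.
    by apply: cvgB; [exact: riemann_steps_cvg|exact: cvg_cst].
  exact: (cvgM c c).
have mh : measurable_fun `]a, b] h.
  apply: (measurable_fun_cvg (h := f)) => // v /=; rewrite in_itv/=; exact: fh.
have bf N v : a < v <= b -> `|f N v| <= (M1 + M2) ^+ 2.
  move=> vab; have hb : `|step_val (SP N.+1) v w - step_val X v w| <= M1 + M2.
    by apply: (le_trans (ler_normB _ _)); apply: lerD; [exact: hM1|exact: hM2].
  by rewrite /f normrX ler_pXn2r// nnegrE (le_trans _ hb).
have cE v : `]a, b]%classic v -> (f N v)%:E @[N --> \oo] --> (h v)%:E.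
  rewrite /= in_itv/= => vab; apply: cvg_EFin; [exact: nearW|exact: fh].
have iM : mu.-integrable `]a, b] (fun=> ((M1 + M2) ^+ 2)%:E).
  apply: (@integrable_bounded _ _ _ mu _ (fun=> (M1 + M2) ^+ 2) `|(M1 + M2) ^+ 2|) => //.
  by rewrite [X in (X < _)%E]lebesgue_measure_itv/=; case: ifP => _; rewrite ltry.
have aE : {ae mu, forall v, `]a, b]%classic v -> (EFin \o f N) v @[N --> \oo] --> (EFin \o h) v}.
  by apply: aeW => v; exact: cE.
have aB : {ae mu, forall v N, `]a, b]%classic v -> (`|(EFin \o f N) v| <= ((M1 + M2) ^+ 2)%:E)%E}.
  by apply: aeW => v N /=; rewrite in_itv/= => vab; rewrite lee_fin; exact: bf.
have [ih _ ch] := @dominated_convergence _ _ _ mu `]a, b] (measurable_itv _)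
  (fun N => EFin \o f N) (EFin \o h) (fun=> ((M1 + M2) ^+ 2)%:E)
  (fun N => (measurable_EFinP _ _).2 (mf N _)) ((measurable_EFinP _ _).2 mh)
  aE iM aB.
have ifin : (\int[mu]_(v in `]a, b]) (h v)%:E)%E \is a fin_num by exact: integrable_fin_num.
split.
  rewrite -integral_itv_obnd_cbnd; last exact/measurable_EFinP.
  by rewrite /Rintegral fineK.
by apply: fine_cvg; rewrite /Rintegral fineK.
Qed.

(** The Riemann steps and a given approximant [X n] are compared through their energy distance. For
    fixed [n] it converges, as the mesh shrinks, to the distance from [H] to [X n], which is small
    in probability for a suitable [n]. So [n] is fixed first. *)
Lemma ito_integral_riemann J (eps : R) : ito_integral P F W a b H J -> 0 < eps ->
  prob P [set w | eps <= `|step_integral W (SP N.+1) w - J w|] @[N --> \oo] --> 0.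
Proof.
move=> [mJ [X [sX X1 X2]]] eps0.
pose D n w := \int[mu]_(v in `]a, b]) ((H v w - step_val (X n) v w) ^+ 2).
have gX n : step_grid a b (X n) by have [] := simple_on_steps (sX n).
have aX n : adapted_steps F (X n) by have [] := simple_on_steps (sX n).
have gS N : step_grid a b (SP N.+1) by exact: riemann_steps_grid.
have aS N : adapted_steps F (SP N.+1) by exact: riemann_steps_adapted.
have mdist N n : measurable_fun setT (step_dist (SP N.+1) (X n) a b).
  exact: (measurable_step_dist F_filt a0 (gS N) (gX n) (aS N) (aX n)).
have Dcvg n w := (step_dist_cvg (X n) w).2.
have mD n : measurable_fun setT (D n).
  by apply: (measurable_fun_cvg (mdist^~ n)) => w _; exact: Dcvg.
have mSP N : measurable_fun setT (step_integral W (SP N.+1)).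
  exact: measurable_step_integral a0 (gS N) (aS N).
have mXI n : measurable_fun setT (step_integral W (X n)).
  exact: measurable_step_integral a0 (gX n) (aX n).
apply/cvgrPdist_le => e e0.
(* Four events contribute: [X n] far from [J], [X n] far from [H], the Riemann distance far from its
   limit, and the term [eta / h ^+ 2] of the truncation bound, made equal to [e4] by the choice of
   [eta]. *)
pose e4 := e / 4; have e40 : 0 < e4 by rewrite divr_gt0.
pose h := eps / 2; have h0 : 0 < h by rewrite divr_gt0.
pose eta := e4 * h ^+ 2; have eta0 : 0 < eta by rewrite mulr_gt0// exprn_gt0.
have eta20 : 0 < eta / 2 by rewrite divr_gt0.
have PD : prob P [set w | eta / 2 <= D n w] @[n --> \oo] --> 0.
  apply: fine_cvg; apply: cvg_trans (X1 _ eta20).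
  apply: near_eq_cvg; apply: nearW => n /=; congr (P _).
  by apply/seteqP; split=> w /=; rewrite (step_dist_cvg (X n) w).1 lee_fin.
have PJ : prob P [set w | h <= `|step_integral W (X n) w - J w|] @[n --> \oo] --> 0.
  apply: fine_cvg; apply: cvg_trans (X2 _ h0).
  apply: near_eq_cvg; apply: nearW => n /=; congr (P _).
have [n [hD hJ]] : exists n, prob P [set w | eta / 2 <= D n w] <= e4 /\
    prob P [set w | h <= `|step_integral W (X n) w - J w|] <= e4.
  have /cvgrPdist_le/(_ _ e40) A := PD; have /cvgrPdist_le/(_ _ e40) B := PJ.
  have [n [/= hA hB]] := filter_ex (filterI A B); exists n.
  by move: hA hB; rewrite !sub0r !normrN !ger0_norm ?prob_ge0.
have Pdist := @prob_cvg0 _ _ _ P (fun N w => step_dist (SP N.+1) (X n) a b w - D n w)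
  (eta / 2) eta20 (fun N => measurable_funB (mdist N n) (mD n)).
have {}Pdist : prob P [set w | eta / 2 <= `|step_dist (SP N.+1) (X n) a b w - D n w|]
    @[N --> \oo] --> 0.
  apply: Pdist => w; rewrite -(subrr (D n w)); apply: cvgB; first exact: Dcvg.
  exact: cvg_cst.
have /cvgrPdist_le/(_ _ e40) := Pdist; apply: filterS => N.
rewrite !sub0r !normrN !ger0_norm ?prob_ge0// => hN.
have sq0 : 0 < h ^+ 2 by rewrite exprn_gt0.
have mA : measurable [set w | h ^+ 2 <= (step_integral W (SP N.+1) w - step_integral W (X n) w) ^+ 2].
  by apply: measurable_ge_rv; apply: measurable_funX; exact: measurable_funB.
have mB : measurable [set w | h <= `|step_integral W (X n) w - J w|].
  by apply: measurable_ge_rv; apply: measurableT_comp => //; exact: measurable_funB.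
have mC : measurable [set w | eps <= `|step_integral W (SP N.+1) w - J w|].
  by apply: measurable_ge_rv; apply: measurableT_comp => //; exact: measurable_funB.
have mE : measurable [set w | eta < step_dist (SP N.+1) (X n) a b w].
  exact: measurable_gt_rv.
have mE1 : measurable [set w | eta / 2 <= D n w] by exact: measurable_ge_rv.
have mE2 : measurable [set w | eta / 2 <= `|step_dist (SP N.+1) (X n) a b w - D n w|].
  by apply: measurable_ge_rv; apply: measurableT_comp => //; exact: measurable_funB.
have s1 : prob P [set w | eps <= `|step_integral W (SP N.+1) w - J w|] <=
    prob P [set w | h ^+ 2 <= (step_integral W (SP N.+1) w - step_integral W (X n) w) ^+ 2] +
    prob P [set w | h <= `|step_integral W (X n) w - J w|].
  apply: prob_le_setU => // w /= hw.
  have [hb|hb] := leP h `|step_integral W (X n) w - J w|; [by right|left].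
  have : h <= `|step_integral W (SP N.+1) w - step_integral W (X n) w|.
    have := ler_normD (step_integral W (SP N.+1) w - step_integral W (X n) w)
      (step_integral W (X n) w - J w).
    by rewrite addrA subrK; move: hw hb; rewrite /h; lra.
  by rewrite -[_ ^+ 2 in X in _ -> _ <= X]real_normK ?num_real// ler_pXn2r ?nnegrE// ltW.
have s2 := step_integral_dist F_filt W_bm a0 (gS N) (gX n) (aS N) (aX n) sq0 (ltW eta0).
have s3 : prob P [set w | eta < step_dist (SP N.+1) (X n) a b w] <=
    prob P [set w | eta / 2 <= D n w] +
    prob P [set w | eta / 2 <= `|step_dist (SP N.+1) (X n) a b w - D n w|].
  apply: prob_le_setU => // w /= hw.
  have [hb|hb] := leP (eta / 2) (D n w); [by left|right].
  apply: le_trans (ler_norm _); lra.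
have s4 : eta / h ^+ 2 = e4 by rewrite /eta mulfK// gt_eqF.
have e44 : e = e4 + e4 + e4 + e4 by rewrite /e4; field.
lra.
Qed.

End riemann_sums.

(** * Elementary estimates for logarithms of products *)

Section mean_value_bounds.
Context {R : realType}.

Lemma mvt_norm_le (f f' : R -> R) (x K : R) :
  (forall y : R, `|y| <= `|x| -> is_derive y 1 f (f' y)) ->
  (forall y, `|y| <= `|x| -> `|f' y| <= K) -> `|f x - f 0| <= K * `|x|.
Proof.
move=> df bf.
have fc (A : set R) : (forall y, A y -> `|y| <= `|x|) -> {within A, continuous f}.
  move=> hA; apply: continuous_in_subspaceT => y /[!inE] /hA yx.
  by apply: differentiable_continuous; apply/derivable1_diffP; have [] := df y yx.
have [x0|x0|->] := ltrgt0P x; last by rewrite subrr normr0 mulr0.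
  have sub (y : R) : y \in `[0, x] -> `|y| <= `|x|.
    by rewrite in_itv/= => /andP[y0 yx]; rewrite ger0_norm// (ger0_norm (ltW x0)).
  have dI y : y \in `]0, x[ -> is_derive y 1 f (f' y) by move/subset_itv_oo_cc/sub/df.
  have [c cx ->] := MVT x0 dI (fc _ sub).
  rewrite subr0 normrM -{2}(gtr0_norm x0) ler_wpM2r//; apply: bf; apply: sub.
  exact: subset_itv_oo_cc.
have sub (y : R) : y \in `[x, 0] -> `|y| <= `|x|.
  by rewrite in_itv/= => /andP[y0 yx]; rewrite ler0_norm// (ler0_norm (ltW x0)) lerN2.
have dI y : y \in `]x, 0[ -> is_derive y 1 f (f' y) by move/subset_itv_oo_cc/sub/df.
have [c cx E] := MVT x0 dI (fc _ sub).
rewrite distrC E sub0r normrM normrN -(ltr0_norm x0) ler_wpM2r//; apply: bf; apply: sub.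
exact: subset_itv_oo_cc.
Qed.

(** The left side has derivative y^2 / (1 + y), which is at most 2 y^2 when |y| <= 1/2; the mean
    value bound then gives the cube. *)
Lemma ln_taylor2 (x : R) : `|x| <= 1 / 2 ->
  `|ln (1 + x) - x + x ^+ 2 / 2| <= 2 * `|x| ^+ 3.
Proof.
move=> x12.
have h := @mvt_norm_le (fun y => ln (1 + y) - y + y ^+ 2 / 2) (fun y => y ^+ 2 / (1 + y)) x
   (2 * `|x| ^+ 2).
have {h} := h.
have E0 : ln (1 + 0) - 0 + 0 ^+ 2 / 2 = 0 :> R.
  by rewrite addr0 ln1 subr0 expr0n/= mul0r addr0.
rewrite E0 subr0 (_ : 2 * `|x| ^+ 2 * `|x| = 2 * `|x| ^+ 3); last by ring.
apply.
- move=> y yx; have y0 : 0 < 1 + y by have := ler_norm (- y); rewrite normrN; lra.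
  have d1 : is_derive y 1 (fun y : R => ln (1 + y)) (1 + y)^-1.
    have dy : is_derive y 1 (fun y : R => 1 + y) 1.
      have := is_derive_funD (is_derive_cst (1 : R) y (1 : R)) (is_derive_id y (1 : R)).
      by rewrite add0r.
    have := @is_derive1_comp _ (@ln R) (fun y => 1 + y) y (1 + y)^-1 1 (is_derive1_ln y0) dy.
    by rewrite mulr1.
  have d2 := is_derive_funD (is_derive_funD d1 (is_derive_funZ (-1) (is_derive_id y (1 : R))))
    (is_derive_funZ 2^-1 (is_derive_funX 2 y)).
  have E : (fun y => ln (1 + y) - y + y ^+ 2 / 2) = (fun y : R => ln (1 + y) + -1 * y + 2^-1 * y ^+ 2).
    by apply/funext => z; ring.
  rewrite E; apply: (is_derive_eq d2) => /=; rewrite expr1.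
  by field; rewrite gt_eqF.
- move=> y yx; have y0 : 1 / 2 <= 1 + y by have := ler_norm (- y); rewrite normrN; lra.
  have y1 : 0 < 1 + y by lra.
  rewrite normrM normrX normfV (gtr0_norm y1) ler_pdivrMr//.
  have : `|y| ^+ 2 <= `|x| ^+ 2 by rewrite ler_pXn2r// nnegrE.
  have := sqr_ge0 `|x|; nra.
Qed.

End mean_value_bounds.

Section triangular_arrays.
Context {R : realType}.

Lemma cvg_dist_le (f g h : nat -> R) (l : R) :
  (\forall j \near \oo, `|f j - g j| <= h j) ->
  h j @[j --> \oo] --> 0 -> g j @[j --> \oo] --> l -> f j @[j --> \oo] --> l.
Proof.
move=> fg h0 gl.
have -> : f = (fun j => (f j - g j) + g j) by apply/funext => j; rewrite subrK.
rewrite -[l]add0r; apply: cvgD => //; apply/cvgrPdist_le => e e0.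
near=> j; rewrite sub0r normrN (@le_trans _ _ (h j))//; first by near: j.
rewrite (le_trans (ler_norm _))// -[`|h j|]normrN -sub0r; near: j.
by move/cvgrPdist_le : h0; exact.
Unshelve. all: by end_near. Qed.

(** Young's inequality 2|uv| <= la u^2 + v^2 / la, applied termwise: [la] is fixed small first, then
    the perturbation is made small against 1 + 1/la. *)
Lemma sum_sqr_perturb_cvg (N : nat -> nat) (x e : nat -> nat -> R) (s : R) :
  \sum_(k < N j) x j k ^+ 2 @[j --> \oo] --> s ->
  \sum_(k < N j) e j k ^+ 2 @[j --> \oo] --> 0 ->
  \sum_(k < N j) (x j k + e j k) ^+ 2 @[j --> \oo] --> s.
Proof.
move=> xs e0.
pose A j := \sum_(k < N j) x j k ^+ 2; pose B j := \sum_(k < N j) e j k ^+ 2.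
have AB (la : R) j : 0 < la ->
    `|\sum_(k < N j) (x j k + e j k) ^+ 2 - A j| <= la * A j + (1 + la^-1) * B j.
  move=> la0; rewrite -sumrB 2!big_distrr/= -big_split/=.
  apply: (le_trans (ler_norm_sum _ _ _)); apply: ler_sum => k _.
  set u := x j k; set v := e j k.
  have -> : (u + v) ^+ 2 - u ^+ 2 = 2 * u * v + v ^+ 2 by ring.
  apply: (le_trans (ler_normD _ _)); rewrite [`|v ^+ 2|]ger0_norm ?sqr_ge0//.
  rewrite (_ : (1 + la^-1) * v ^+ 2 = la^-1 * v ^+ 2 + v ^+ 2); last by ring.
  rewrite addrA lerD2r.
  have h (t : R) : t ^+ 2 = 1 -> 2 * u * v * t <= la * u ^+ 2 + la^-1 * v ^+ 2.
    move=> t1; have := sqr_ge0 (la * u - t * v); rewrite -(pmulr_rge0 _ (_ : 0 < la^-1)) ?invr_gt0//.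
    have -> : la^-1 * (la * u - t * v) ^+ 2 = la * u ^+ 2 + la^-1 * (t ^+ 2 * v ^+ 2) - 2 * u * v * t.
      by field; rewrite gt_eqF.
    by rewrite t1; lra.
  rewrite ler_norml; have h1 := h 1 (expr1n _ _); have h2 := h (-1) (etrans (sqrrN 1) (expr1n _ _)).
  lra.
apply/cvgrPdist_le => eps eps0.
(* Chosen so that [la * A j] is at most [eps / 2] as soon as [A j] is at most |s| + 1. *)
pose la := eps / 2 / (`|s| + 1).
have s1 : 0 < `|s| + 1 by rewrite ltr_wpDl.
have la0 : 0 < la by rewrite !divr_gt0.
pose K := 1 + la^-1; have K0 : 0 < K by rewrite addr_gt0// invr_gt0.
have eK : 0 < eps / 4 / K by rewrite !divr_gt0.
have h1 : 0 < Num.min 1 (eps / 4) by rewrite lt_min ltr01 divr_gt0.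
near=> j.
have a1 : `|s - A j| <= Num.min 1 (eps / 4) by near: j; move/cvgrPdist_le : xs; exact.
have b1 : `|0 - B j| <= eps / 4 / K by near: j; move/cvgrPdist_le : e0; exact.
have {}b1 : K * B j <= eps / 4.
  rewrite mulrC -ler_pdivlMr//; apply: le_trans b1; rewrite sub0r normrN; exact: ler_norm.
move: a1; rewrite le_min => /andP[a1 a2].
have a3 : A j <= `|s| + 1.
  by rewrite -lerBlDl (le_trans _ a1)// distrC (le_trans _ (ler_norm _))// lerD2l lerN2 ler_norm.
have a4 : la * A j <= eps / 2.
  by apply: (le_trans (ler_wpM2l (ltW la0) a3)); rewrite /la divfK// gt_eqF.
have := AB la j la0.
have := ler_distD (A j) s (\sum_(k < N j) (x j k + e j k) ^+ 2).
rewrite [`|A j - _|]distrC -/K; lra.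
Unshelve. all: by end_near. Qed.

(** The second order expansion of the logarithm leaves cubes, and their sum is at most the largest
    term times the sum of squares. The limit of the squares is the source of the Ito correction. *)
Lemma sum_ln_cvg (N : nat -> nat) (D : nat -> nat -> R) (o : nat -> R) (s1 s2 : R) :
  (forall j k, (k < N j)%N -> `|D j k| <= o j) -> o j @[j --> \oo] --> 0 ->
  \sum_(k < N j) D j k @[j --> \oo] --> s1 ->
  \sum_(k < N j) D j k ^+ 2 @[j --> \oo] --> s2 ->
  \sum_(k < N j) ln (1 + D j k) @[j --> \oo] --> s1 - s2 / 2.
Proof.
move=> Do o0 h1 h2.
apply: (@cvg_dist_le _ (fun j => \sum_(k < N j) D j k - (\sum_(k < N j) D j k ^+ 2) / 2)
  (fun j => 2 * (o j * \sum_(k < N j) D j k ^+ 2))).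
- have half : 0 < 1 / 2 :> R by lra.
  near=> j; have oj : `|0 - o j| <= 1 / 2 by near: j; move/cvgrPdist_le : o0; exact.
  rewrite big_distrl/= -sumrB -sumrB 2!big_distrr/=.
  apply: (le_trans (ler_norm_sum _ _ _)); apply: ler_sum => k _.
  have Dk := Do j k (ltn_ord k).
  have oj' : o j <= 1 / 2 by rewrite (le_trans (ler_norm _))// -normrN -sub0r.
  rewrite opprB addrA [_ + _ - _]addrAC.
  apply: (le_trans (ln_taylor2 (le_trans Dk oj'))).
  rewrite ler_pM2l// exprS -[D j k ^+ 2]real_normK ?num_real//.
  by rewrite ler_wpM2r// sqr_ge0.
- have : 2 * (o j * \sum_(k < N j) D j k ^+ 2) @[j --> \oo] --> 2 * (0 * s2).
    by apply: cvgM; [exact: cvg_cst|exact: cvgM].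
  by rewrite mul0r mulr0.
- by apply: cvgB => //; apply: cvgM => //; exact: cvg_cst.
Unshelve. all: by end_near. Qed.

End triangular_arrays.

(** * Convergence to zero in probability *)

Section convergence_in_probability.
Context {R : realType} {d : measure_display} {Omega : measurableType d}.
Variable P : probability Omega R.
Implicit Types X Y : nat -> Omega -> R.

Definition cvgp0 X := (forall n, measurable_fun setT (X n)) /\
  forall e : R, 0 < e -> prob P [set w | e <= `|X n w|] @[n --> \oo] --> 0.

Let meas X e n : (forall n, measurable_fun setT (X n)) ->
  measurable [set w | e <= `|X n w|].
Proof. by move=> mX; apply: measurable_ge_rv; exact: measurableT_comp. Qed.

Lemma cvgp0_squeeze (f g : nat -> R) : (forall n, 0 <= f n) ->
  (\forall n \near \oo, f n <= g n) -> g n @[n --> \oo] --> 0 -> f n @[n --> \oo] --> 0.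
Proof.
move=> f0 fg g0; apply: (@cvg_dist_le _ f (fun=> 0) g); [|exact: g0|exact: cvg_cst].
by apply: filterS fg => n; rewrite subr0 ger0_norm.
Qed.

Lemma cvgp0_le X Y : (forall n, measurable_fun setT (X n)) -> cvgp0 Y ->
  (forall n w, `|X n w| <= `|Y n w|) -> cvgp0 X.
Proof.
move=> mX [mY hY] XY; split => // e e0.
apply: (cvgp0_squeeze _ _ (hY e e0)) => [n|]; first exact: prob_ge0.
apply: nearW => n; apply: prob_le; [exact: meas|exact: meas|].
by move=> w /= /le_trans; apply.
Qed.

Lemma cvgp0D X Y : cvgp0 X -> cvgp0 Y -> cvgp0 (fun n w => X n w + Y n w).
Proof.
move=> [mX hX] [mY hY]; split=> [n|e e0]; first exact: measurable_funD.
have e20 : 0 < e / 2 by rewrite divr_gt0.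
apply: (@cvgp0_squeeze _ (fun n => prob P [set w | e / 2 <= `|X n w|] +
  prob P [set w | e / 2 <= `|Y n w|])).
- by move=> n; exact: prob_ge0.
- apply: nearW => n; apply: prob_le_setU.
  + by apply: (@meas (fun n w => X n w + Y n w)) => k; exact: measurable_funD.
  + exact: meas.
  + exact: meas.
  + move=> w /= h; have [h1|h1] := leP (e / 2) `|X n w|; [by left|right].
    by have := ler_normD (X n w) (Y n w); lra.
- by rewrite -[0]addr0; apply: cvgD; [exact: hX|exact: hY].
Qed.

Lemma cvgp0_norm X : cvgp0 X -> cvgp0 (fun n w => `|X n w|).
Proof.
move=> cX; have [mX _] := cX.
apply: (cvgp0_le _ cX) => [n|n w]; first exact: measurableT_comp.
by rewrite normr_id.
Qed.

Lemma cvgp0_sum (N : nat) (X : nat -> nat -> Omega -> R) :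
  (forall k, (k < N)%N -> cvgp0 (X k)) -> cvgp0 (fun n w => \sum_(k < N) X k n w).
Proof.
elim: N => [_|N ih h].
  split=> [n|e e0]; first by apply: measurable_sum => -[].
  apply: cvg_near_cst; apply: nearW => n; rewrite [X in prob _ X](_ : _ = set0).
    by rewrite /prob measure0.
  by rewrite -subset0 => w /=; rewrite big_ord0 normr0 leNgt e0.
have -> : (fun n w => \sum_(k < N.+1) X k n w) = (fun n w => \sum_(k < N) X k n w + X N n w).
  by apply/funext => n; apply/funext => w; rewrite big_ord_recr.
apply: cvgp0D; last exact: h.
by apply: ih => k kN; apply: h; exact: ltnW.
Qed.

Lemma cvgp0_pointwise X : (forall n, measurable_fun setT (X n)) ->
  (forall w, X n w @[n --> \oo] --> 0) -> cvgp0 X.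
Proof. by move=> mX cX; split=> // e e0; exact: prob_cvg0. Qed.

Lemma ae_prob0 (A : set Omega) : measurable A -> prob P A = 0 -> {ae P, forall w, ~ A w}.
Proof.
move=> mA A0; exists A; split => //; first by rewrite probE// A0.
by move=> w /= /contrapT.
Qed.

(** The event that all late terms stay above a threshold is contained in events of vanishing
    probability. This yields, for almost every w, a subsequence tending to zero that may depend on
    w, which suffices for a pathwise identity. *)
Lemma cvgp0_frequently X : cvgp0 X ->
  {ae P, forall w, forall j N : nat, exists2 n, (N <= n)%N & `|X n w| < j.+1%:R^-1}.
Proof.
move=> [mX hX]; apply: ae_foralln => j; apply: ae_foralln => N.
pose A n := [set w | j.+1%:R^-1 <= `|X n w|].
pose B := \bigcap_n A (N + n)%N.
have mA n : measurable (A n) by exact: meas.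
have mB : measurable B by apply: bigcapT_measurable => n; exact: mA.
have B0 : prob P B = 0.
  apply/eqP; rewrite eq_le prob_ge0 andbT; apply/ler_addgt0Pl => e e0; rewrite addr0.
  have j0 : 0 < j.+1%:R^-1 :> R by rewrite invr_gt0.
  have /cvgrPdist_le/(_ _ e0)[n0 _ hn] := hX _ j0.
  have := hn (maxn N n0) (leq_maxr _ _); rewrite sub0r normrN ger0_norm ?prob_ge0//.
  apply: le_trans; apply: prob_le => //; first exact: mA.
  by move=> w /(_ (maxn N n0 - N)%N I); rewrite subnKC// leq_maxl.
have := ae_prob0 mB B0; apply: filterS => w nB.
apply: contrapT => h; apply: nB => n _; rewrite /A/= leNgt; apply/negP => hn.
by apply: h; exists (N + n)%N => //; exact: leq_addr.
Qed.

End convergence_in_probability.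

Lemma compact_unif {R : realType} {T : pseudoMetricType R} (A : set T) (f : T -> R) :
  compact A -> {within A, continuous f} -> forall e : R, 0 < e ->
  exists2 dl : R, 0 < dl & forall x y, A x -> A y -> ball x dl y -> `|f x - f y| < e.
Proof.
move=> /compact_near_coveringP cA cf e e0.
have e2 : 0 < e / 2 by rewrite divr_gt0.
have /(_ _) := cA R (0^'+) (fun dl x => A x -> forall y, A y -> ball x dl y -> `|f x - f y| < e) _.
case.
  move=> x Ax.
  have [dl dl0 hdl] := (within_continuous_eps _ _).1 cf x Ax _ e2.
  have dl2 : 0 < dl / 2 by rewrite divr_gt0.
  exists (ball x (dl / 2), [set i | i < dl / 2]).
    split => /=; first exact: nbhsx_ballx.
    exact: nbhs_right_lt.
  move=> [x' i] [/= xx' id] Ax' y Ay x'y.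
  have h1 : `|f x - f x'| < e / 2.
    by apply: hdl => //; apply: le_ball xx'; lra.
  have h2 : `|f x - f y| < e / 2.
    apply: hdl => //; rewrite (splitr dl); apply: ball_triangle xx' _.
    by apply: le_ball x'y; exact: ltW.
  rewrite [e]splitr (le_lt_trans (ler_distD (f x) _ _))// distrC ltrD//.
move=> dl /= dl0 h; exists (dl / 2); first by rewrite divr_gt0.
move=> x y Ax Ay xy; apply: (h (dl / 2)) => //=.
  rewrite sub0r normrN gtr0_norm ?divr_gt0//; lra.
by rewrite divr_gt0.
Qed.

Definition ugrid {R : realType} (t u : R) (n i : nat) : R := t + (u - t) * (i%:R / n%:R).

Lemma ugrid_grid {R : realType} (t u : R) (n : nat) : t <= u -> (0 < n)%N ->
  grid_on t u n (ugrid t u n).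
Proof.
move=> tu n0; have n0' : 0 < n%:R :> R by rewrite ltr0n.
split => [||i iN]; rewrite /ugrid.
- by rewrite mul0r mulr0 addr0.
- by rewrite divff ?gt_eqF// mulr1 subrKC.
- by rewrite lerD2l ler_wpM2l ?subr_ge0// ler_pM2r ?invr_gt0// ler_nat.
Qed.

Lemma ugrid_step {R : realType} (t u : R) (n i : nat) :
  ugrid t u n i.+1 - ugrid t u n i = (u - t) / n%:R.
Proof. by rewrite /ugrid -natr1; ring. Qed.

Lemma ratio_unif {R : realType} (t u : R) (f : R -> R) : t <= u ->
  (forall v, t <= v <= u -> 0 < f v) -> {within `[t, u], continuous f} ->
  (exists2 c : R, 0 < c & forall v, t <= v <= u -> c <= f v) /\
  forall e : R, 0 < e -> exists2 dl : R, 0 < dl &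
    forall x v, t <= x <= u -> t <= v <= u -> `|x - v| < dl -> `|f v / f x - 1| <= e.
Proof.
move=> tu f_gt0 f_cont.
have [c c0 hc] : exists2 c : R, 0 < c & forall v, t <= v <= u -> c <= f v.
  have [c cI hc] := EVT_min tu f_cont.
  by exists (f c) => [|v vI]; [apply: f_gt0; rewrite in_itv in cI|apply: hc; rewrite in_itv].
split=> [|e e0]; first by exists c.
have [dl dl0 hdl] := compact_unif (@segment_compact R t u) f_cont (mulr_gt0 e0 c0).
exists dl => // x v xI vI xv; have fx := f_gt0 x xI.
have -> : f v / f x - 1 = (f v - f x) / f x by rewrite mulrBl divff// gt_eqF.
rewrite normrM normfV (gtr0_norm fx) ler_pdivrMr//.
apply: (@le_trans _ _ (e * c)); last by rewrite ler_pM2l// hc.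
by rewrite distrC; apply/ltW/hdl => //=; rewrite in_itv.
Qed.

(** * The logarithm of the price *)

Section pathwise_logarithm.
Context {R : realType}.
Local Notation mu := (@lebesgue_measure R).
Variables (t u a sigma : R) (f W : R -> R).
Hypotheses (tu : t < u) (f_gt0 : forall v, t <= v <= u -> 0 < f v).
Hypothesis f_cont : {within `[t, u], continuous f}.
Variables (N : nat -> nat) (J M : nat -> nat -> R).
Hypotheses (N_gt0 : forall j, (0 < N j)%N) (N_cvg : (N j)%:R^-1 @[j --> \oo] --> (0 : R)).
Local Notation g j := (ugrid t u (N j)).
Hypothesis f_eq : forall j k, (k <= N j)%N ->
  f (g j k) = f t + \int[mu]_(v in `[t, g j k]) (a * f v) + J j k.
(** Relative error of freezing the integrand of the Ito integral at the left end of a cell. [M] will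
    be the same quantity with [J] replaced by Riemann sums on a finer grid; only for those is a
    second moment estimate available. *)
Let E j k := (J j k.+1 - J j k) / f (g j k) - sigma * (W (g j k.+1) - W (g j k)).
Hypothesis M1 : \sum_(k < N j) M j k @[j --> \oo] --> 0.
Hypothesis M2 : \sum_(k < N j) M j k ^+ 2 @[j --> \oo] --> 0.
Hypothesis EM : \sum_(k < N j) `|E j k - M j k| @[j --> \oo] --> 0.
Hypothesis W2 : \sum_(k < N j) (W (g j k.+1) - W (g j k)) ^+ 2 @[j --> \oo] --> u - t.

Let gg j : grid_on t u (N j) (g j). Proof. by apply: ugrid_grid => //; exact: ltW. Qed.

Let gin j k : (k <= N j)%N -> t <= g j k <= u. Proof. by move=> kN; exact: grid_in (gg j) kN. Qed.

Let ratio_le (e : R) : 0 < e -> \forall j \near \oo, forall k v, (k < N j)%N ->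
  g j k <= v <= g j k.+1 -> `|f v / f (g j k) - 1| <= e.
Proof.
move=> e0; have [_ h] := ratio_unif (ltW tu) f_gt0 f_cont.
have [dl dl0 hdl] := h e e0.
have dlu : 0 < dl / (u - t) by rewrite divr_gt0// subr_gt0.
near=> j => k v kN /andP[kv vk].
have h1 := gin (ltnW kN); have h2 := gin kN.
have hv : t <= v <= u.
  by case/andP: h1 => ta _; case/andP: h2 => _ bu; rewrite (le_trans ta)// (le_trans vk).
have hN : `|0 - (N j)%:R^-1| < dl / (u - t).
  by near: j; move/cvgrPdist_lt : N_cvg; exact.
apply: hdl => //; rewrite distrC ger0_norm ?subr_ge0//.
move: hN; rewrite sub0r normrN gtr0_norm ?invr_gt0 ?ltr0n// ltr_pdivlMr ?subr_gt0// mulrC.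
apply: le_lt_trans; rewrite -(ugrid_step t u (N j) k); lra.
Unshelve. all: by end_near. Qed.

Let D j k := f (g j k.+1) / f (g j k) - 1.
Let o j := \big[Order.max/0]_(k < N j) `|D j k|.

Let D_le j k : (k < N j)%N -> `|D j k| <= o j.
Proof. by move=> kN; exact: (le_bigmax _ (fun k : 'I_(N j) => `|D j k|) (Ordinal kN)). Qed.

Let o_cvg : o j @[j --> \oo] --> 0.
Proof.
apply/cvgrPdist_le => e e0; have := ratio_le e0; apply: filterS => j hj.
rewrite sub0r normrN ger0_norm; last by apply/bigmax_geP; left.
apply/bigmax_leP; split => [|k _]; first exact: ltW.
by apply: hj => //; rewrite lexx andbT; have [_ _] := gg j; exact.
Qed.

Let iaf (A : set R) : measurable A -> A `<=` `[t, u]%classic ->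
  mu.-integrable A (EFin \o (fun v => a * f v)).
Proof.
move=> mA Asub.
have h : mu.-integrable `[t, u] (EFin \o (fun v => a * f v)).
  apply: continuous_compact_integrable; first exact: segment_compact.
  by move=> v; apply: cvgM; [exact: cvg_cst|exact: f_cont].
by apply: integrableS h => //; exact: measurable_itv.
Qed.

Let x j k := (\int[mu]_(v in `]g j k, g j k.+1]) (a * f v)) / f (g j k).

Let fk_gt0 j k : (k < N j)%N -> 0 < f (g j k).
Proof. by move=> kN; rewrite f_gt0// gin// ltnW. Qed.

Let cell_sub j k : (k < N j)%N -> `]g j k, g j k.+1] `<=` `[t, u]%classic.
Proof.
move=> kN v /=; rewrite !in_itv/= => /andP[kv vk].
have /andP[h1 _] := gin (ltnW kN); have /andP[_ h2] := gin kN.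
by rewrite (le_trans h1 (ltW kv)) (le_trans vk).
Qed.

Let g12 j k : (k < N j)%N -> g j k <= g j k.+1.
Proof. by have [_ _] := gg j; exact. Qed.

Let D_eq j k : (k < N j)%N ->
  D j k = sigma * (W (g j k.+1) - W (g j k)) + (x j k + E j k).
Proof.
move=> kN; have fk : f (g j k) != 0 by rewrite gt_eqF// fk_gt0.
have /andP[h1 _] := gin (ltnW kN); have /andP[h3 h2] := gin kN.
have I : \int[mu]_(v in `]g j k, g j k.+1]) (a * f v) =
    \int[mu]_(v in `[t, g j k.+1]) (a * f v) - \int[mu]_(v in `[t, g j k]) (a * f v).
  rewrite -(@Rintegral_itvB _ _ (BLeft t) (BRight (g j k.+1)) (g j k))//.
  - by apply: iaf => //; apply: subset_itvl; rewrite bnd_simp.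
  - by rewrite bnd_simp g12.
rewrite /x /D /E I.
have e1 := f_eq (ltnW kN); have e2 := f_eq kN.
have e3 : \int[mu]_(v in `[t, g j k.+1]) (a * f v) - \int[mu]_(v in `[t, g j k]) (a * f v) =
  f (g j k.+1) - f (g j k) - (J j k.+1 - J j k).
  by rewrite [in RHS]e2 [in RHS]e1; ring.
rewrite e3; move: fk; move: (f (g j k)) (f (g j k.+1)) => y z y0.
by field.
Qed.

Let Delta j := (u - t) / (N j)%:R.

Let mu_cell j k : (k < N j)%N -> fine (mu `]g j k, g j k.+1]) = Delta j.
Proof.
move=> kN; rewrite lebesgue_measure_itv/= lte_fin.
case: ltP => [_|h]; first by rewrite -EFinB/= ugrid_step.
have h' := g12 kN; rewrite /= /Delta -(ugrid_step t u (N j) k).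
by apply/eqP; rewrite eq_sym subr_eq0 eq_le h h'.
Qed.

(** On short cells the ratio of [f] to its left value is uniformly close to 1, so the relative drift
    of a cell is almost [a] times its length. *)
Let x_le (e : R) : 0 < e -> \forall j \near \oo, forall k, (k < N j)%N ->
  `|x j k - a * Delta j| <= `|a| * e * Delta j.
Proof.
move=> e0; have := ratio_le e0; apply: filterS => j hj k kN.
have mC : measurable (`]g j k, g j k.+1]%classic : set (measurableTypeR R)).
  exact: measurable_itv.
have ic := iaf (measurable_itv _) (cell_sub kN).
have fC : (mu `]g j k, g j k.+1] < +oo)%E.
  by rewrite lebesgue_measure_itv/=; case: ifP => _; rewrite ltry.
have icst (c : R) : mu.-integrable `]g j k, g j k.+1] (EFin \o (fun=> c)).
  by apply: (@integrable_bounded _ _ _ mu _ (fun=> c) `|c|).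
have iq : mu.-integrable `]g j k, g j k.+1] (EFin \o (fun v => a * f v / f (g j k))).
  have := integrableZr mC (f (g j k))^-1 ic; apply: eq_integrable => // v _ /=.
have idf : mu.-integrable `]g j k, g j k.+1] (EFin \o (fun v => a * f v / f (g j k) - a)).
  have := integrableB mC iq (icst a); apply: eq_integrable => // v _ /=.
have -> : x j k - a * Delta j = \int[mu]_(v in `]g j k, g j k.+1]) (a * f v / f (g j k) - a).
  rewrite RintegralB// Rintegral_cst// mu_cell//; congr (_ - _).
  by rewrite /x RintegralZr.
apply: (le_trans (le_normr_Rintegral _ idf)) => //.
rewrite -(mu_cell kN) -Rintegral_cst//; apply: le_Rintegral => //.
  exact: integrable_norm.
move=> v /=; rewrite in_itv/= => /andP[kv vk].
have -> : a * f v / f (g j k) - a = a * (f v / f (g j k) - 1) by ring.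
by rewrite normrM ler_wpM2l// hj// (ltW kv).
Qed.

Let N_Delta j : (N j)%:R * Delta j = u - t.
Proof. by rewrite mulrC /Delta divfK// gt_eqF// ltr0n. Qed.

Let Delta_ge0 j : 0 <= Delta j.
Proof. by rewrite divr_ge0// subr_ge0 ltW. Qed.

Let x1_cvg : \sum_(k < N j) x j k @[j --> \oo] --> a * (u - t).
Proof.
have ut : 0 < u - t by rewrite subr_gt0.
apply/cvgrPdist_le => e e0.
pose e' := e / (`|a| + 1) / (u - t); have a1 : 0 < `|a| + 1 by rewrite ltr_wpDl.
have e'0 : 0 < e' by rewrite !divr_gt0.
have := x_le e'0; apply: filterS => j hj.
rewrite -(N_Delta j) mulrCA mulr_natl -[X in _ *+ X](card_ord (N j)) -sumr_const -sumrB.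
apply: (le_trans (ler_norm_sum _ _ _)).
apply: (@le_trans _ _ (\sum_(k < N j) `|a| * e' * Delta j)).
  by apply: ler_sum => k _; rewrite distrC; exact: hj.
rewrite sumr_const card_ord -[leLHS]mulr_natl mulrCA N_Delta -mulrA.
have -> : e' * (u - t) = e / (`|a| + 1) by rewrite /e' divfK// gt_eqF.
by rewrite mulrA ler_pdivrMr// mulrDr mulr1 mulrC lerDl ltW.
Qed.

Let x2_cvg : \sum_(k < N j) x j k ^+ 2 @[j --> \oo] --> 0.
Proof.
pose K := (`|a| + `|a|) ^+ 2 * (u - t) ^+ 2.
apply: (@cvgp0_squeeze _ _ (fun j => K * (N j)%:R^-1)).
- by move=> j; apply: sumr_ge0 => k _; exact: sqr_ge0.
- have := x_le ltr01; apply: filterS => j hj.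
  apply: (@le_trans _ _ (\sum_(k < N j) ((`|a| + `|a|) * Delta j) ^+ 2)).
    apply: ler_sum => k _; rewrite -[leLHS]real_normK ?num_real//.
    have c0 : 0 <= (`|a| + `|a|) * Delta j by apply: mulr_ge0; [exact: addr_ge0|exact: Delta_ge0].
    rewrite ler_pXn2r ?nnegrE//.
    have := ler_normD (x j k - a * Delta j) (a * Delta j); rewrite subrK.
    have := hj k (ltn_ord k); rewrite [`|a * Delta j|]normrM (ger0_norm (Delta_ge0 j)); lra.
  rewrite sumr_const card_ord -[leLHS]mulr_natl /K -(N_Delta j).
  have N0 : (N j)%:R != 0 :> R by rewrite pnatr_eq0 -lt0n.
  move: (Delta j) N0; move: (N j)%:R => z y z0.
  rewrite le_eqVlt; apply/orP; left; apply/eqP.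
  by field.
- have : K * (N j)%:R^-1 @[j --> \oo] --> K * 0 by apply: cvgM => //; exact: cvg_cst.
  by rewrite mulr0.
Qed.

Let EM2 : \sum_(k < N j) (E j k - M j k) ^+ 2 @[j --> \oo] --> 0.
Proof.
apply: (@cvgp0_squeeze _ _ (fun j => (\sum_(k < N j) `|E j k - M j k|) ^+ 2)).
- by move=> j; apply: sumr_ge0 => k _; exact: sqr_ge0.
- apply: nearW => j; rewrite [leRHS]expr2 big_distrl/=; apply: ler_sum => k _.
  rewrite -[leLHS]real_normK ?num_real// expr2 ler_wpM2l//.
  by rewrite (bigD1 k)//= lerDl sumr_ge0.
- have : (\sum_(k < N j) `|E j k - M j k|) * (\sum_(k < N j) `|E j k - M j k|)
    @[j --> \oo] --> (0 : R) * 0 by exact: cvgM.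
  by rewrite mulr0.
Qed.

Let E2 : \sum_(k < N j) E j k ^+ 2 @[j --> \oo] --> 0.
Proof.
have := @sum_sqr_perturb_cvg R N M (fun j k => E j k - M j k) 0 M2 EM2.
apply: cvg_trans; apply: near_eq_cvg; apply: nearW => j.
by apply: eq_bigr => k _; rewrite addrC subrK.
Qed.

Let E1 : \sum_(k < N j) E j k @[j --> \oo] --> 0.
Proof.
apply: (cvg_dist_le _ EM M1); apply: nearW => j; rewrite -sumrB.
exact: ler_norm_sum.
Qed.

(** Relative increments split into sigma dW, a drift part and [E]. The sums of squares of the last
    two vanish in the limit, so the squares converge to sigma^2 (u - t), while the plain sum
    converges to the drift plus sigma times the increment of [W]. The sum of logarithms telescopes
    for every grid. *)
Lemma log_path_eq :
  ln (f u) - ln (f t) = a * (u - t) + sigma * (W u - W t) - sigma ^+ 2 * (u - t) / 2.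
Proof.
have tel (h : R -> R) j : \sum_(k < N j) (h (g j k.+1) - h (g j k)) = h u - h t.
  have [g0 gN _] := gg j.
  rewrite -(big_mkord xpredT (fun k => h (g j k.+1) - h (g j k))).
  by rewrite (telescope_sumr (fun k => h (g j k)))// gN g0.
have D1 : \sum_(k < N j) D j k @[j --> \oo] --> a * (u - t) + sigma * (W u - W t).
  have : sigma * (W u - W t) + (\sum_(k < N j) x j k + \sum_(k < N j) E j k)
      @[j --> \oo] --> sigma * (W u - W t) + (a * (u - t) + 0).
    by apply: cvgD; [exact: cvg_cst|exact: cvgD].
  rewrite (_ : _ + (_ + 0) = a * (u - t) + sigma * (W u - W t)); last first.
    by rewrite addr0 addrC.
  apply: cvg_trans; apply: near_eq_cvg; apply: nearW => j.
  under [RHS]eq_bigr => k _ do rewrite D_eq//.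
  rewrite !big_split/= -big_distrr/=; congr (_ * _ + _).
  exact/esym/(tel W).
have D2 : \sum_(k < N j) D j k ^+ 2 @[j --> \oo] --> sigma ^+ 2 * (u - t).
  have s2 : \sum_(k < N j) (sigma * (W (g j k.+1) - W (g j k))) ^+ 2
      @[j --> \oo] --> sigma ^+ 2 * (u - t).
    have : sigma ^+ 2 * (\sum_(k < N j) (W (g j k.+1) - W (g j k)) ^+ 2)
      @[j --> \oo] --> sigma ^+ 2 * (u - t) by apply: cvgM; [exact: cvg_cst|exact: W2].
    apply: cvg_trans; apply: near_eq_cvg; apply: nearW => j.
    by rewrite big_distrr/=; apply: eq_bigr => k _; rewrite exprMn.
  have xE2 := @sum_sqr_perturb_cvg R N x E 0 x2_cvg E2.
  have := @sum_sqr_perturb_cvg R N (fun j k => sigma * (W (g j k.+1) - W (g j k)))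
    (fun j k => x j k + E j k) _ s2 xE2.
  apply: cvg_trans; apply: near_eq_cvg; apply: nearW => j.
  by apply: eq_bigr => k _; rewrite D_eq.
have h := @sum_ln_cvg R N D o _ _ D_le o_cvg D1 D2.
have <- := cvg_lim (@Rhausdorff R) h.
apply/esym/cvg_lim => //; apply: cvg_near_cst; apply: nearW => j.
rewrite -(tel (fun v => ln (f v)) j); apply: eq_bigr => k _; rewrite /D subrKC ln_div// posrE.
  by apply: f_gt0; exact: gin.
exact: fk_gt0.
Qed.

End pathwise_logarithm.

Section increment_squares.
Context {R : realType} {d : measure_display} {Omega : measurableType d}.
Variables (P : probability Omega R) (F : R -> set (set Omega)) (W : R -> Omega -> R).
Hypotheses (F_filt : filtration F) (W_bm : brownian_motion P F W).
Variables (t u : R).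
Hypotheses (t0 : 0 <= t) (tu : t <= u).

(** The centred squared increments are orthogonal with variance 2 De^2, by the fourth moment;
    Chebyshev's inequality leaves a bound of order 1/n. *)
Lemma quadratic_variation : cvgp0 P (fun n w =>
  \sum_(k < n.+1) (W (ugrid t u n.+1 k.+1) w - W (ugrid t u n.+1 k) w) ^+ 2 - (u - t)).
Proof.
pose g n := ugrid t u n.+1; pose De n := (u - t) / n.+1%:R : R.
have gg n : grid_on t u n.+1 (g n) by exact: ugrid_grid.
have g0 n k : (k <= n.+1)%N -> 0 <= g n k.
  by move=> kn; have /andP[+ _] := grid_in (gg n) kn; exact: le_trans.
have gle n k : (k < n.+1)%N -> g n k <= g n k.+1 by have [_ _] := gg n; exact.
pose Z n (k : 'I_n.+1) w := (W (g n k.+1) w - W (g n k) w) ^+ 2 - De n.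
have sumZ n w : \sum_(k < n.+1) (W (g n k.+1) w - W (g n k) w) ^+ 2 - (u - t) =
    \sum_(k < n.+1) Z n k w.
  by rewrite sumrB sumr_const card_ord -[_ *+ n.+1]mulr_natl /De mulrC divfK.
have iX n k j : (k < n.+1)%N -> (j <= 4)%N -> rv_integrable P (fun w => (W (g n k.+1) w - W (g n k) w) ^+ j).
  by move=> kn; exact: (rv_integrable_incrementX F_filt W_bm (g0 n k (ltnW kn)) (gle n k kn)).
have iZ n k : rv_integrable P (Z n k).
  by apply: rv_integrableB; [exact: iX|exact: rv_integrable_cst].
have mom n (k : 'I_n.+1) := increment_moments F_filt W_bm (g0 n k (ltnW (ltn_ord k))) (gle n k (ltn_ord k)).
have meanZ0 n k : mean P (Z n k) = 0.
  have [_ m2 _] := mom n k.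
  by rewrite meanB ?mean_cst ?m2 ?ugrid_step ?subrr//; [exact: iX|exact: rv_integrable_cst].
have ZZ n (i j : 'I_n.+1) : (i < j)%N ->
    rv_integrable P (fun w => Z n i w * Z n j w) /\ mean P (fun w => Z n i w * Z n j w) = 0.
  move=> ij; have jn := ltn_ord j; have in_ := ltn_ord i.
  have gij : g n i.+1 <= g n j by exact: (grid_homo (gg n) ij (ltnW jn)).
  have Fs := filtration_sigma F_filt (g0 n i.+1 in_).
  have mZ : measurable_wrt (F (g n j)) (Z n i).
    apply: (measurable_wrt_le F_filt (g0 n i.+1 in_) gij).
    apply: measurable_wrtB => //; last exact: measurable_wrt_cst.
    apply: (measurable_wrt_comp (g := fun x => x ^+ 2)); first exact: exprn_measurable.
    by apply: (increment_adapted F_filt W_bm); [exact: g0 (ltnW in_)|exact: gle].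
  have mg : measurable_fun setT (fun x : R => x ^+ 2 - De n).
    by apply: measurable_funB => //; exact: exprn_measurable.
  have [iij mij] := rv_integrableM_increment W_bm (g0 n j (ltnW jn)) (gle n j jn) mZ (iZ n i) mg (iZ n j).
  by split => //; rewrite mij meanZ0 mul0r.
have Z2 n k : rv_integrable P (fun w => Z n k w * Z n k w) /\
    mean P (fun w => Z n k w ^+ 2) = 2 * De n ^+ 2.
  have [_ m2 m4] := mom n k; have kn := ltn_ord k.
  have E : (fun w => Z n k w ^+ 2) = (fun w => (W (g n k.+1) w - W (g n k) w) ^+ 4
      - 2 * De n * (W (g n k.+1) w - W (g n k) w) ^+ 2 + De n ^+ 2).
    by apply/funext => w; rewrite /Z; ring.
  have i4 := iX n k 4%N kn isT; have i2 := rv_integrableZ (2 * De n) (iX n k 2%N kn isT).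
  have i42 := rv_integrableB i4 i2.
  have ic := rv_integrable_cst P (De n ^+ 2).
  split.
    under [X in rv_integrable _ X]funext do rewrite -expr2.
    by rewrite E; exact: rv_integrableD.
  rewrite E meanD// meanB// meanZ; last exact: iX.
  by rewrite mean_cst m2 m4 ugrid_step -/(De n); ring.
have iZZ n i j : rv_integrable P (fun w => Z n i w * Z n j w).
  case: (ltngtP i j) => [ij|ij|/val_inj ->].
  - by have [] := ZZ n i j ij.
  - by have [+ _] := ZZ n j i ij; under [X in rv_integrable _ X]funext do rewrite mulrC.
  - by have [] := Z2 n j.
have orth n := mean_sqr_orthogonal predT (iZZ n) (fun i j ij => (ZZ n i j ij).2).
have mS n : measurable_fun setT (fun w => \sum_(k < n.+1) Z n k w).
  by apply: measurable_sum => k; exact: rv_integrable_measurable (iZ n k).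
split=> [n|e e0].
  by under [X in measurable_fun _ X]funext do rewrite sumZ; exact: mS.
apply: (@cvgp0_squeeze _ _ (fun n => 2 * (u - t) ^+ 2 / e ^+ 2 / n.+1%:R)).
- by move=> n; exact: prob_ge0.
- apply: nearW => n; have [iS mS2] := orth n.
  have e20 : 0 < e ^+ 2 by rewrite exprn_gt0.
  apply: (@le_trans _ _ (prob P [set w | e ^+ 2 <= (\sum_(k < n.+1) Z n k w) ^+ 2])).
    apply: prob_le; last first.
    + move=> w /=; rewrite sumZ => h.
      by rewrite -[leRHS]real_normK ?num_real// ler_pXn2r ?nnegrE// ltW.
    + by apply: measurable_ge_rv; apply: measurable_funX; exact: mS.
    + apply: measurable_ge_rv; apply: measurableT_comp => //.
      by under [X in measurable_fun _ X]funext do rewrite sumZ; exact: mS.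
  apply: (le_trans (prob_markov iS _ e20)); first by move=> w; exact: sqr_ge0.
  rewrite mS2 /=; under eq_bigr do rewrite (Z2 n _).2.
  rewrite sumr_const card_ord -[X in X / _]mulr_natl /De le_eqVlt; apply/orP; left; apply/eqP.
  have n0 : n.+1%:R != 0 :> R by rewrite pnatr_eq0.
  have e1 : e != 0 by rewrite gt_eqF.
  by move: n.+1%:R n0 => z z0; field; rewrite e1 z0.
- apply/cvgrPdist_le => eps eps0; have := @near_natinv R (2 * (u - t) ^+ 2 / e ^+ 2) _ eps0.
  apply: filterS => n /ltW h; rewrite sub0r normrN ger0_norm//.
  by rewrite !divr_ge0// ?sqr_ge0// mulr_ge0// sqr_ge0.
Qed.

End increment_squares.

Lemma ugrid_refine {R : realType} (t u : R) n m k : (0 < m)%N ->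
  ugrid t u n k = ugrid t u (n * m) (k * m).
Proof.
move=> m0; rewrite /ugrid !natrM; congr (_ + _ * _).
by rewrite -mulf_div divff ?mulr1// pnatr_eq0 -lt0n.
Qed.

Lemma sum_divn_group {R : realType} (n m k : nat) (f : nat -> R) : (0 < m)%N -> (k < n)%N ->
  \sum_(i < n * m | (i %/ m == k)%N) f i = \sum_(k * m <= i < k.+1 * m) f i.
Proof.
move=> m0 kn; rewrite -(big_mkord (fun i => i %/ m == k)%N f).
have h1 : (k * m <= k.+1 * m)%N by rewrite leq_mul2r leqnSn orbT.
have h2 : (k.+1 * m <= n * m)%N by rewrite leq_mul2r kn orbT.
rewrite (big_cat_nat (leq0n (k * m)) (leq_trans h1 h2))/= big_nat_cond big_pred0 ?add0r; last first.
  move=> i; apply/negP => /andP[/andP[_ h] /eqP e]; move: h.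
  by rewrite -{1}e leqNgt ltnS leq_divM.
rewrite (big_cat_nat h1 h2)/= [X in _ + X]big_nat_cond [X in _ + X]big_pred0 ?addr0; last first.
  move=> i; apply/negP => /andP[/andP[h _] /eqP e]; move: h.
  by rewrite -leq_divRL// e ltnn.
rewrite big_nat_cond [RHS]big_nat_cond; apply: eq_bigl => i.
case: (boolP (k * m <= i < k.+1 * m)%N) => //= /andP[h h'].
by rewrite eqn_leq leq_divRL// h -ltnS ltn_divLR// h'.
Qed.

(** * The price equation on two grids *)

Section price_identification.
Context {R : realType} {d : measure_display} {Omega : measurableType d}.
Local Notation mu := (@lebesgue_measure R).
Variables (P : probability Omega R) (F : R -> set (set Omega)) (W : R -> Omega -> R).
Hypotheses (F_filt : filtration F) (W_bm : brownian_motion P F W).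
Variables (r q sigma T t s u : R) (S : R -> Omega -> R).
Hypotheses (t0 : 0 <= t) (tu : t < u) (uT : u <= T).
Hypothesis S_price : price_process P F W r q sigma T t s S.

Local Notation g n := (ugrid t u n).

Let S_gt0 v w : t <= v <= u -> 0 < S v w.
Proof.
case: S_price => h _ _ _ _ /andP[tv vu]; apply: h.
by rewrite tv (le_trans vu).
Qed.

Let S_cont w : {within `[t, u], continuous (fun v => S v w)}.
Proof.
case: S_price => _ h _ _ _; apply: continuous_subspaceW (h w).
by apply: subset_itvl; rewrite bnd_simp.
Qed.

Let S_adapted v : t <= v <= u -> measurable_wrt (F v) (S v).
Proof.
case: S_price => _ _ h _ _ /andP[tv vu]; apply: h.
by rewrite tv (le_trans vu).
Qed.

Let gg n : (0 < n)%N -> grid_on t u n (g n). Proof. by move=> n0; apply: ugrid_grid => //; exact: ltW. Qed.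

Let gin n k : (0 < n)%N -> (k <= n)%N -> t <= g n k <= u.
Proof. by move=> n0 kn; exact: grid_in (gg n0) kn. Qed.

Let g_ge0 n k : (0 < n)%N -> (k <= n)%N -> 0 <= g n k.
Proof. by move=> n0 kn; have /andP[+ _] := gin n0 kn; exact: le_trans. Qed.

Let gle n k : (0 < n)%N -> (k < n)%N -> g n k <= g n k.+1.
Proof. by move=> n0; have [_ _] := gg n0; exact. Qed.

Let dW n i w := W (g n i.+1) w - W (g n i) w.

(** The Riemann sum up to coarse node [k]. All coarse nodes use the same fine grid, so the
    difference of two consecutive sums is a sum over the fine cells of one coarse cell. *)
Let Rsum n m k w := \sum_(i < k * m) sigma * S (g (n * m) i) w * dW (n * m) i w.

Let RsumE n m k w : (0 < n)%N -> (0 < m)%N -> (0 < k)%N ->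
  step_integral W (riemann_steps (fun v w => sigma * S v w) t (g n k) (k * m)) w = Rsum n m k w.
Proof.
move=> n0 m0 k0; rewrite /step_integral /= /Rsum.
have E i : t + (g n k - t) * (i%:R / (k * m)%:R) = g (n * m) i.
  rewrite /ugrid !natrM; field.
  by rewrite !pnatr_eq0 -!lt0n n0 m0 k0.
by apply: eq_bigr => i _; rewrite !E.
Qed.

(** The price equation gives an integral for each fixed upper limit, outside a null set depending on
    it. Finitely many limits are handled at a time, one integral being chosen per coarse node. *)
Let coarse_ito n : (0 < n)%N -> exists Jc : nat -> Omega -> R, forall k, (k <= n)%N ->
  [/\ measurable_fun setT (Jc k), cvgp0 P (fun m w => Rsum n m.+1 k w - Jc k w) &
      {ae P, forall w, S (g n k) w =
         S t w + \int[mu]_(v in `[t, g n k]) ((r - q) * S v w) + Jc k w}].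
Proof.
move=> n0; have H k : exists J : Omega -> R, (k <= n)%N ->
  [/\ measurable_fun setT J, cvgp0 P (fun m w => Rsum n m.+1 k w - J w) &
      {ae P, forall w, S (g n k) w =
         S t w + \int[mu]_(v in `[t, g n k]) ((r - q) * S v w) + J w}].
  have [kn|] := leqP k n; last first.
    by move=> kn; exists (fun=> 0) => kn'; move: kn; rewrite ltnNge kn'.
  have [->|k0] := posnP k.
    have R0 : (fun m w => Rsum n m.+1 0 w - 0) = (fun m w => 0).
      apply/funext => m; apply/funext => w; rewrite subr0 /Rsum big1//.
      by case=> i; rewrite mul0n.
    exists (fun=> 0) => _; split=> //.
      by rewrite R0; apply: cvgp0_pointwise => // w; exact: cvg_cst.
    apply: aeW => w; have -> : g n 0 = t by rewrite /ugrid mul0r mulr0 addr0.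
    by rewrite set_itv1 Rintegral_set1 !addr0.
  have kI : t <= g n k <= T.
    by have /andP[-> h] := gin n0 kn; rewrite (le_trans h).
  case: S_price => _ _ _ _ /(_ _ kI)[J iJ Jae]; exists J => _.
  have tk : t <= g n k by case/andP: kI.
  have sub : `[t, g n k] `<=` `[t, u]%classic.
    by apply: subset_itvl; rewrite bnd_simp; have /andP[_] := gin n0 kn.
  have Hc w : {within `[t, g n k], continuous (fun v => sigma * S v w)}.
    move=> v; apply: cvgM; first exact: cvg_cst.
    exact: (continuous_subspaceW sub (@S_cont w)).
  have Ha v : t <= v <= g n k -> measurable_wrt (F v) (fun w => sigma * S v w).
    move=> /andP[tv vk]; have vI : t <= v <= u.
      by rewrite tv (le_trans vk)//; have /andP[_] := gin n0 kn.
    have Fs := filtration_sigma F_filt (le_trans t0 tv).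
    by apply: measurable_wrtM => //; [exact: measurable_wrt_cst|exact: S_adapted].
  have mJ : measurable_fun setT J by case: iJ.
  have mR m : measurable_fun setT (Rsum n m.+1 k).
    have km0 : (0 < k * m.+1)%N by rewrite muln_gt0 k0.
    have := measurable_step_integral F_filt W_bm t0
      (riemann_steps_grid (fun v w => sigma * S v w) tk km0)
      (riemann_steps_adapted tk km0 Ha).
    by under [X in measurable_fun _ X -> _]funext do rewrite RsumE//.
  split=> //; split=> [m|e e0]; first exact: measurable_funB.
  have := ito_integral_riemann F_filt W_bm t0 tk Hc Ha iJ e0.
  move=> /cvgrPdist_le h; apply/cvgrPdist_le => eps eps0.
  have [n1 _ hn1] := h _ eps0.
  (* [ito_integral_riemann] counts [N.+1] cells, hence the predecessor of [k * m.+1]. *)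
  exists n1 => // m /= hm; have := hn1 (k * m.+1).-1; rewrite /= prednK ?muln_gt0 ?k0//.
  under [X in `|_ - prob P X| <= _](_ : _ = [set w | e <= `|Rsum n m.+1 k w - J w|]).
    by apply/seteqP; split=> w /=; rewrite RsumE.
  apply; rewrite -ltnS prednK ?muln_gt0 ?k0//; apply: (leq_ltn_trans hm).
  by rewrite -[X in (X < _)%N]mul1n; apply: (leq_trans (_ : 1 * m < 1 * m.+1)%N); rewrite ?mul1n// leq_pmull.
have [f hf] := choice H.
by exists f.
Qed.

Let M n m k w := (Rsum n m k.+1 w - Rsum n m k w) / S (g n k) w - sigma * dW n k w.

(** The relative deviation of the price from its value at the last coarse node, times sigma. The
    form with exponential and logarithms makes adaptedness immediate; [hE] restores the quotient. *)
Let h n m i w := sigma * (expR (ln (S (g (n * m) i) w) - ln (S (g n (i %/ m)) w)) - 1).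

Let hE n m i w : (0 < n)%N -> (0 < m)%N -> (i < n * m)%N ->
  h n m i w = sigma * (S (g (n * m) i) w / S (g n (i %/ m)) w - 1).
Proof.
move=> n0 m0 im; have nm0 : (0 < n * m)%N by rewrite muln_gt0 n0.
have kn : (i %/ m <= n)%N by rewrite ltnW// ltn_divLR.
rewrite /h expRD expRN !lnK// posrE; apply: S_gt0; last exact: gin (ltnW im).
exact: gin.
Qed.

Let M_eq n m k w : (0 < n)%N -> (0 < m)%N -> (k < n)%N ->
  M n m k w = \sum_(i < n * m | (i %/ m == k)%N) h n m i w * dW (n * m) i w.
Proof.
move=> n0 m0 kn.
rewrite (sum_divn_group (fun i => h n m i w * dW (n * m) i w) m0 kn).
have km : (k * m <= k.+1 * m)%N by rewrite leq_mul2r leqnSn orbT.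
have E1 : Rsum n m k.+1 w - Rsum n m k w =
    \sum_(k * m <= i < k.+1 * m) sigma * S (g (n * m) i) w * dW (n * m) i w.
  rewrite /Rsum -!(big_mkord xpredT (fun i => sigma * S (g (n * m) i) w * dW (n * m) i w)).
  by rewrite (big_cat_nat (leq0n (k * m)) km)/= addrAC subrr add0r.
have E2 : dW n k w = \sum_(k * m <= i < k.+1 * m) dW (n * m) i w.
  by rewrite (telescope_sumr (fun i => W (g (n * m) i) w) km) /dW !(ugrid_refine _ _ n _ m0).
rewrite /M E1 E2 big_distrl big_distrr/= -sumrB.
apply: eq_big_nat => i /andP[ki ik].
have inm : (i < n * m)%N by rewrite (leq_trans ik)// leq_mul2r kn orbT.
rewrite hE//; have -> : (i %/ m)%N = k.
  by apply/eqP; rewrite eqn_leq -ltnS ltn_divLR// ik leq_divRL.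
have := S_gt0 w (gin n0 (ltnW kn)); move: (S (g n k) w) => z z0.
by field; rewrite gt_eqF.
Qed.

Let ln_measurable_wrt v v' : t <= v -> v <= v' -> v' <= u ->
  measurable_wrt (F v') (fun w => ln (S v w)).
Proof.
move=> tv vv' v'u; apply: (measurable_wrt_le F_filt (le_trans t0 tv) vv').
apply: (measurable_wrt_comp (g := @ln R)); first exact: measurable_ln.
by apply: S_adapted; rewrite tv (le_trans vv').
Qed.

Let h_adapted n m i : (0 < n)%N -> (0 < m)%N -> (i < n * m)%N ->
  measurable_wrt (F (g (n * m) i)) (h n m i).
Proof.
move=> n0 m0 im; have nm0 : (0 < n * m)%N by rewrite muln_gt0 n0.
have /andP[h1 h2] := gin nm0 (ltnW im).
have Fs := filtration_sigma F_filt (le_trans t0 h1).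
have kn : (i %/ m <= n)%N by rewrite ltnW// ltn_divLR.
have /andP[h3 h4] := gin n0 kn.
apply: measurable_wrtM => //; first exact: measurable_wrt_cst.
apply: measurable_wrtB => //; last exact: measurable_wrt_cst.
apply: (measurable_wrt_comp (g := @expR R)); first exact: measurable_expR.
apply: measurable_wrtB => //; apply: ln_measurable_wrt => //.
rewrite (ugrid_refine t u n _ m0); apply: (grid_homo (gg nm0) _ (ltnW im)).
exact: leq_divM.
Qed.

Let Eg n m w := energy (g (n * m)) (h n m) (n * m) w.

(** Uniform continuity of a positive path keeps the ratio near 1 within a coarse cell, however fine
    the inner grid is. This uniformity in [m] permits choosing [m] afterwards. *)
Let energy_small (e : R) w : 0 < e -> \forall n \near \oo, forall m, (0 < m)%N ->
  Eg n.+1 m w <= (sigma * e) ^+ 2 * (u - t).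
Proof.
move=> e0; have [_ hr] := ratio_unif (ltW tu) (fun v => @S_gt0 v w) (@S_cont w).
have [dl dl0 hdl] := hr e e0.
have := @near_natinv R (u - t) dl dl0; apply: filterS => n hn m m0.
have nm0 : (0 < n.+1 * m)%N by rewrite muln_gt0.
have nm0' : 0 < (n.+1 * m)%:R :> R by rewrite ltr0n.
have ut : 0 < u - t by rewrite subr_gt0.
apply: (@le_trans _ _ (\sum_(i < n.+1 * m) (sigma * e) ^+ 2 * ((u - t) / (n.+1 * m)%:R))).
  apply: ler_sum => i _; rewrite ugrid_step ler_wpM2r ?divr_ge0 ?(ltW ut) ?(ltW nm0')//.
  rewrite hE// exprMn [leRHS]exprMn ler_wpM2l ?sqr_ge0//.
  rewrite -[leLHS]real_normK ?num_real// ler_pXn2r ?nnegrE ?(ltW e0)//.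
  have kn : (i %/ m <= n.+1)%N by rewrite ltnW// ltn_divLR.
  apply: hdl; [exact: gin|exact: gin (ltnW (ltn_ord i))|].
  apply: le_lt_trans hn; rewrite (ugrid_refine t u n.+1 _ m0) distrC.
  have ki : (i %/ m * m <= i)%N by exact: leq_divM.
  rewrite ger0_norm ?subr_ge0; last exact: (grid_homo (gg nm0) ki (ltnW (ltn_ord i))).
  have -> : g (n.+1 * m) i - g (n.+1 * m) (i %/ m * m) =
      (u - t) / (n.+1 * m)%:R * (i%:R - (i %/ m * m)%:R) by rewrite /ugrid; ring.
  have -> : i%:R - (i %/ m * m)%:R = (i %% m)%N%:R :> R.
    by rewrite [in X in X - _](divn_eq i m) natrD addrAC subrr add0r.
  apply: (@le_trans _ _ ((u - t) / (n.+1 * m)%:R * m%:R)).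
    by rewrite ler_wpM2l ?divr_ge0 ?(ltW ut) ?(ltW nm0')// ler_nat ltnW// ltn_mod.
  have m1 : m%:R != 0 :> R by rewrite pnatr_eq0 -lt0n.
  have n1 : n.+1%:R != 0 :> R by rewrite pnatr_eq0.
  rewrite natrM le_eqVlt; apply/orP; left; apply/eqP.
  by move: n.+1%:R n1 => z z0; field; rewrite z0 m1.
rewrite sumr_const card_ord -[leLHS]mulr_natl mulrCA ler_wpM2l ?sqr_ge0//.
by rewrite mulrC divfK// gt_eqF.
Qed.

(** Taking [eta] proportional to [e * eps] settles the second term of the truncation bound; the
    first tends to zero since the energy does so pointwise. *)
Let cvgp0_energy (m_ : nat -> nat) (X : nat -> Omega -> R) : (forall n, (0 < m_ n)%N) ->
  (forall n, measurable_fun setT (X n)) -> (forall n w, 0 <= X n w) ->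
  (forall n (eta e : R), 0 <= eta -> 0 < e -> prob P [set w | e <= X n w] <=
     prob P [set w | eta < Eg n.+1 (m_ n) w] + eta / e) -> cvgp0 P X.
Proof.
move=> m0 mX X0 hX; split=> // e e0.
have mE n : measurable_fun setT (Eg n.+1 (m_ n)).
  apply: measurable_sum => i; apply: measurable_funM => //; apply: measurable_funX.
  have nm0 : (0 < n.+1 * m_ n)%N by rewrite muln_gt0 m0.
  apply: (measurable_wrt_measurable _ (h_adapted (ltn0Sn n) (m0 n) (ltn_ord i))).
  by apply: (filtration_sub F_filt); exact: g_ge0 (ltnW (ltn_ord i)).
have Eg0 n w : 0 <= Eg n.+1 (m_ n) w.
  apply: sumr_ge0 => i _; rewrite mulr_ge0 ?sqr_ge0// ugrid_step divr_ge0//.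
  by rewrite subr_ge0 ltW.
have cE : cvgp0 P (fun n => Eg n.+1 (m_ n)).
  apply: cvgp0_pointwise => // w; apply/cvgrPdist_le => eps eps0.
  pose K := 1 + (sigma ^+ 2 * (u - t)); have ut : 0 < u - t by rewrite subr_gt0.
  have K0 : 0 < K by rewrite ltr_pwDl// mulr_ge0 ?sqr_ge0// ltW.
  pose e' := Num.min 1 (eps / K).
  have e'0 : 0 < e' by rewrite lt_min ltr01 divr_gt0.
  have := energy_small w e'0; apply: filterS => n hn.
  rewrite sub0r normrN ger0_norm//; apply: (le_trans (hn _ (m0 n))).
  have e1 : e' <= 1 by rewrite ge_min lexx.
  have e2 : e' * K <= eps by rewrite -ler_pdivlMr// ge_min lexx orbT.
  apply: le_trans e2; rewrite exprMn /K.
  have s0 : 0 <= sigma ^+ 2 * (u - t) by rewrite mulr_ge0 ?sqr_ge0 ?ltW.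
  have : e' ^+ 2 <= e' by rewrite expr2 ler_piMr// ltW.
  have -> : sigma ^+ 2 * e' ^+ 2 * (u - t) = e' ^+ 2 * (sigma ^+ 2 * (u - t)) by ring.
  move: (sigma ^+ 2 * (u - t)) s0 => z z0 h2.
  have := ler_wpM2r z0 h2; lra.
apply/cvgrPdist_le => eps eps0.
pose eta := e * (eps / 2); have eta0 : 0 < eta by rewrite mulr_gt0// divr_gt0.
have eps2 : 0 < eps / 2 by rewrite divr_gt0.
have /cvgrPdist_le/(_ _ eps2) := cE.2 eta eta0; apply: filterS => n.
rewrite !sub0r !normrN !ger0_norm ?prob_ge0// => hn.
have -> : [set w | e <= `|X n w|] = [set w | e <= X n w].
  by apply/seteqP; split=> w /=; rewrite ger0_norm.
have := hX n eta e (ltW eta0) e0; have -> : eta / e = eps / 2 by rewrite /eta; field; rewrite gt_eqF.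
have : prob P [set w | eta < Eg n.+1 (m_ n) w] <= prob P [set w | eta <= `|Eg n.+1 (m_ n) w|].
  apply: prob_le; [exact: measurable_gt_rv| |].
    by apply: measurable_ge_rv; exact: measurableT_comp.
  by move=> w /= /ltW hw; rewrite ger0_norm.
lra.
Qed.

Let M_measurable n m k : (0 < n)%N -> (0 < m)%N -> (k < n)%N -> measurable_fun setT (M n m k).
Proof.
move=> n0 m0 kn; have nm0 : (0 < n * m)%N by rewrite muln_gt0 n0.
have -> : M n m k = fun w => \sum_(i < n * m | (i %/ m == k)%N) h n m i w * dW (n * m) i w.
  by apply/funext => w; exact: M_eq.
under [X in measurable_fun _ X]funext do rewrite big_mkcond.
apply: measurable_sum => i; case: (boolP (_ == k)) => _; last exact: measurable_cst.
apply: measurable_funM.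
  apply: (measurable_wrt_measurable _ (h_adapted n0 m0 (ltn_ord i))).
  by apply: (filtration_sub F_filt); exact: g_ge0 (ltnW (ltn_ord i)).
apply: (measurable_increment F_filt W_bm); first exact: g_ge0 (ltnW (ltn_ord i)).
exact: gle.
Qed.

Let ito_prob n m (l : nat) (Q : 'I_l -> pred 'I_(n * m)) (eta e : R) : (0 < n)%N -> (0 < m)%N ->
  (forall i, \sum_(j < l) (Q j i : nat) <= 1)%N -> 0 <= eta -> 0 < e ->
  prob P [set w | e <= \sum_(j < l)
      (\sum_(i < n * m | Q j i) h n m i w * dW (n * m) i w) ^+ 2] <=
  prob P [set w | eta < Eg n m w] + eta / e.
Proof.
move=> n0 m0 Q1 eta0 e0; have nm0 : (0 < n * m)%N by rewrite muln_gt0 n0.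
apply: (truncated_ito_prob F_filt W_bm) => //; first exact: g_ge0.
- by move=> i im; exact: gle.
- by move=> i im; exact: h_adapted.
Qed.

(** Here the blocks of the isometry are the coarse cells; for the plain sum in [M1_cvg] all fine
    cells form one block. *)
Let M2_cvg (m_ : nat -> nat) : (forall n, (0 < m_ n)%N) ->
  cvgp0 P (fun n w => \sum_(k < n.+1) M n.+1 (m_ n) k w ^+ 2).
Proof.
move=> m0; apply: (cvgp0_energy m0).
- move=> n; apply: measurable_sum => k; apply: measurable_funX.
  exact: M_measurable.
- by move=> n w; apply: sumr_ge0 => k _; exact: sqr_ge0.
- move=> n eta e eta0 e0.
  have Q1 i : (\sum_(j < n.+1) ((i %/ m_ n == j)%N : nat) <= 1)%N.
    have [hi|hi] := ltnP (i %/ m_ n) n.+1; last first.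
      by rewrite big1// => j _; case: eqP => // e'; move: hi; rewrite e' leqNgt ltn_ord.
    rewrite (bigD1 (Ordinal hi))//= eqxx big1// => j jh.
    by case: eqP => // e'; case/negP: jh; apply/eqP/val_inj.
  have := @ito_prob n.+1 (m_ n) n.+1 (fun k i => (i %/ m_ n == k)%N) eta e isT (m0 n) (fun i => Q1 i) eta0 e0.
  congr (prob P _ <= _); apply/seteqP; split=> w /=;
    by under [X in _ <= X -> _]eq_bigr => k _ do rewrite ?M_eq//; under [X in _ -> _ <= X]eq_bigr => k _ do rewrite ?M_eq//.
Qed.

Let M1_cvg (m_ : nat -> nat) : (forall n, (0 < m_ n)%N) ->
  cvgp0 P (fun n w => \sum_(k < n.+1) M n.+1 (m_ n) k w).
Proof.
move=> m0.
have mS n : measurable_fun setT (fun w => \sum_(k < n.+1) M n.+1 (m_ n) k w).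
  by apply: measurable_sum => k; exact: M_measurable.
have h2 : cvgp0 P (fun n w => (\sum_(k < n.+1) M n.+1 (m_ n) k w) ^+ 2).
  apply: (cvgp0_energy m0).
  - by move=> n; exact: measurable_funX.
  - by move=> n w; exact: sqr_ge0.
  - move=> n eta e eta0 e0.
    have Q1 (i : 'I_(n.+1 * m_ n)) : (\sum_(j < 1) (true : nat) <= 1)%N by rewrite big_ord1.
    have := @ito_prob n.+1 (m_ n) 1 (fun _ _ => true) eta e isT (m0 n) Q1 eta0 e0.
    congr (prob P _ <= _); apply: eq_set => w; rewrite big_ord1; congr (_ <= _ ^+ 2).
    rewrite (partition_big (fun i : 'I_(n.+1 * m_ n) => inord (i %/ m_ n) : 'I_n.+1) xpredT)//=.
    apply: eq_bigr => k _; rewrite M_eq//; apply: eq_bigl => i.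
    by rewrite -val_eqE/= inordK// ltn_divLR.
split=> [//|e e0]; have := h2.2 _ (exprn_gt0 2 e0).
apply: cvg_trans; apply: near_eq_cvg; apply: nearW => n; congr (prob P _).
apply: eq_set => w; rewrite normrX ler_pXn2r ?nnegrE ?(ltW e0)//.
Qed.

(** For each [n] the refinement [m_ n] is chosen so that, with probability near 1, all coarse
    integrals are close to their Riemann sums. All errors then tend to zero in probability, and the
    pathwise lemma is applied along a subsequence depending on w. *)
Lemma price_log : {ae P, forall w, ln (S u w) - ln s =
  (r - q) * (u - t) + sigma * (W u w - W t w) - sigma ^+ 2 * (u - t) / 2}.
Proof.
have [Jc hJc] := choice (fun n => coarse_ito (ltn0Sn n)).
pose CC n m w := \sum_(k < n.+2) `|Rsum n.+1 m.+1 k w - Jc n k w|.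
have cCC n : cvgp0 P (CC n).
  apply: (@cvgp0_sum _ _ _ P n.+2 (fun k m w => `|Rsum n.+1 m.+1 k w - Jc n k w|)) => k kn.
  by apply: cvgp0_norm; have [] := hJc n k kn.
have /choice[m_ hm] n : exists m, prob P [set w | n.+1%:R^-1 <= `|CC n m w|] <= n.+1%:R^-1.
  have n0 : 0 < n.+1%:R^-1 :> R by rewrite invr_gt0.
  have /cvgrPdist_le/(_ _ n0)[m1 _ hm1] := (cCC n).2 _ n0.
  exists m1; have := hm1 m1 (leqnn _).
  by rewrite sub0r normrN ger0_norm// prob_ge0.
have C0 : cvgp0 P (fun n => CC n (m_ n)).
  split=> [n|e e0]; first exact: (cCC n).1.
  apply: (@cvgp0_squeeze _ _ (fun n => n.+1%:R^-1)) => [n||]; first exact: prob_ge0.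
    have := @near_natinv R 1 e e0; apply: filterS => n; rewrite mul1r => ne.
    apply: le_trans (hm n); apply: prob_le => [||w /=].
    - by apply: measurable_ge_rv; apply: measurableT_comp => //; exact: (cCC n).1.
    - by apply: measurable_ge_rv; apply: measurableT_comp => //; exact: (cCC n).1.
    - by apply: le_trans; exact: ltW.
  exact: cvg_harmonic.
(* Adding the four errors lets a single subsequence serve all of them. *)
pose Q n w := `|CC n (m_ n) w| + `|\sum_(k < n.+1) M n.+1 (m_ n).+1 k w| +
  `|\sum_(k < n.+1) M n.+1 (m_ n).+1 k w ^+ 2| +
  `|\sum_(k < n.+1) (W (g n.+1 k.+1) w - W (g n.+1 k) w) ^+ 2 - (u - t)|.
have Q0 : cvgp0 P Q.
  have q1 := cvgp0_norm C0.
  have q2 := cvgp0_norm (M1_cvg (m_ := fun n => (m_ n).+1) (fun=> isT)).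
  have q3 := cvgp0_norm (M2_cvg (m_ := fun n => (m_ n).+1) (fun=> isT)).
  have q4 := cvgp0_norm (quadratic_variation F_filt W_bm t0 (ltW tu)).
  exact: cvgp0D (cvgp0D (cvgp0D q1 q2) q3) q4.
have St : {ae P, forall w, S t w = s} by case: S_price.
have aeJ : {ae P, forall w, forall n k, (k <= n.+1)%N -> S (g n.+1 k) w =
   S t w + \int[mu]_(v in `[t, g n.+1 k]) ((r - q) * S v w) + Jc n k w}.
  apply: ae_foralln => n; apply: ae_foralln => k.
  have [kn|kn] := leqP k n.+1; last by apply: aeW.
  by have [_ _] := hJc n k kn; apply: filterS => w ->.
near=> w.
have Stw : S t w = s by near: w.
have Jw : forall n k, (k <= n.+1)%N -> S (g n.+1 k) w =
   S t w + \int[mu]_(v in `[t, g n.+1 k]) ((r - q) * S v w) + Jc n k w by near: w.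
have Fw : forall j N : nat, exists2 n, (N <= n)%N & `|Q n w| < j.+1%:R^-1.
  by near: w; exact: cvgp0_frequently.
have /choice[n_ hn] j : exists n, (j <= n)%N /\ `|Q n w| < j.+1%:R^-1.
  by have [n] := Fw j j; exists n.
have small (f : nat -> R) : (forall n, `|f n| <= `|Q n w|) -> f (n_ j) @[j --> \oo] --> 0.
  move=> hf; apply: (@cvg_dist_le _ _ (fun=> 0) (fun j => j.+1%:R^-1)).
  - apply: nearW => j; rewrite subr0; apply: le_trans (hf _) _; apply/ltW.
    by have [] := hn j.
  - exact: cvg_harmonic.
  - exact: cvg_cst.
have Qge n : `|Q n w| = Q n w by rewrite ger0_norm// /Q !addr_ge0.
have := @log_path_eq R t u (r - q) sigma (S^~ w) (W^~ w) tu (fun v => @S_gt0 v w) (@S_cont w)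
  (fun j => (n_ j).+1) (fun j k => Jc (n_ j) k w) (fun j k => M (n_ j).+1 (m_ (n_ j)).+1 k w).
rewrite /= Stw; apply.
- by [].
- apply: (@cvg_dist_le _ _ (fun=> 0) (fun j => j.+1%:R^-1)); [|exact: cvg_harmonic|exact: cvg_cst].
  apply: nearW => j; rewrite subr0 ger0_norm ?invr_ge0// lef_pV2 ?posrE ?ltr0n//.
  by rewrite ler_nat ltnS; have [] := hn j.
- by move=> j k kn; rewrite -Stw; exact: Jw.
- apply: (small (fun n => \sum_(k < n.+1) M n.+1 (m_ n).+1 k w)) => n.
  by rewrite Qge /Q -!addrA addrCA lerDl !addr_ge0.
- apply: (small (fun n => \sum_(k < n.+1) M n.+1 (m_ n).+1 k w ^+ 2)) => n.
  by rewrite Qge /Q addrAC lerDr !addr_ge0.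
- have [[c c0 hc] _] := ratio_unif (ltW tu) (fun v => @S_gt0 v w) (@S_cont w).
  apply: (@cvg_dist_le _ _ (fun=> 0) (fun j => 2 / c * CC (n_ j) (m_ (n_ j)) w)); last exact: cvg_cst.
    apply: nearW => j; rewrite subr0 ger0_norm; last by apply: sumr_ge0.
    move: (n_ j) => n.
    pose dd k := `|Rsum n.+1 (m_ n).+1 k w - Jc n k w|.
    (* An increment of integrals involves the discrepancies at both ends of its cell, so each is
       counted at most twice; [c] bounds the path from below. Hence the factor 2 / c. *)
    apply: (@le_trans _ _ (\sum_(k < n.+1) c^-1 * (dd k.+1 + dd k))).
      apply: ler_sum => k _.
      have hk := hc _ (gin (ltn0Sn n) (ltnW (ltn_ord k))).
      have Sk := lt_le_trans c0 hk.
      rewrite /M /dW (_ : _ - _ - _ = ((Jc n k.+1 w - Rsum n.+1 (m_ n).+1 k.+1 w) +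
         (Rsum n.+1 (m_ n).+1 k w - Jc n k w)) / S (g n.+1 k) w); last by ring.
      rewrite normrM normfV (gtr0_norm Sk) mulrC ler_pM ?invr_ge0 ?(ltW Sk)//.
        by rewrite lef_pV2 ?posrE.
      by apply: le_trans (ler_normD _ _) _; rewrite distrC.
    rewrite -big_distrr/= big_split/= (_ : 2 / c * _ = c^-1 * (CC n (m_ n) w + CC n (m_ n) w)).
      rewrite ler_wpM2l ?invr_ge0 ?(ltW c0)// lerD//.
        by rewrite /CC [leRHS]big_ord_recl/= lerDr.
      by rewrite /CC [leRHS]big_ord_recr/= lerDl.
    by move: c^-1 (CC n (m_ n) w) => a b; ring.
  rewrite -(mulr0 (2 / c)); apply: cvgM; first exact: cvg_cst.
  apply: (small (fun n => CC n (m_ n) w)) => n.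
  by rewrite Qge /Q -!addrA lerDl !addr_ge0.
- apply: cvg_sub0; last exact: cvg_cst.
  apply: (small (fun n => \sum_(k < n.+1) (W (g n.+1 k.+1) w - W (g n.+1 k) w) ^+ 2 - (u - t))) => n.
  by rewrite Qge /Q lerDr !addr_ge0.
Unshelve. all: by end_near. Qed.

End price_identification.

(** * Mollification *)

Section smooth_functions.
Context {R : realType}.
Implicit Types (f g : R -> R).

Fixpoint smooth_upto (k : nat) f : Prop :=
  if k is k'.+1 then
    exists2 f' : R -> R, (forall x : R, is_derive x 1 f (f' x)) & smooth_upto k' f'
  else True.

Definition smooth f := forall k, smooth_upto k f.

Lemma smooth_uptoS k f : smooth_upto k.+1 f -> smooth_upto k f.
Proof. by elim: k f => // k ih f [f' df' /ih]; exists f'. Qed.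

Lemma smooth_uptoD k f g : smooth_upto k f -> smooth_upto k g ->
  smooth_upto k (fun x => f x + g x).
Proof.
elim: k f g => // k ih f g [f' df sf] [g' dg sg].
by exists (fun x => f' x + g' x); [move=> x; exact: is_derive_funD|exact: ih].
Qed.

Lemma smooth_uptoM k f g : smooth_upto k f -> smooth_upto k g ->
  smooth_upto k (fun x => f x * g x).
Proof.
elim: k f g => // k ih f g sf sg; case: (sf) (sg) => f' df sf' [g' dg sg'].
exists (fun x => f' x * g x + f x * g' x); first by move=> x; exact: is_derive_funM.
by apply: smooth_uptoD; apply: ih => //; exact: smooth_uptoS.
Qed.

Lemma smooth_upto_affine k f (a b : R) : smooth_upto k f ->
  smooth_upto k (fun x => f (a * x + b)).
Proof.
elim: k f => // k ih f [f' df sf].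
exists (fun x => a * f' (a * x + b)).
  move=> x; rewrite mulrC.
  have da : is_derive x (1 : R) (fun y => a * y + b) a.
    by apply: is_derive_eq; rewrite /GRing.scale/=; ring.
  exact: (@is_derive1_comp R f (fun y => a * y + b) x _ _ (df _) da).
apply: smooth_uptoM; last exact: ih.
elim: k {ih sf} a => // k ih a; exists (fun=> 0); last exact: ih.
by move=> x; exact: is_derive_cst.
Qed.

Lemma smooth_derive1n f : smooth f ->
  forall n x, is_derive x (1 : R) (derive1n n f) ((derive1n n.+1 f) x).
Proof.
move=> sf n; have H k : smooth_upto k (derive1n n f).
  elim: n k => [|n ih] k; first exact: sf.
  have [f' df] := ih k.+1; rewrite derive1nS.
  by have -> : ((derive1n n f))^`()%classic = f' by apply/funext => x; rewrite derive1E; have [_ ->] := df x.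
have [f' df _] := H 1%N => x.
by rewrite derive1nS derive1E; have [h _] := df x; split.
Qed.

End smooth_functions.

Section smooth_step.
Context {R : realType}.

(** The n-th derivative of exp(-1/x) is p(1/x) exp(-1/x) with p = [pseq n]: differentiating such a
    product multiplies by x^-2 and replaces p by p - p'. *)
Let pseq (n : nat) : {poly R} := iter n (fun p => 'X^2 * (p - p^`())) 1.

Let flat (p : {poly R}) (x : R) : R := if 0 < x then p.[x^-1] * expR (- x^-1) else 0.

Let poly_exp_bound (p : {poly R}) : exists C, forall y, 0 <= y -> `|p.[y]| * expR (- y) <= C.
Proof.
exists (\sum_(i < size p) `|p`_i| * (i`!%:R)) => y y0.
rewrite horner_coef; apply: (@le_trans _ _ (\sum_(i < size p) `|p`_i| * y ^+ i * expR (- y))).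
  rewrite -big_distrl/= ler_wpM2r ?expR_ge0//; apply: le_trans (ler_norm_sum _ _ _) _.
  by apply: ler_sum => i _; rewrite normrM normrX (ger0_norm y0).
apply: ler_sum => i _; rewrite -mulrA ler_wpM2l//.
rewrite expRN ler_pdivrMr ?expR_gt0// -ler_pdivrMl ?ltr0n ?fact_gt0// mulrC.
case: (i : nat) => [|k].
  by rewrite expr0 divr1 -expR0 ler_expR.
by apply: le_trans (expR_ge1Dxn k y0); rewrite lerDr.
Qed.

(** At 0 the difference quotient equals h times (X^2 p)(1/h) exp(-1/h), and the second factor is
    bounded because the exponential dominates every polynomial. *)
Let flat_derive (p : {poly R}) (x : R) : is_derive x (1 : R) (flat p) (flat ('X^2 * (p - p^`())) x).
Proof.
have [x0|x0|->] := ltgtP x 0.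
- rewrite /flat [X in is_derive _ _ _ X]ifN ?ltNge ?(ltW x0)//.
  apply: near_eq_is_derive (is_derive_cst (0 : R) x 1).
  by have := lt_nbhsl x0; apply: filterS => z z0; rewrite ifN// -leNgt ltW.
- rewrite /flat x0.
  have xn0 : x != 0 by rewrite gt_eqF.
  have dV : is_derive x (1 : R) (fun z : R => z^-1) (- x ^- 2).
    by apply: is_derive_eq; [apply: is_deriveV|rewrite /GRing.scale/= mulr1].
  have dP : is_derive x (1 : R) (fun z => p.[z^-1]) (p^`().[x^-1] * - x ^- 2).
    exact: (@is_derive1_comp R (horner p) (fun z => z^-1) x _ _ (is_derive_poly p x^-1) dV).
  have dE : is_derive x (1 : R) (fun z => expR (- z^-1)) (x ^- 2 * expR (- x^-1)).
    have dN : is_derive x (1 : R) (fun z : R => - z^-1) (x ^- 2).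
      by rewrite -[X in is_derive _ _ _ X]opprK; exact: is_deriveN.
    by rewrite mulrC; exact: (@is_derive_expR_comp R (fun z => - z^-1) x _ dN).
  apply: near_eq_is_derive (is_derive_eq (is_derive_funM dP dE) _).
    by have := lt_nbhsr x0; apply: filterS => z z0; rewrite z0.
  by rewrite hornerM hornerXn hornerD hornerN exprVn; move: (x ^- 2) => z; ring.
- have -> : flat ('X^2 * (p - p^`())) 0 = 0 by rewrite /flat ltxx.
  have [C hC] := poly_exp_bound ('X^2 * p).
  have C0 : 0 <= C by apply: le_trans (hC 0 (lexx _)); rewrite mulr_ge0// expR_ge0.
  have H : h^-1 *: (flat p (h *: 1 + 0) - flat p 0) @[h --> 0^'] --> (0 : R).
    apply/cvgrPdist_le => e e0; near=> h.
    rewrite sub0r normrN /flat ltxx subr0 addr0 /GRing.scale/= mulr1.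
    case: ifPn => h0; last by rewrite mulr0 normr0 ltW.
    have hV : 0 <= h^-1 by rewrite invr_ge0 ltW.
    have := hC _ hV; rewrite hornerM hornerXn.
    have -> : h^-1 * (p.[h^-1] * expR (- h^-1)) = h * (h^-1 ^+ 2 * p.[h^-1] * expR (- h^-1)).
      by field; rewrite gt_eqF.
    rewrite [in X in _ -> X]normrM (gtr0_norm h0) [in X in _ -> X]normrM (ger0_norm (expR_ge0 _)) => hh.
    apply: (@le_trans _ _ (h * (C + 1))).
      by rewrite ler_wpM2l ?(ltW h0)// (le_trans hh)// lerDl.
    rewrite -ler_pdivlMr ?ltr_wpDl//; apply/ltW.
    rewrite -[ltLHS]gtr0_norm//; near: h; apply: dnbhs0_lt.
    by rewrite divr_gt0// ltr_wpDl.
  split; first by apply/cvg_ex; exists 0.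
  exact: cvg_lim H.
Unshelve. all: by end_near. Qed.

Definition smooth_step (x : R) : R := if 0 < x then expR (- x^-1) else 0.

Lemma smooth_smooth_step : smooth smooth_step.
Proof.
have -> : smooth_step = flat (pseq 0).
  by apply/funext => x; rewrite /flat/= hornerC mul1r.
move=> k; elim: k (0%N) => // k ih n; exists (flat (pseq n.+1)); last exact: ih.
by move=> x; exact: flat_derive.
Qed.

Lemma smooth_step_ge0 x : 0 <= smooth_step x.
Proof. by rewrite /smooth_step; case: ifP => // _; exact: expR_ge0. Qed.

End smooth_step.

Section bump.
Context {R : realType}.
Local Notation mu := (@lebesgue_measure R).
Variable ep : R.
Hypothesis ep0 : 0 < ep.

Let b0 (x : R) := smooth_step (1 * x + - ep) * smooth_step (- 1 * x + 2 * ep).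

Let b0_ge0 x : 0 <= b0 x. Proof. by rewrite mulr_ge0// smooth_step_ge0. Qed.

Let b0_smooth : smooth b0.
Proof. by move=> k; apply: smooth_uptoM; apply: smooth_upto_affine; exact: smooth_smooth_step. Qed.

Let b0_cont : continuous b0.
Proof.
move=> x; have [b' db _] := b0_smooth 1%N; apply: differentiable_continuous.
by apply/derivable1_diffP; have [] := db x.
Qed.

Let b0_out x : ~ (ep <= x <= 2 * ep) -> b0 x = 0.
Proof.
move=> h; have [x1|x1] := ltP x ep.
  rewrite /b0 [X in X * _](_ : _ = 0) ?mul0r// /smooth_step ifN// -leNgt; lra.
have [x2|x2] := leP x (2 * ep); first by case: h; rewrite x1.
rewrite /b0 [X in _ * X](_ : _ = 0) ?mulr0// /smooth_step ifN// -leNgt; lra.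
Qed.

Let I : \bar R := (\int[mu]_(x in `[ep, (2 * ep)%R]) (b0 x)%:E)%E.

(** Stated for y -> b0(x - y), the form in which the bump enters the convolution; the reflection is
    carried out once, by substitution on the interval where the integrand lives. *)
Let I_reflect x : (\int[mu]_y (b0 (x - y))%:E = I)%E.
Proof.
have cR : continuous (fun y : R => x - y) by move=> y; apply: cvgB; [exact: cvg_cst|exact: cvg_id].
have dR (y : R) : is_derive y (1 : R) (fun y : R => x - y) (- 1).
  by have := is_deriveB (is_derive_cst x y (1 : R)) (is_derive_id y (1 : R)); rewrite sub0r.
have dR1 : (fun y : R => x - y)^`()%classic = cst (-1).
  by apply/funext => y; rewrite derive1E; have [_ ->] := dR y.
have e1 : x - (x - ep) = ep by ring.
have e2 : x - (x - 2 * ep) = 2 * ep by ring.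
have := @integration_by_substitution_decreasing R (fun y => x - y) b0 (x - 2 * ep) (x - ep).
rewrite /= e1 e2 -/I dR1 => ->.
- rewrite [LHS](_ : _ = \int[mu]_(y in `[(x - 2 * ep)%R, (x - ep)%R]) (b0 (x - y))%:E)%E.
    by apply: eq_integral => y _; rewrite /= /cst opprK !fctE/= mulr1.
  rewrite [RHS]integral_mkcond; apply: eq_integral => y _; rewrite patchE.
  case: ifPn => //; rewrite notin_setE /= in_itv/= => h; rewrite b0_out// => h'; apply: h; lra.
- by rewrite lerD2l lerN2 ler_peMl ?ler1n// ltW.
- by move=> y z _ _ yz; rewrite ltrD2l ltrN2.
- by move=> y _; exact: cvg_cst.
- by apply/cvg_ex; exists (-1); exact: cvg_cst.
- by apply/cvg_ex; exists (-1); exact: cvg_cst.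
- split => [y _||]; first by have [] := dR y.
  + by apply: cvg_at_right_filter; exact: cR.
  + by apply: cvg_at_left_filter; exact: cR.
- by apply: continuous_subspaceT; exact: b0_cont.
Qed.

Let I_fin : I \is a fin_num.
Proof.
apply: integrable_fin_num => //; apply: continuous_compact_integrable.
  exact: segment_compact.
by apply: continuous_subspaceT; exact: b0_cont.
Qed.

Let I_gt0 : 0 < fine I.
Proof.
(* On the middle half of [ep, 2 ep] both step functions have arguments at least ep / 4. *)
have [c c0 hc] : exists2 c : R, 0 < c & forall x : R, 5 / 4 * ep <= x <= 7 / 4 * ep -> c <= b0 x.
  exists (expR (- (ep / 4)^-1) ^+ 2); first by rewrite exprn_gt0// expR_gt0.
  have st (x : R) : ep / 4 <= x -> expR (- (ep / 4)^-1) <= smooth_step x.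
    move=> hx; have x0 : 0 < x by apply: lt_le_trans hx; rewrite divr_gt0.
    by rewrite /smooth_step x0 ler_expR lerN2 lef_pV2// posrE divr_gt0.
  move=> x hx; rewrite expr2 ler_pM ?expR_ge0//; apply: st; lra.
rewrite -lte_fin fineK//; apply: (@lt_le_trans _ _ (c * (ep / 2))%:E).
  by rewrite lte_fin mulr_gt0// divr_gt0.
have sub : `[5 / 4 * ep, 7 / 4 * ep] `<=` `[ep, 2 * ep]%classic.
  by move=> z; rewrite /= !in_itv/= => hz; lra.
apply: (@le_trans _ _ (\int[mu]_(x in `[(5 / 4 * ep)%R, (7 / 4 * ep)%R]) (b0 x)%:E)%E).
  have -> : ((c * (ep / 2))%:E = \int[mu]_(x in `[(5 / 4 * ep)%R, (7 / 4 * ep)%R]) (cst c%:E) x)%E.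
    rewrite integral_cst//= lebesgue_measure_itv/= lte_fin ifT; last by move: (ep0); lra.
    by rewrite -EFinB -EFinM; congr EFin; lra.
  apply: ge0_le_integral => //.
  - by move=> x _; rewrite lee_fin ltW.
  - apply/measurable_EFinP; apply: measurable_funTS; exact: continuous_measurable_fun.
apply: ge0_subset_integral => //.
- apply/measurable_EFinP; apply: measurable_funTS; exact: continuous_measurable_fun.
- by move=> x _; rewrite lee_fin.
Qed.

Lemma bump_exists : exists b : R -> R, [/\ smooth b, forall x, 0 <= b x,
  forall x, ~ (ep <= x <= 2 * ep) -> b x = 0 &
  forall x, (\int[mu]_y (b (x - y))%:E = 1)%E].
Proof.
exists (fun x => b0 x * (fine I)^-1); split.
- move=> k; apply: smooth_uptoM; first exact: b0_smooth.
  elim: k ((fine I)^-1) => // k ih a; exists (fun=> 0); last exact: ih.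
  by move=> x; exact: is_derive_cst.
- by move=> x; rewrite mulr_ge0// invr_ge0 ltW.
- by move=> x /b0_out ->; rewrite mul0r.
- move=> x; under eq_integral do rewrite EFinM.
  rewrite ge0_integralZr//; first by rewrite I_reflect -(fineK I_fin) -EFinM divff ?gt_eqF.
  + apply/measurable_EFinP; apply: (measurableT_comp (f := b0)).
      exact: continuous_measurable_fun.
    by apply: measurable_funB.
  + by move=> y _; rewrite lee_fin.
  + by rewrite lee_fin invr_ge0 ltW.
Qed.

End bump.

Section smooth_compact_support.
Context {R : realType}.
Variables (b : R -> R) (lo hi : R).
Hypotheses (b_smooth : smooth b) (b_out : forall x, ~ (lo <= x <= hi) -> b x = 0).

Lemma smooth_support n x : ~ (lo <= x <= hi) -> derive1n n b x = 0.
Proof.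
elim: n x => [|n ih] x hx; first exact: b_out.
have [_ <-] := smooth_derive1n b_smooth n x.
rewrite (near_eq_derive (g := cst 0)) ?derive_cst//.
have [x1|x1] := ltP x lo.
  have := lt_nbhsl x1; apply: filterS => z z0; apply: ih => /andP[z1 _].
  by have := lt_le_trans z0 z1; rewrite ltxx.
have [x2|x2] := leP x hi; first by case: hx; rewrite x1.
have := lt_nbhsr x2; apply: filterS => z z0; apply: ih => /andP[_ z1].
by have := lt_le_trans z0 z1; rewrite ltxx.
Qed.

Lemma smooth_continuous n : continuous (derive1n n b).
Proof.
move=> x; apply: differentiable_continuous; apply/derivable1_diffP.
by have [] := smooth_derive1n b_smooth n x.
Qed.

Lemma smooth_bounded n : lo <= hi -> exists2 M : R, 0 <= M & forall x, `|derive1n n b x| <= M.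
Proof.
move=> lohi; have hc : {within `[lo, hi], continuous (fun x => `|derive1n n b x|)}.
  by apply: continuous_subspaceT => x; apply: cvg_norm; exact: smooth_continuous.
have [c _ hM] := EVT_max lohi hc.
exists `|derive1n n b c| => // x.
have [hx|hx] := boolP (lo <= x <= hi); first by apply: hM; rewrite in_itv.
by rewrite smooth_support ?normr0//; apply/negP.
Qed.

End smooth_compact_support.

Section product_kernels.
Context {R : realType}.
Implicit Types (B C : R -> R) (z : R * R).

Let dx_prod_is B C (d : R) z : is_derive z.1 (1 : R) B d ->
  is_derive z ((1, 0) : R * R) (fun y : R * R => B y.1 * C y.2) (d * C z.2).
Proof.
move=> [cB <-].
have H : h^-1 *: (B (h *: (1, 0) + z).1 * C (h *: (1, 0) + z).2 - B z.1 * C z.2)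
    @[h --> 0^'] --> 'D_1 B z.1 * C z.2.
  have : (h^-1 *: (B (h *: 1 + z.1) - B z.1)) * C z.2 @[h --> 0^'] --> 'D_1 B z.1 * C z.2.
    by apply: cvgM; [exact: cB|exact: cvg_cst].
  apply: cvg_trans; apply: near_eq_cvg; apply: nearW => h.
  by rewrite /= /GRing.scale/= mulr0 add0r -mulrBl mulrA.
by split; [apply/cvg_ex; exists ('D_1 B z.1 * C z.2)|exact: cvg_lim H].
Qed.

Let dtau_prod_is B C (d : R) z : is_derive z.2 (1 : R) C d ->
  is_derive z ((0, 1) : R * R) (fun y : R * R => B y.1 * C y.2) (B z.1 * d).
Proof.
move=> [cC <-].
have H : h^-1 *: (B (h *: (0, 1) + z).1 * C (h *: (0, 1) + z).2 - B z.1 * C z.2)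
    @[h --> 0^'] --> B z.1 * 'D_1 C z.2.
  have : B z.1 * (h^-1 *: (C (h *: 1 + z.2) - C z.2)) @[h --> 0^'] --> B z.1 * 'D_1 C z.2.
    by apply: cvgM; [exact: cvg_cst|exact: cC].
  apply: cvg_trans; apply: near_eq_cvg; apply: nearW => h.
  by rewrite /= /GRing.scale/= mulr0 add0r -mulrBr mulrCA.
by split; [apply/cvg_ex; exists (B z.1 * 'D_1 C z.2)|exact: cvg_lim H].
Qed.

Variables (B C : R -> R).
Hypotheses (sB : smooth B) (sC : smooth C).

Definition prod_deriv (i j : nat) (z : R * R) : R := derive1n i B z.1 * derive1n j C z.2.

Lemma continuous_prod_deriv i j : continuous (prod_deriv i j).
Proof.
move=> z; apply: cvgM.
  by apply: (@cvg_comp _ _ _ fst (derive1n i B) _ (nbhs z.1)); [exact: cvg_fst|exact: smooth_continuous].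
by apply: (@cvg_comp _ _ _ snd (derive1n j C) _ (nbhs z.2)); [exact: cvg_snd|exact: smooth_continuous].
Qed.

Lemma dx_prod_deriv i j : dx (prod_deriv i j) = prod_deriv i.+1 j.
Proof.
apply/funext => z; rewrite /dx.
by have [_ ->] := dx_prod_is (derive1n j C) (smooth_derive1n sB i z.1).
Qed.

Lemma dtau_prod_deriv i j : dtau (prod_deriv i j) = prod_deriv i j.+1.
Proof.
apply/funext => z; rewrite /dtau.
by have [_ ->] := dtau_prod_is (derive1n i B) (smooth_derive1n sC j z.2).
Qed.

(** The products of derivatives of [B] and [C] are closed under both partial derivatives, so the
    induction on [k] treats all orders [i], [j] together. *)
Lemma Ck_prod_deriv k i j : Ck k (prod_deriv i j).
Proof.
elim: k i j => [|k ih] i j; split=> //; [exact: continuous_prod_deriv|exact: continuous_prod_deriv|].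
split => [z|z||].
- by have [] := dx_prod_is (derive1n j C) (smooth_derive1n sB i z.1).
- by have [] := dtau_prod_is (derive1n i B) (smooth_derive1n sC j z.2).
- by rewrite dx_prod_deriv.
- by rewrite dtau_prod_deriv.
Qed.

Lemma iter_dx_dtau_prod a b : iter a dx (iter b dtau (prod_deriv 0 0)) = prod_deriv a b.
Proof.
elim: a => [|a ih]; last by rewrite iterS ih dx_prod_deriv.
by elim: b => //= b ->; rewrite dtau_prod_deriv.
Qed.

Lemma test_function_prod (D : set (R * R)) (K : set (R * R)) : compact K -> K `<=` D ->
  (forall z, ~ K z -> B z.1 * C z.2 = 0) -> test_function D (prod_deriv 0 0).
Proof. by move=> cK KD K0; split=> [k|]; [exact: Ck_prod_deriv|exists K]. Qed.

End product_kernels.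

Section smooth_taylor.
Context {R : realType}.
Variables (b : R -> R) (M : R).
Hypotheses (sb : smooth b) (bM : forall i x, (i <= 3)%N -> `|derive1n i b x| <= M).
Local Notation D i := (derive1n i b).

Let dshift i (x y : R) : is_derive y (1 : R) (fun h : R => D i (x + h)) (D i.+1 (x + y)).
Proof.
have dx : is_derive y (1 : R) (fun h : R => x + h) 1.
  by have := is_deriveD (is_derive_cst x y (1 : R)) (is_derive_id y (1 : R)); rewrite add0r.
by have := @is_derive1_comp R (D i) (fun h : R => x + h) y _ _ (smooth_derive1n sb i _) dx; rewrite mulr1.
Qed.

Lemma smooth_taylor1 i (x h : R) : (i < 3)%N -> `|D i (x + h) - D i x| <= M * `|h|.
Proof.
move=> i3; rewrite -[X in _ - D i X]addr0.
apply: (@mvt_norm_le R (fun h => D i (x + h)) (fun h => D i.+1 (x + h))) => [y _|y _].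
  exact: dshift.
exact: bM.
Qed.

(** Each order follows from the previous one by the mean value bound; this costs the factorials in
    the constant, which do not matter. *)
Lemma smooth_taylor2 i (x h : R) : (i < 2)%N ->
  `|D i (x + h) - D i x - D i.+1 x * h| <= M * h ^+ 2.
Proof.
move=> i2; pose f y := D i (x + y) - D i.+1 x * y.
have -> : D i (x + h) - D i x - D i.+1 x * h = f h - f 0.
  by rewrite /f addr0 mulr0 subr0 addrAC.
have -> : M * h ^+ 2 = M * `|h| * `|h| by rewrite -mulrA -expr2 real_normK ?num_real.
apply: (@mvt_norm_le R f (fun y => D i.+1 (x + y) - D i.+1 x)) => [y _|y yh].
  have := is_deriveB (dshift i x y) (is_derive_funZ (D i.+1 x) (is_derive_id y (1 : R))).
  by rewrite mulr1.
apply: (le_trans (smooth_taylor1 x y _)) => //.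
by rewrite ler_wpM2l// (le_trans (normr_ge0 _) (bM x (leq0n 3))).
Qed.

Lemma smooth_taylor3 (x h : R) :
  `|D 0 (x + h) - D 0 x - D 1 x * h - D 2 x * (h ^+ 2 / 2)| <= M * `|h| ^+ 3.
Proof.
pose f y := D 0 (x + y) - D 1 x * y - D 2 x / 2 * y ^+ 2.
have -> : D 0 (x + h) - D 0 x - D 1 x * h - D 2 x * (h ^+ 2 / 2) = f h - f 0.
  by rewrite /f addr0; move: (D 0 (x + h)) (D 0 x) (D 1 x) (D 2 x) => a0 a1 a2 a3; field.
have -> : M * `|h| ^+ 3 = M * `|h| ^+ 2 * `|h| by ring.
apply: (@mvt_norm_le R f (fun y => D 1 (x + y) - D 1 x - D 2 x * y)) => [y _|y yh].
  have h1 := is_deriveB (dshift 0 x y) (is_derive_funZ (D 1 x) (is_derive_id y (1 : R))).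
  have h2 := is_derive_funZ (D 2 x / 2) (is_derive_funX 2 y).
  have := is_deriveB h1 h2; rewrite mulr1 [X in is_derive _ _ _ (_ - X)](_ : _ = D 2 x * y)//.
  by rewrite expr1; move: (D 2 x) => a; field.
have M0 : 0 <= M by exact: le_trans (normr_ge0 _) (bM x (leq0n 3)).
apply: (le_trans (smooth_taylor2 x y _)) => //.
by rewrite ler_wpM2l// -[y ^+ 2]real_normK ?num_real// ler_pXn2r// nnegrE.
Qed.

End smooth_taylor.

Section mollification.
Context {R : realType}.
Local Notation mu2 := ((@lebesgue_measure R) \x (@lebesgue_measure R))%E.
Variables (Q : set (measurableTypeR R * measurableTypeR R)) (Y : R * R -> R) (A : R).
Hypotheses (mQ : measurable Q) (Q_fin : (mu2 Q < +oo)%E).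
Hypotheses (mY : measurable_fun Q Y) (YA : forall z, Q z -> `|Y z| <= A) (A0 : 0 <= A).

Definition bounded_kernel (G : R * R -> R) :=
  measurable_fun [set: measurableTypeR R * measurableTypeR R] G /\ exists K : R, forall z, `|G z| <= K.

Lemma bounded_kernelD G H : bounded_kernel G -> bounded_kernel H ->
  bounded_kernel (fun z => G z + H z).
Proof.
move=> [mG [K hK]] [mH [L hL]]; split; first exact: measurable_funD.
by exists (K + L) => z; apply: le_trans (ler_normD _ _) _; rewrite lerD.
Qed.

Lemma bounded_kernelZ (a : R) G : bounded_kernel G -> bounded_kernel (fun z => a * G z).
Proof.
move=> [mG [K hK]]; split; first by apply: measurable_funM.
by exists (`|a| * K) => z; rewrite normrM ler_wpM2l.
Qed.

Lemma bounded_kernelB G H : bounded_kernel G -> bounded_kernel H ->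
  bounded_kernel (fun z => G z - H z).
Proof.
move=> bG bH; have := bounded_kernelD bG (bounded_kernelZ (-1) bH).
by under [X in bounded_kernel X -> _]funext do rewrite mulN1r.
Qed.

Definition pairing (G : R * R -> R) : R := \int[mu2]_(z in Q) (Y z * G z).

Lemma integrable_pairing G : bounded_kernel G -> mu2.-integrable Q (EFin \o (fun z => Y z * G z)).
Proof.
move=> [mG [K hK]]; apply: (@integrable_bounded _ _ _ _ _ _ (A * K)) => //.
- by apply: measurable_funM => //; exact: measurable_funTS.
- by move=> z Qz; rewrite normrM ler_pM// YA.
Qed.

Lemma pairingB G H : bounded_kernel G -> bounded_kernel H ->
  pairing (fun z => G z - H z) = pairing G - pairing H.
Proof.
move=> bG bH; rewrite /pairing -RintegralB//; [|exact: integrable_pairing..].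
by apply: eq_Rintegral => z _; rewrite mulrBr.
Qed.

Lemma pairingZ (a : R) G : bounded_kernel G -> pairing (fun z => a * G z) = a * pairing G.
Proof.
move=> bG; rewrite /pairing -RintegralZl//; last exact: integrable_pairing.
by apply: eq_Rintegral => z _; rewrite mulrCA.
Qed.

(** Every estimate for the mollified function is a sup bound on a combination of kernels,
    transferred by this inequality. Differentiation under the integral sign is thereby avoided. *)
Lemma pairing_le G (K : R) : bounded_kernel G -> (forall z, `|G z| <= K) ->
  `|pairing G| <= A * fine (mu2 Q) * K.
Proof.
move=> bG GK; have iG := integrable_pairing bG.
apply: le_trans (le_normr_Rintegral mQ iG) _.
have -> : A * fine (mu2 Q) * K = \int[mu2]_(z in Q) (A * K).
  by rewrite Rintegral_cst//; ring.
apply: le_Rintegral => //.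
- have := integrable_abse iG; exact.
- by apply: (@integrable_bounded _ _ _ _ _ _ `|A * K|) => //; exact: measurable_cst.
- by move=> z Qz; rewrite normrM ler_pM// YA.
Qed.

End mollification.

Lemma Rintegral_support {d : measure_display} {T : measurableType d} {R : realType}
    (mu : {measure set T -> \bar R}) (K D : set T) (g : T -> R) :
  K `<=` D -> (forall z, ~ K z -> g z = 0) ->
  \int[mu]_(z in D) g z = \int[mu]_(z in K) g z.
Proof.
move=> KD g0; rewrite Rintegral_mkcond [RHS]Rintegral_mkcond; apply: eq_Rintegral => z _.
rewrite !patchE; case: ifPn => zD; case: ifPn => zK //.
  by apply: g0 => /mem_set; rewrite (negbTE zK).
by move: zD; rewrite (mem_set (KD z (set_mem zK))).
Qed.

Section mollified_function.
Context {R : realType}.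
Local Notation mu := (@lebesgue_measure R).
Local Notation mu2 := ((@lebesgue_measure R) \x (@lebesgue_measure R))%E.
Variables (Q : set (measurableTypeR R * measurableTypeR R)) (Y : R * R -> R) (A : R).
Hypotheses (mQ : measurable Q) (Q_fin : (mu2 Q < +oo)%E).
Hypotheses (mY : measurable_fun Q Y) (YA : forall z, Q z -> `|Y z| <= A) (A0 : 0 <= A).
Variables (b : R -> R) (ep M : R).
Hypotheses (b_smooth : smooth b) (b_ge0 : forall x, 0 <= b x).
Hypotheses (b_out : forall x, ~ (ep <= x <= 2 * ep) -> b x = 0).
Hypothesis b_int : forall x, (\int[mu]_y (b (x - y))%:E = 1)%E.
Hypothesis bM : forall i x, (i <= 3)%N -> `|derive1n i b x| <= M.

Definition bump_kernel (i j : nat) (x tau : R) (z : R * R) : R :=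
  derive1n i b (x - z.1) * derive1n j b (tau - z.2).

(** The derivatives sit on the kernel by definition; that they behave as derivatives of [moll 0 0]
    is expressed by the Taylor estimates below. *)
Definition moll (i j : nat) (x tau : R) : R := pairing Q Y (bump_kernel i j x tau).

Definition mollC := A * fine (mu2 Q) * (M * M).

Let M0 : 0 <= M. Proof. exact: le_trans (normr_ge0 _) (bM 0 (leq0n 3)). Qed.

Lemma measurable_bump_kernel i j x tau :
  measurable_fun [set: measurableTypeR R * measurableTypeR R] (bump_kernel i j x tau).
Proof.
apply: measurable_funM.
  apply: (measurableT_comp (f := derive1n i b)); last exact: measurable_funB.
  exact: (continuous_measurable_fun (@smooth_continuous _ _ b_smooth _)).
apply: (measurableT_comp (f := derive1n j b)); last exact: measurable_funB.
exact: (continuous_measurable_fun (@smooth_continuous _ _ b_smooth _)).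
Qed.

Lemma bounded_kernel_kernel i j x tau : (i <= 3)%N -> (j <= 3)%N -> bounded_kernel (bump_kernel i j x tau).
Proof.
move=> i3 j3; split; first exact: measurable_bump_kernel.
by exists (M * M) => z; rewrite normrM ler_pM// bM.
Qed.
Local Notation bk := bounded_kernel_kernel.

Let pB G H : bounded_kernel G -> bounded_kernel H ->
  pairing Q Y (fun z => G z - H z) = pairing Q Y G - pairing Q Y H.
Proof. exact: (pairingB mQ Q_fin mY YA). Qed.

Let pZ (a : R) G : bounded_kernel G -> pairing Q Y (fun z => a * G z) = a * pairing Q Y G.
Proof. exact: (pairingZ mQ Q_fin mY YA). Qed.

Let moll_le G (K : R) : bounded_kernel G -> (forall z, `|G z| <= K * M) ->
  `|pairing Q Y G| <= A * fine (mu2 Q) * (K * M).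
Proof. exact: pairing_le. Qed.

Lemma moll_bound i j x tau : (i <= 3)%N -> (j <= 3)%N -> `|moll i j x tau| <= mollC.
Proof.
move=> i3 j3; apply: moll_le; first exact: bk.
by move=> z; rewrite normrM ler_pM// bM.
Qed.

Lemma moll_lip_x i j x tau h : (i < 3)%N -> (j <= 3)%N ->
  `|moll i j (x + h) tau - moll i j x tau| <= mollC * `|h|.
Proof.
move=> i3 j3; have i3' := ltnW i3.
rewrite /moll -pB//; [|exact: bk..].
have -> : mollC * `|h| = A * fine (mu2 Q) * (M * `|h| * M) by rewrite /mollC; ring.
apply: moll_le => [|z]; first by apply: bounded_kernelB; exact: bk.
rewrite /bump_kernel -mulrBl normrM ler_pM ?bM// -[x + h - z.1]addrAC.
exact: smooth_taylor1.
Qed.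

Lemma moll_lip_t i j x tau h : (i <= 3)%N -> (j < 3)%N ->
  `|moll i j x (tau + h) - moll i j x tau| <= mollC * `|h|.
Proof.
move=> i3 j3; have j3' := ltnW j3.
rewrite /moll -pB//; [|exact: bk..].
have -> : mollC * `|h| = A * fine (mu2 Q) * (M * (M * `|h|)) by rewrite /mollC; ring.
apply: pairing_le => // [|z]; first by apply: bounded_kernelB; exact: bk.
rewrite /bump_kernel -mulrBr normrM ler_pM ?bM// -[tau + h - z.2]addrAC.
exact: smooth_taylor1.
Qed.

Lemma moll_taylor_t x tau h :
  `|moll 0 0 x (tau + h) - moll 0 0 x tau - moll 0 1 x tau * h| <= mollC * h ^+ 2.
Proof.
have -> : moll 0 1 x tau * h = pairing Q Y (fun z => h * bump_kernel 0 1 x tau z).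
  by rewrite pZ; [exact: mulrC|exact: bk].
rewrite /moll.
rewrite -pB//; [|exact: bk..].
rewrite -pB//; [|apply: bounded_kernelB; exact: bk|apply: bounded_kernelZ; exact: bk].
have -> : mollC * h ^+ 2 = A * fine (mu2 Q) * (M * (M * h ^+ 2)) by rewrite /mollC; ring.
apply: pairing_le => // [|z].
  by apply: bounded_kernelB; [apply: bounded_kernelB|apply: bounded_kernelZ]; exact: bk.
have -> : bump_kernel 0 0 x (tau + h) z - bump_kernel 0 0 x tau z - h * bump_kernel 0 1 x tau z =
  derive1n 0 b (x - z.1) * (derive1n 0 b (tau - z.2 + h) - derive1n 0 b (tau - z.2) -
    derive1n 1 b (tau - z.2) * h).
  by rewrite /bump_kernel [tau + h - _]addrAC; ring.
by rewrite normrM ler_pM ?bM//; exact: smooth_taylor2.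
Qed.

Lemma moll_taylor_x x tau h :
  `|moll 0 0 (x + h) tau - moll 0 0 x tau - moll 1 0 x tau * h - moll 2 0 x tau * (h ^+ 2 / 2)|
  <= mollC * `|h| ^+ 3.
Proof.
pose G z := bump_kernel 0 0 (x + h) tau z - bump_kernel 0 0 x tau z - h * bump_kernel 1 0 x tau z -
  h ^+ 2 / 2 * bump_kernel 2 0 x tau z.
have b1 : bounded_kernel (fun z => bump_kernel 0 0 (x + h) tau z - bump_kernel 0 0 x tau z).
  by apply: bounded_kernelB; exact: bk.
have b2 : bounded_kernel (fun z => h * bump_kernel 1 0 x tau z) by apply: bounded_kernelZ; exact: bk.
have b3 := bounded_kernelB b1 b2.
have b4 : bounded_kernel (fun z => h ^+ 2 / 2 * bump_kernel 2 0 x tau z).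
  by apply: bounded_kernelZ; exact: bk.
have bG : bounded_kernel G by exact: bounded_kernelB.
have GE : pairing Q Y G = moll 0 0 (x + h) tau - moll 0 0 x tau - h * moll 1 0 x tau -
    h ^+ 2 / 2 * moll 2 0 x tau.
  by rewrite /G pB// pB// pB ?pZ//; exact: bk.
have : `|pairing Q Y G| <= A * fine (mu2 Q) * (M * `|h| ^+ 3 * M).
  apply: pairing_le => // z.
  have -> : G z = (derive1n 0 b (x - z.1 + h) - derive1n 0 b (x - z.1) -
     derive1n 1 b (x - z.1) * h -
     derive1n 2 b (x - z.1) * (h ^+ 2 / 2)) * derive1n 0 b (tau - z.2).
    by rewrite /G /bump_kernel [x + h - _]addrAC; ring.
  by rewrite normrM ler_pM ?bM//; exact: smooth_taylor3.
rewrite GE /mollC; move: (moll 0 0 (x + h) tau) (moll 0 0 x tau) (moll 1 0 x tau) (moll 2 0 x tau).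
move=> m0 m1 m2 m3; rewrite (mulrC h) (mulrC _ m3) => H.
by rewrite -mulrA [M * M * _]mulrAC.
Qed.

(* The bump is supported in [ep, 2 ep], so the box lies strictly in the past of
   [tau] and stays inside the open time interval even at [tau = T]. *)
Definition box (x tau : R) : set (measurableTypeR R * measurableTypeR R) :=
  `[x - 2 * ep, x - ep] `*` `[tau - 2 * ep, tau - ep].

Lemma measurable_box x tau : measurable (box x tau).
Proof. by apply: measurableX; exact: measurable_itv. Qed.

Lemma kernel_out i j x tau z : ~ box x tau z -> bump_kernel i j x tau z = 0.
Proof.
move=> h; rewrite /bump_kernel; have [h1|h1] := boolP (ep <= x - z.1 <= 2 * ep); last first.
  by rewrite (smooth_support b_smooth b_out) ?mul0r//; exact/negP.
have [h2|h2] := boolP (ep <= tau - z.2 <= 2 * ep); last first.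
  by rewrite [X in _ * X](smooth_support b_smooth b_out) ?mulr0//; exact/negP.
by case: h; split; rewrite /= in_itv/=; lra.
Qed.

Let kernel_ge0 x tau z : 0 <= bump_kernel 0 0 x tau z. Proof. by rewrite mulr_ge0// b_ge0. Qed.

(** Outside the box the kernel vanishes, so the integral extends to the plane, where Tonelli splits
    it into two unit masses. *)
Let kernel_int x tau : box x tau `<=` Q -> \int[mu2]_(z in Q) bump_kernel 0 0 x tau z = 1.
Proof.
move=> bQ; rewrite (Rintegral_support _ bQ); last exact: kernel_out.
rewrite -(Rintegral_support _ (@subsetT _ (box x tau))); last exact: kernel_out.
have inner (y : R) : (\int[mu]_s (bump_kernel 0 0 x tau (y, s))%:E = (b (x - y))%:E)%E.
  transitivity (\int[mu]_s ((b (x - y))%:E * (b (tau - s))%:E))%E.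
    by apply: eq_integral => s _; rewrite -EFinM.
  rewrite ge0_integralZl//; first by rewrite b_int mule1.
  - apply/measurable_EFinP; apply: (measurableT_comp (f := b)); last exact: measurable_funB.
    exact: (continuous_measurable_fun (@smooth_continuous _ _ b_smooth 0)).
  - by move=> s _; rewrite lee_fin.
  - by rewrite lee_fin.
rewrite /Rintegral fubini_tonelli1/=; last 2 first.
- by apply/measurable_EFinP; exact: measurable_bump_kernel.
- by move=> z; rewrite lee_fin.
transitivity (fine (\int[mu]_y (b (x - y))%:E)%E); last by rewrite b_int.
by congr fine; apply: eq_integral => y _; exact: inner.
Qed.

Lemma moll_approx x tau y0 eta : box x tau `<=` Q ->
  (forall z, box x tau z -> `|Y z - y0| <= eta) -> `|moll 0 0 x tau - y0| <= eta.
Proof.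
move=> bQ hY; have bk0 := bk x tau (leq0n 3) (leq0n 3).
have ik (c : R) : mu2.-integrable Q (EFin \o (fun z => c * bump_kernel 0 0 x tau z)).
  apply: (integrable_pairing mQ Q_fin (measurable_cst _) (A := `|c|)) => //.
have ik1 : mu2.-integrable Q (EFin \o bump_kernel 0 0 x tau).
  by have := ik 1; apply: eq_integrable => // z _; rewrite /= mul1r.
have iYk := integrable_pairing mQ Q_fin mY YA bk0.
have cE (c : R) : \int[mu2]_(z in Q) (c * bump_kernel 0 0 x tau z) = c.
  by rewrite RintegralZl// kernel_int// mulr1.
rewrite -[X in _ - X]cE /moll /pairing -RintegralB// -[leRHS]cE.
have iD : mu2.-integrable Q (EFin \o (fun z => Y z * bump_kernel 0 0 x tau z - y0 * bump_kernel 0 0 x tau z)).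
  by have := integrableB mQ iYk (ik y0); apply: eq_integrable.
apply: le_trans (le_normr_Rintegral mQ iD) _.
apply: le_Rintegral => //; first by have := integrable_abse iD; exact.
move=> z Qz; rewrite -mulrBl normrM [X in _ * X]ger0_norm//.
have [hz|hz] := pselect (box x tau z); first by rewrite ler_wpM2r// hY.
by rewrite kernel_out// !mulr0.
Qed.

End mollified_function.

Section mollified_equation.
Context {R : realType}.
Local Notation mu2 := ((@lebesgue_measure R) \x (@lebesgue_measure R))%E.
Variables (Q : set (measurableTypeR R * measurableTypeR R)) (Y : R * R -> R) (A : R).
Hypotheses (mQ : measurable Q) (Q_fin : (mu2 Q < +oo)%E).
Hypotheses (mY : measurable_fun Q Y) (YA : forall z, Q z -> `|Y z| <= A).
Variables (b : R -> R) (ep : R).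
Hypotheses (b_smooth : smooth b) (b_ge0 : forall x, 0 <= b x).
Hypotheses (b_out : forall x, ~ (ep <= x <= 2 * ep) -> b x = 0) (ep0 : 0 <= ep).
Variables (D : set (R * R)) (Yx Yxx Yt : R * R -> R) (sigma r q x tau : R).
Hypotheses (wx : weak_derivative D 1 0 Y Yx) (wxx : weak_derivative D 2 0 Y Yxx).
Hypothesis (wt : weak_derivative D 0 1 Y Yt).
Local Notation K := (box ep x tau).
Local Notation ker := (bump_kernel b).
Local Notation moll := (moll Q Y b).
Hypotheses (KQ : K `<=` Q) (KD : K `<=` D).

Let refl_smooth (c : R) : smooth (fun y => b (-1 * y + c)).
Proof. by move=> k; apply: smooth_upto_affine; exact: b_smooth. Qed.

Let refl_deriv (c : R) i y :
  derive1n i (fun y => b (-1 * y + c)) y = (-1) ^+ i * derive1n i b (c - y).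
Proof.
elim: i y => [|i ih] y; first by rewrite /= expr0 mul1r mulN1r addrC.
have [_ <-] := smooth_derive1n (refl_smooth c) i y.
rewrite (_ : derive1n i _ = fun y => (-1) ^+ i * derive1n i b (c - y)); last exact/funext.
have dR : is_derive y (1 : R) (fun y : R => c - y) (-1).
  by have := is_deriveB (is_derive_cst c y (1 : R)) (is_derive_id y (1 : R)); rewrite sub0r.
have := is_derive_funZ ((-1) ^+ i) (@is_derive1_comp R (derive1n i b) (fun y => c - y) y _ _
  (smooth_derive1n b_smooth i (c - y)) dR).
by case=> _ ->; rewrite exprS; ring.
Qed.

Let B y := b (-1 * y + x).
Let C s := b (-1 * s + tau).

Let prod_kernel i j z : prod_deriv B C i j z = (-1) ^+ (i + j) * ker i j x tau z.
Proof. by rewrite /prod_deriv !refl_deriv exprD /bump_kernel; ring. Qed.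

Let K_compact : compact (K : set (R * R)).
Proof. by apply: compact_setX; exact: segment_compact. Qed.

Let test : test_function D (prod_deriv B C 0 0).
Proof.
apply: (test_function_prod (refl_smooth x) (refl_smooth tau) K_compact KD) => z Kz.
have := prod_kernel 0 0 z; rewrite (kernel_out b_smooth b_out) ?mulr0//.
Qed.

Let mK : measurable K. Proof. exact: measurable_box. Qed.

Let iker (h : R * R -> R) i j : mu2.-integrable K (EFin \o h) ->
  mu2.-integrable K (EFin \o (fun z => h z * ker i j x tau z)).
Proof.
move=> ih; have lohi : ep <= 2 * ep by rewrite ler_peMl// ler1n.
have [Mi _ hMi] := smooth_bounded b_smooth b_out i lohi.
have [Mj _ hMj] := smooth_bounded b_smooth b_out j lohi.
have mker : measurable_fun K (ker i j x tau).
  by apply: measurable_funTS; exact: measurable_bump_kernel.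
have := integrableMl mK ih mker; apply.
exists (Mi * Mj); split; first exact: num_real.
move=> c Mc z _ /=; apply: le_trans (ltW Mc); rewrite normrM ler_pM//.
Qed.

Let supp (h : R * R -> R) i j : mu2.-integrable K (EFin \o h) ->
  \int[mu2]_(z in D) (h z * prod_deriv B C i j z) =
  (-1) ^+ (i + j) * \int[mu2]_(z in K) (h z * ker i j x tau z).
Proof.
move=> ih; rewrite (Rintegral_support _ KD); last first.
  by move=> z Kz; rewrite prod_kernel (kernel_out b_smooth b_out) ?mulr0.
rewrite -RintegralZl//; last exact: iker.
by apply: eq_Rintegral => z _; rewrite prod_kernel mulrCA.
Qed.

Let iY : mu2.-integrable K (EFin \o Y).
Proof.
apply: (@integrable_bounded _ _ _ _ _ _ A) => //.
- by apply: le_lt_trans Q_fin; apply: le_measure => //; rewrite inE.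
- exact: measurable_funS mY.
- by move=> z /KQ /YA.
Qed.

(** As a function of the integration variable the kernel is a reflected bump, and each derivative of
    it brings a sign. These signs cancel the one in the definition of a weak derivative. *)
Let weakE i j g : weak_derivative D i j Y g -> mu2.-integrable K (EFin \o g) /\
  moll i j x tau = \int[mu2]_(z in K) (g z * ker 0 0 x tau z).
Proof.
move=> [[_ lg] /(_ _ test)]; rewrite iter_dx_dtau_prod; [|exact: refl_smooth..] => E.
have ig := lg K KD K_compact; split=> //.
rewrite /moll /pairing (Rintegral_support _ KQ); last first.
  by move=> z Kz; rewrite (kernel_out b_smooth b_out) ?mulr0.
have s0 : (-1) ^+ (i + j) != 0 :> R by rewrite signr_eq0.
by move: E; rewrite (supp i j iY) (supp 0 0 ig) mul1r => /(mulfI s0).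
Qed.

Local Notation defect z := (Yt z - Lop sigma r q (Y z) (Yx z) (Yxx z)).

Let igen : mu2.-integrable K (EFin \o (fun z => defect z * ker 0 0 x tau z)) /\
  sigma ^+ 2 / 2 * moll 2 0 x tau + (r - q - sigma ^+ 2 / 2) * moll 1 0 x tau
    - moll 0 1 x tau - r * moll 0 0 x tau =
  - \int[mu2]_(z in K) (defect z * ker 0 0 x tau z).
Proof.
have [i1 ->] := weakE wx; have [i2 ->] := weakE wxx; have [i3 ->] := weakE wt.
have -> : moll 0 0 x tau = \int[mu2]_(z in K) (Y z * ker 0 0 x tau z).
  by rewrite /moll /pairing (Rintegral_support _ KQ)// => z Kz; rewrite (kernel_out b_smooth b_out) ?mulr0.
have j0 := iker 0 0 iY; have j1 := iker 0 0 i1; have j2 := iker 0 0 i2; have j3 := iker 0 0 i3.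
have jZ (a : R) h : mu2.-integrable K (EFin \o h) -> mu2.-integrable K (EFin \o (fun z => a * h z)).
  by move=> ih; have := integrableZl mK a ih; apply: eq_integrable.
have jD h h' : mu2.-integrable K (EFin \o h) -> mu2.-integrable K (EFin \o h') ->
    mu2.-integrable K (EFin \o (fun z => h z + h' z)).
  by move=> ih ih'; have := integrableD mK ih ih'; apply: eq_integrable.
have jB h h' : mu2.-integrable K (EFin \o h) -> mu2.-integrable K (EFin \o h') ->
    mu2.-integrable K (EFin \o (fun z => h z - h' z)).
  by move=> ih ih'; have := integrableB mK ih ih'; apply: eq_integrable.
pose c2 := sigma ^+ 2 / 2; pose c1 := r - q - sigma ^+ 2 / 2.
have l2 := jZ c2 _ j2; have l1 := jZ c1 _ j1; have l0 := jZ r _ j0.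
have l21 := jD _ _ l2 l1; have l213 := jB _ _ l21 j3; have l := jB _ _ l213 l0.
have E z : c2 * (Yxx z * ker 0 0 x tau z) + c1 * (Yx z * ker 0 0 x tau z) -
   Yt z * ker 0 0 x tau z - r * (Y z * ker 0 0 x tau z) = -1 * (defect z * ker 0 0 x tau z).
  by rewrite /Lop /c2 /c1; ring.
have jdef : mu2.-integrable K (EFin \o (fun z => defect z * ker 0 0 x tau z)).
  have := jZ (-1) _ l; apply: eq_integrable => // z _.
  by rewrite /= E mulrA mulrNN mulr1 mul1r.
split=> //; rewrite -/c2 -/c1 -!RintegralZl// -RintegralD// -RintegralB// -RintegralB//.
rewrite -mulN1r -RintegralZl//.
by apply: eq_Rintegral => z _; rewrite E.
Qed.

Lemma moll_supersolution :
  {ae mu2, forall z, K z -> 0 <= defect z} ->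
  sigma ^+ 2 / 2 * moll 2 0 x tau + (r - q - sigma ^+ 2 / 2) * moll 1 0 x tau
    - moll 0 1 x tau - r * moll 0 0 x tau <= 0.
Proof.
move=> h; have [ig ->] := igen; rewrite oppr_le0.
(* The integrand is nonnegative only almost everywhere; its absolute value has the same integral. *)
rewrite (_ : \int[mu2]_(z in K) _ = \int[mu2]_(z in K) `|defect z * ker 0 0 x tau z|).
  by apply: Rintegral_ge0.
congr fine; have mg := measurable_int _ ig; apply: ae_eq_integral => //.
  by have := measurable_int _ (integrable_abse ig).
apply: filterS h => z hz Kz /=; congr EFin; rewrite ger0_norm// mulr_ge0 ?hz// mulr_ge0//; exact: b_ge0.
Qed.

Lemma moll_solution :
  {ae mu2, forall z, K z -> defect z = 0} ->
  sigma ^+ 2 / 2 * moll 2 0 x tau + (r - q - sigma ^+ 2 / 2) * moll 1 0 x tau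
    - moll 0 1 x tau - r * moll 0 0 x tau = 0.
Proof.
move=> h; have [ig ->] := igen; apply/eqP; rewrite oppr_eq0; apply/eqP.
rewrite /Rintegral (ae_eq_integral (cst 0%E))//; first by rewrite integral0.
- exact: measurable_int _ ig.
- by apply: filterS h => z hz Kz /=; rewrite hz// mul0r.
Qed.

End mollified_equation.

(** * Dynkin's inequality *)

(** Odd powers of [h] are traded for even ones, whose means are known. The inequalities come from w
    (w - h)^2 >= 0 and (h^2 / w) (w - h)^2 >= 0, and from w <= 1. *)
Lemma young_cubic {R : realType} (w h : R) : 0 < w -> w <= 1 -> 0 <= h ->
  let S := w ^+ 3 + w * h ^+ 2 + h ^+ 4 / w in
  [/\ 0 <= S, w ^+ 4 <= S, w ^+ 2 * h <= S / 2, h ^+ 3 <= S / 2 & w ^+ 2 * (h ^+ 2 / 2) <= S / 2].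
Proof.
move=> w0 w1 h0 /=.
have s3 : 0 <= w ^+ 3 by rewrite exprn_ge0// ltW.
have s2 : 0 <= w * h ^+ 2 by rewrite mulr_ge0 ?sqr_ge0// ltW.
have s4 : 0 <= h ^+ 4 / w by rewrite divr_ge0 ?exprn_ge0// ltW.
have b1 : w ^+ 4 <= w ^+ 3 by rewrite (exprS w 3) ler_piMl.
have b2 : 0 <= w ^+ 3 - 2 * (w ^+ 2 * h) + w * h ^+ 2.
  have -> : w ^+ 3 - 2 * (w ^+ 2 * h) + w * h ^+ 2 = w * (w - h) ^+ 2 by ring.
  by rewrite mulr_ge0 ?sqr_ge0// ltW.
have b3 : 0 <= w * h ^+ 2 - 2 * h ^+ 3 + h ^+ 4 / w.
  have -> : w * h ^+ 2 - 2 * h ^+ 3 + h ^+ 4 / w = h ^+ 2 / w * (w - h) ^+ 2.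
    by field; rewrite gt_eqF.
  by rewrite mulr_ge0 ?sqr_ge0// divr_ge0 ?sqr_ge0// ltW.
have b4 : w ^+ 2 * h ^+ 2 <= w * h ^+ 2 by rewrite ler_wpM2r ?sqr_ge0// expr2 ler_piMl// ltW.
rewrite mulrA; move: (w ^+ 3) (w * h ^+ 2) (h ^+ 4 / w) (w ^+ 4) (w ^+ 2 * h) (h ^+ 3) (w ^+ 2 * h ^+ 2) s3 s2 s4 b1 b2 b3 b4.
by move=> {w h w0 w1 h0} *; split; lra.
Qed.

(* [w] is the square root of the time step and [H] the increment of the log-price;
   the bound has mean of order [w ^ 3], as [H ^ 4] has mean of order [w ^ 4]. *)
Lemma dynkin_remainder {R : realType} (A r w rho a g0 g1 d01 d01' d10 d20 H : R) :
  0 <= A -> 0 <= r -> 0 < w -> w <= 1 ->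
  0 <= rho -> rho <= 1 -> `|rho - 1| <= r * w ^+ 2 -> `|rho - 1 + r * w ^+ 2| <= r ^+ 2 * w ^+ 4 ->
  `|a| <= A -> `|d01| <= A -> `|d10| <= A -> `|d20| <= A ->
  `|g1 - g0 + d01' * w ^+ 2| <= A * w ^+ 4 -> `|d01' - d01| <= A * `|H| ->
  `|g0 - a - d10 * H - d20 * (H ^+ 2 / 2)| <= A * `|H| ^+ 3 ->
  `|rho * g1 - a - (w ^+ 2 * (- d01 - r * a) + d10 * H + d20 * (H ^+ 2 / 2))| <=
  A * (2 + r) ^+ 2 * (w ^+ 3 + w * H ^+ 2 + H ^+ 4 / w).
Proof.
move=> A0 r0 w0 w1 rho0 rho1 hr hr2 ha h01 h10 h20 e1 e2 e3.
have w2 : 0 <= w ^+ 2 by exact: sqr_ge0.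
(* Six errors: the time Taylor remainder, the change of the time derivative across the jump [H],
   discounting against the time derivative, the space Taylor remainder, discounting against the
   space terms, and the second order part of the discount. *)
have -> : rho * g1 - a - (w ^+ 2 * (- d01 - r * a) + d10 * H + d20 * (H ^+ 2 / 2)) =
  rho * (g1 - g0 + d01' * w ^+ 2) - rho * w ^+ 2 * (d01' - d01) - (rho - 1) * (w ^+ 2 * d01)
  + rho * (g0 - a - d10 * H - d20 * (H ^+ 2 / 2)) + (rho - 1) * (d10 * H + d20 * (H ^+ 2 / 2))
  + (rho - 1 + r * w ^+ 2) * a by ring.
have n1 (x z : R) : 0 <= z -> `|x| <= z -> `|rho * x| <= z.
  by move=> z0 xz; rewrite normrM (ger0_norm rho0); apply: le_trans xz; rewrite ler_piMl.
pose h := `|H|; have h0 : 0 <= h by exact: normr_ge0.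
have H2 : H ^+ 2 = h ^+ 2 by rewrite /h real_normK ?num_real.
have H4 : H ^+ 4 = h ^+ 4 by rewrite (exprM H 2 2) H2 -exprM.
have t1 : `|rho * (g1 - g0 + d01' * w ^+ 2)| <= A * w ^+ 4.
  by apply: n1 => //; rewrite mulr_ge0// exprn_ge0// ltW.
have t2 : `|rho * w ^+ 2 * (d01' - d01)| <= A * (w ^+ 2 * h).
  rewrite -mulrA; apply: n1; first by rewrite mulr_ge0// mulr_ge0.
  by rewrite normrM (ger0_norm w2) mulrCA ler_wpM2l.
have t3 : `|(rho - 1) * (w ^+ 2 * d01)| <= A * (r * w ^+ 4).
  have -> : A * (r * w ^+ 4) = r * w ^+ 2 * (w ^+ 2 * A) by ring.
  by rewrite normrM ler_pM// normrM (ger0_norm w2) ler_wpM2l.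
have t4 : `|rho * (g0 - a - d10 * H - d20 * (H ^+ 2 / 2))| <= A * h ^+ 3.
  by apply: n1 => //; rewrite mulr_ge0// exprn_ge0.
have t5 : `|(rho - 1) * (d10 * H + d20 * (H ^+ 2 / 2))| <= A * (r * w ^+ 2 * (h + h ^+ 2 / 2)).
  have -> : A * (r * w ^+ 2 * (h + h ^+ 2 / 2)) = r * w ^+ 2 * (A * h + A * (h ^+ 2 / 2)) by ring.
  rewrite normrM ler_pM//; apply: le_trans (ler_normD _ _) _.
  have hh : 0 <= h ^+ 2 / 2 by rewrite divr_ge0 ?sqr_ge0.
  by rewrite H2 normrM [X in _ + X]normrM (ger0_norm hh) lerD// ler_wpM2r.
have t6 : `|(rho - 1 + r * w ^+ 2) * a| <= A * (r ^+ 2 * w ^+ 4).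
  by rewrite normrM mulrC ler_pM.
have tri (x1 x2 x3 x4 x5 x6 y1 y2 y3 y4 y5 y6 : R) : `|x1| <= y1 -> `|x2| <= y2 -> `|x3| <= y3 ->
    `|x4| <= y4 -> `|x5| <= y5 -> `|x6| <= y6 ->
    `|x1 - x2 - x3 + x4 + x5 + x6| <= y1 + y2 + y3 + y4 + y5 + y6.
  clear; rewrite !ler_norml => /andP[? ?] /andP[? ?] /andP[? ?] /andP[? ?] /andP[? ?] /andP[? ?].
  apply/andP; split; lra.
apply: (le_trans (tri _ _ _ _ _ _ _ _ _ _ _ _ t1 t2 t3 t4 t5 t6)).
have [] := young_cubic w0 w1 h0; rewrite H2 H4; move: (_ + h ^+ 4 / w) => S S0 b1 b2 b3 b4.
rewrite -(mulrA A) -!(mulrDr A) ler_wpM2l//.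
have c0 : 0 <= r * S by rewrite mulr_ge0.
have c1 := ler_wpM2l r0 b1; have c2 := ler_wpM2l r0 b2; have c4 := ler_wpM2l r0 b4.
have c5 := ler_wpM2l (sqr_ge0 r) b1.
have -> : r * w ^+ 2 * (h + h ^+ 2 / 2) = r * (w ^+ 2 * h) + r * (w ^+ 2 * (h ^+ 2 / 2)) by ring.
have -> : (2 + r) ^+ 2 * S = 4 * S + 4 * (r * S) + r ^+ 2 * S by ring.
move: S0 c0 b1 b2 b3 b4 c1 c2 c4 c5; rewrite !mulrA; clear; lra.
Qed.

Lemma expRN_bounds {R : realType} (y : R) : 0 <= y ->
  [/\ 0 <= expR (- y), expR (- y) <= 1, `|expR (- y) - 1| <= y & `|expR (- y) - 1 + y| <= y ^+ 2].
Proof.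
move=> y0; have h1 := expR_ge1Dx (- y).
have e1 : expR (- y) <= 1 by rewrite -expR0 ler_expR oppr_le0.
have e2 : expR (- y) - 1 + y <= y ^+ 2.
  have y1 : 0 < 1 + y by rewrite ltr_wpDr.
  have : expR (- y) <= (1 + y)^-1.
    by rewrite expRN lef_pV2 ?posrE ?expR_gt0// expR_ge1Dx.
  have : (1 + y)^-1 - 1 + y <= y ^+ 2.
    have -> : (1 + y)^-1 - 1 + y = y ^+ 2 / (1 + y) by field; rewrite gt_eqF.
    by rewrite ler_pdivrMr// mulrDr mulr1 lerDl mulr_ge0 ?sqr_ge0.
  lra.
split=> //; rewrite ?expR_ge0//.
  rewrite ler_norml; apply/andP; split; lra.
by rewrite ger0_norm//; lra.
Qed.

Lemma lipschitz_measurable {R : realType} (g : R -> R) (A : R) :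
  (forall x h, `|g (x + h) - g x| <= A * `|h|) -> measurable_fun [set: R] g.
Proof.
move=> gA; apply: continuous_measurable_fun => x; apply/cvgrPdist_le => e e0.
have A0 : 0 < `|A| + 1 by rewrite ltr_wpDl.
near=> y; rewrite distrC -{1}[y](subrKC x).
apply: (le_trans (gA _ _)); apply: (@le_trans _ _ ((`|A| + 1) * `|y - x|)).
  by rewrite ler_wpM2r// (le_trans (ler_norm _))// lerDl.
rewrite mulrC -ler_pdivlMr// distrC; near: y.
by apply: (@cvgr_dist_le _ _ _ _ _ id x); [exact: cvg_id|exact: divr_gt0].
Unshelve. all: by end_near. Qed.

Section one_step.
Context {R : realType} {d : measure_display} {Omega : measurableType d}.
Variables (P : probability Omega R) (F : R -> set (set Omega)) (W : R -> Omega -> R).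
Hypotheses (F_filt : filtration F) (W_bm : brownian_motion P F W).
Variables (f f10 f20 f01 : R -> R -> R) (A m sigma r : R).
Hypotheses (A0 : 0 <= A) (r0 : 0 <= r).
Hypotheses (fA : forall x tau, `|f x tau| <= A) (f10A : forall x tau, `|f10 x tau| <= A)
  (f20A : forall x tau, `|f20 x tau| <= A) (f01A : forall x tau, `|f01 x tau| <= A).
Hypotheses
  (f_lip : forall x tau h, `|f (x + h) tau - f x tau| <= A * `|h|)
  (f10_lip : forall x tau h, `|f10 (x + h) tau - f10 x tau| <= A * `|h|)
  (f20_lip : forall x tau h, `|f20 (x + h) tau - f20 x tau| <= A * `|h|)
  (f01_lip : forall x tau h, `|f01 (x + h) tau - f01 x tau| <= A * `|h|).
Hypothesis f_taylor_x : forall x tau h,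
  `|f (x + h) tau - f x tau - f10 x tau * h - f20 x tau * (h ^+ 2 / 2)| <= A * `|h| ^+ 3.
Hypothesis f_taylor_t : forall x tau h,
  `|f x (tau + h) - f x tau - f01 x tau * h| <= A * h ^+ 2.

(** The sign of [f01] is negative because [tau] is the time to maturity, which decreases; the last
    term accounts for discounting. *)
Definition generator x tau :=
  sigma ^+ 2 / 2 * f20 x tau + m * f10 x tau - f01 x tau - r * f x tau.

(** Second and fourth moments of the increment are inserted into the bounds for H^2 and H^4; 24 is 8
    times the 3 of the fourth moment. The last summand covers the squared drift, which is of second
    order in time and absent from the generator. *)
Definition dynkinC := A * (2 + r) ^+ 2 * (1 + 2 * m ^+ 2 + 2 * sigma ^+ 2 + 8 * m ^+ 4 + 24 * sigma ^+ 4)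
  + A * m ^+ 2.

Let m00 tau : measurable_fun [set: R] (f^~ tau). Proof. by apply: (@lipschitz_measurable _ _ A) => x h. Qed.
Let m10 tau : measurable_fun [set: R] (f10^~ tau). Proof. by apply: (@lipschitz_measurable _ _ A) => x h. Qed.
Let m20 tau : measurable_fun [set: R] (f20^~ tau). Proof. by apply: (@lipschitz_measurable _ _ A) => x h. Qed.
Let m01 tau : measurable_fun [set: R] (f01^~ tau). Proof. by apply: (@lipschitz_measurable _ _ A) => x h. Qed.

Variables (u v tau : R) (X X' : Omega -> R) (B : set Omega).
Hypotheses (u0 : 0 <= u) (uv : u < v) (uv1 : v - u <= 1).
Hypotheses (mX : measurable_wrt (F u) X) (mX' : measurable_fun setT X') (FB : F u B).
Hypothesis XX' : {ae P, forall w, X' w - X w = m * (v - u) + sigma * (W v w - W u w)}.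

Let D w := W v w - W u w.
Let de := v - u.
Let s := Num.sqrt de.
Let H w := m * de + sigma * D w.
Let Fs := filtration_sigma F_filt u0.
Let uv' := ltW uv.

Let de0 : 0 < de. Proof. by rewrite subr_gt0. Qed.
Let s0 : 0 < s. Proof. by rewrite sqrtr_gt0. Qed.
Let s2 : s ^+ 2 = de. Proof. by rewrite sqr_sqrtr// ltW. Qed.
Let s1 : s <= 1. Proof. by rewrite -sqrtr1 ler_sqrt. Qed.

Let wrt (p : R -> R) : measurable_fun setT p -> measurable_wrt (F u) (fun w => \1_B w * p (X w)).
Proof.
move=> mp; apply: measurable_wrtM => //; first exact: measurable_wrt_indic.
exact: measurable_wrt_comp.
Qed.

Let wrt_meas (Z : Omega -> R) : measurable_wrt (F u) Z -> measurable_fun setT Z.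
Proof. by apply: measurable_wrt_measurable; exact: filtration_sub. Qed.

Let indM_le (z : R) w (K : R) : `|z| <= K -> `|\1_B w * z| <= K.
Proof.
move=> zK; rewrite normrM; apply: le_trans zK; rewrite ler_piMl//.
by rewrite indicE; case: (_ \in _); rewrite ?normr1 ?normr0.
Qed.

Let int (p : R -> R) K : measurable_fun setT p -> (forall x, `|p x| <= K) ->
  rv_integrable P (fun w => \1_B w * p (X w)).
Proof.
move=> mp pK; apply: (@rv_integrable_bounded _ _ _ _ _ K); first exact/wrt_meas/wrt.
by move=> w; exact: indM_le.
Qed.

Let indM (p : R -> R) K : measurable_fun setT p -> (forall x, `|p x| <= K) ->
  forall k, (k <= 4)%N -> rv_integrable P (fun w => \1_B w * p (X w) * D w ^+ k) /\
  mean P (fun w => \1_B w * p (X w) * D w ^+ k) =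
  mean P (fun w => \1_B w * p (X w)) * mean P (fun w => D w ^+ k).
Proof.
move=> mp pK k k4; apply: (@rv_integrableM_increment _ _ _ P F W W_bm u v u0 uv' _ (fun x => x ^+ k)).
- exact: wrt.
- exact: int pK.
- exact: exprn_measurable.
- exact: (rv_integrable_incrementX F_filt W_bm u0 uv' k4).
Qed.

(** The event [B] belongs to [F u], so its indicator passes through the independence argument like a
    coefficient. The error of order delta^(3/2) beats the number of steps, of order 1/delta. *)
Lemma one_step :
  `|mean P (fun w => \1_B w * (expR (- r * (v - u)) * f (X' w) (tau - (v - u)) - f (X w) tau)) -
    (v - u) * mean P (fun w => \1_B w * generator (X w) tau)| <=
  dynkinC * ((v - u) * Num.sqrt (v - u)).
Proof.
rewrite -/de -/s.
pose rho := expR (- r * de).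
(* The Taylor polynomial sorted by powers of the Brownian increment: [p1] drops out in the mean and
   [p2] is multiplied by the variance [de]. *)
pose p0 x := de * (- f01 x tau - r * f x tau) + (m * de) * f10 x tau + (m * de) ^+ 2 / 2 * f20 x tau.
pose p1 x := sigma * f10 x tau + m * de * sigma * f20 x tau.
pose p2 x := sigma ^+ 2 / 2 * f20 x tau.
pose Del (Z : Omega -> R) w := \1_B w * (rho * f (Z w) (tau - de) - f (X w) tau).
pose lin w := \1_B w * p0 (X w) + \1_B w * p1 (X w) * D w ^+ 1 + \1_B w * p2 (X w) * D w ^+ 2.
pose Bnd w := A * (2 + r) ^+ 2 * (s ^+ 3 + 2 * m ^+ 2 * s ^+ 5 + 8 * m ^+ 4 * s ^+ 7) +
  A * (2 + r) ^+ 2 * (2 * sigma ^+ 2 * s) * D w ^+ 2 +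
  A * (2 + r) ^+ 2 * (8 * sigma ^+ 4 / s) * D w ^+ 4.
have [rho0 rho1 hr hr2] := expRN_bounds (mulr_ge0 r0 (ltW de0)).
have rhoE : expR (- (r * de)) = rho by rewrite /rho mulNr.
rewrite rhoE in rho0 rho1 hr hr2.
have pathwise w : `|Del (fun w => X w + H w) w - lin w| <= Bnd w.
  have -> : Del (fun w => X w + H w) w - lin w = \1_B w * (rho * f (X w + H w) (tau - de) - f (X w) tau -
      (s ^+ 2 * (- f01 (X w) tau - r * f (X w) tau) + f10 (X w) tau * H w + f20 (X w) tau * (H w ^+ 2 / 2))).
    by rewrite /Del /lin /p0 /p1 /p2 s2 /H; field.
  apply: indM_le.
  apply: le_trans (dynkin_remainder (g0 := f (X w + H w) tau) (d01' := f01 (X w + H w) tau)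
    A0 r0 s0 s1 rho0 rho1 _ _ _ _ _ _ _ _ _) _ => //.
  - by rewrite s2.
  - by rewrite (exprM s 2 2) s2 -exprMn.
  - have := f_taylor_t (X w + H w) tau (- de).
    by rewrite mulrN opprK sqrrN (exprM s 2 2) s2.
  have -> : Bnd w = A * (2 + r) ^+ 2 * (s ^+ 3 + s * (2 * (m ^+ 2 * s ^+ 4) + 2 * sigma ^+ 2 * D w ^+ 2) +
      (8 * m ^+ 4 * s ^+ 8 + 8 * sigma ^+ 4 * D w ^+ 4) / s).
    by rewrite /Bnd; field; exact: lt0r_neq0.
  apply: ler_wpM2l; first by rewrite mulr_ge0// sqr_ge0.
  have h2 : H w ^+ 2 <= 2 * (m ^+ 2 * s ^+ 4) + 2 * sigma ^+ 2 * D w ^+ 2.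
    have -> : 2 * (m ^+ 2 * s ^+ 4) + 2 * sigma ^+ 2 * D w ^+ 2 = H w ^+ 2 + (m * de - sigma * D w) ^+ 2.
      by rewrite (exprM s 2 2) s2 /H; ring.
    by rewrite lerDl sqr_ge0.
  have h4 : H w ^+ 4 <= 8 * m ^+ 4 * s ^+ 8 + 8 * sigma ^+ 4 * D w ^+ 4.
    have -> : H w ^+ 4 = (H w ^+ 2) ^+ 2 by rewrite -exprM.
    apply: (@le_trans _ _ ((2 * (m ^+ 2 * s ^+ 4) + 2 * sigma ^+ 2 * D w ^+ 2) ^+ 2)).
      by rewrite ler_pXn2r// nnegrE ?sqr_ge0// (le_trans (sqr_ge0 _) h2).
    rewrite -subr_ge0.
    have -> : 8 * m ^+ 4 * s ^+ 8 + 8 * sigma ^+ 4 * D w ^+ 4 - (2 * (m ^+ 2 * s ^+ 4) + 2 * sigma ^+ 2 * D w ^+ 2) ^+ 2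
      = (2 * (m ^+ 2 * s ^+ 4) - 2 * sigma ^+ 2 * D w ^+ 2) ^+ 2 by ring.
    exact: sqr_ge0.
  by apply: lerD; [rewrite lerD2l ler_wpM2l ?(ltW s0)|rewrite ler_wpM2r// invr_ge0 ltW].
have mp0 : measurable_fun [set: R] p0.
  apply: measurable_funD; last by apply: measurable_funM => //; exact: m20.
  apply: measurable_funD; last by apply: measurable_funM => //; exact: m10.
  apply: measurable_funM => //; apply: measurable_funB; first by apply: measurableT_comp => //; exact: m01.
  by apply: measurable_funM => //; exact: m00.
have mp1 : measurable_fun [set: R] p1.
  by apply: measurable_funD; apply: measurable_funM.
have mp2 : measurable_fun [set: R] p2 by apply: measurable_funM => //; exact: m20.
have nM (c x : R) : `|x| <= A -> `|c * x| <= `|c| * A by move=> xA; rewrite normrM ler_wpM2l.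
have bp2 x : `|p2 x| <= `|sigma ^+ 2 / 2| * A by exact: nM.
have bp1 x : `|p1 x| <= `|sigma| * A + `|m * de * sigma| * A.
  by apply: le_trans (ler_normD _ _) _; rewrite lerD ?nM.
have bp0 x : `|p0 x| <= `|de| * (A + `|r| * A) + `|m * de| * A + `|(m * de) ^+ 2 / 2| * A.
  apply: le_trans (ler_normD _ _) _; rewrite lerD ?nM//.
  apply: le_trans (ler_normD _ _) _; rewrite lerD ?nM//.
  rewrite normrM ler_wpM2l//; apply: le_trans (ler_normB _ _) _.
  by rewrite normrN lerD ?nM.
have i0 := int mp0 bp0; have [i1 e1] := indM mp1 bp1 (isT : (1 <= 4)%N).
have [i2 e2] := indM mp2 bp2 (isT : (2 <= 4)%N).
have [D1 D2 D4] := increment_moments F_filt W_bm u0 uv'.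
have ilin : rv_integrable P lin by apply: rv_integrableD => //; exact: rv_integrableD.
have mD := measurable_increment F_filt W_bm u0 uv'.
have mB : measurable B by exact: (filtration_sub F_filt u0).
have mDel Z : measurable_fun setT Z -> measurable_fun setT (Del Z).
  move=> mZ; apply: measurable_funM; first exact: measurable_indic.
  apply: measurable_funB; last by apply: (measurableT_comp (m00 tau)); exact: wrt_meas.
  by apply: measurable_funM => //; apply: (measurableT_comp (m00 (tau - de))).
have bDel Z w : `|Del Z w| <= A + A.
  apply: indM_le; apply: le_trans (ler_normB _ _) _; rewrite lerD//.
  by rewrite normrM ger0_norm// -[leRHS]mul1r ler_pM.
have mXH : measurable_fun setT (fun w => X w + H w).
  apply: measurable_funD; first exact: wrt_meas.
  by apply: measurable_funD => //; apply: measurable_funM.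
have iDel Z : measurable_fun setT Z -> rv_integrable P (Del Z).
  by move=> mZ; exact: rv_integrable_bounded (mDel _ mZ) (bDel Z).
(* The increment formula for [X'] holds almost surely only, so the substitution is made inside the
   mean. *)
have EDel : mean P (Del X') = mean P (Del (fun w => X w + H w)).
  apply: mean_ae; [exact: mDel|exact: mDel|]; apply: filterS XX' => w hw.
  by rewrite /Del /H -hw subrKC.
have iD2 := rv_integrable_incrementX F_filt W_bm u0 uv' (isT : (2 <= 4)%N).
have iD4 := rv_integrable_incrementX F_filt W_bm u0 uv' (isT : (4 <= 4)%N).
have iBnd : rv_integrable P Bnd.
  apply: rv_integrableD; last exact: rv_integrableZ.
  by apply: rv_integrableD; [exact: rv_integrable_cst|exact: rv_integrableZ].
have s3 : de * s = s ^+ 3 by rewrite exprS s2 mulrC.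
have s30 : 0 <= s ^+ 3 by rewrite exprn_ge0// ltW.
have sk k : s ^+ (3 + k) <= s ^+ 3 by rewrite exprD ler_piMr// exprn_ile1// ltW.
have EBnd : mean P Bnd <= A * (2 + r) ^+ 2 *
    (1 + 2 * m ^+ 2 + 2 * sigma ^+ 2 + 8 * m ^+ 4 + 24 * sigma ^+ 4) * (de * s).
  have iZ2 := rv_integrableZ (A * (2 + r) ^+ 2 * (2 * sigma ^+ 2 * s)) iD2.
  have iZ4 := rv_integrableZ (A * (2 + r) ^+ 2 * (8 * sigma ^+ 4 / s)) iD4.
  have icst := rv_integrable_cst P (A * (2 + r) ^+ 2 * (s ^+ 3 + 2 * m ^+ 2 * s ^+ 5 + 8 * m ^+ 4 * s ^+ 7)).
  rewrite (meanD (rv_integrableD icst iZ2) iZ4) (meanD icst iZ2) mean_cst (meanZ _ iD2) (meanZ _ iD4).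
  rewrite D2 D4 -/de -s2.
  rewrite [leLHS](_ : _ = A * (2 + r) ^+ 2 * (s ^+ 3 + 2 * m ^+ 2 * s ^+ 5 + 8 * m ^+ 4 * s ^+ 7 +
     2 * sigma ^+ 2 * s ^+ 3 + 24 * sigma ^+ 4 * s ^+ 3)); last by field; exact: lt0r_neq0.
  rewrite s2 s3 -[leRHS]mulrA; apply: ler_wpM2l; first by rewrite mulr_ge0// sqr_ge0.
  have k5 : 2 * m ^+ 2 * s ^+ 5 <= 2 * m ^+ 2 * s ^+ 3.
    by apply: ler_wpM2l; [rewrite mulr_ge0// sqr_ge0|exact: (sk 2%N)].
  have k7 : 8 * m ^+ 4 * s ^+ 7 <= 8 * m ^+ 4 * s ^+ 3.
    by apply: ler_wpM2l; [rewrite mulr_ge0// exprn_even_ge0|exact: (sk 4%N)].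
  rewrite !mulrDl mul1r; lra.
have iG : rv_integrable P (fun w => \1_B w * generator (X w) tau).
  apply: (@int (generator^~ tau) (`|sigma ^+ 2 / 2| * A + `|m| * A + A + `|r| * A)).
    apply: measurable_funB; last by apply: measurable_funM.
    by apply: measurable_funB => //; apply: measurable_funD; apply: measurable_funM.
  move=> x; apply: le_trans (ler_normB _ _) _; rewrite lerD ?nM//.
  apply: le_trans (ler_normB _ _) _; rewrite lerD//.
  by apply: le_trans (ler_normD _ _) _; rewrite lerD ?nM.
have i20 : rv_integrable P (fun w => \1_B w * f20 (X w) tau) by exact: int (m20 tau) (f20A^~ tau).
have ip2 : rv_integrable P (fun w => \1_B w * p2 (X w)) by exact: int mp2 bp2.
have Elin : mean P lin = de * mean P (fun w => \1_B w * generator (X w) tau) +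
   (m * de) ^+ 2 / 2 * mean P (fun w => \1_B w * f20 (X w) tau).
  have -> : mean P lin = mean P (fun w => \1_B w * p0 (X w)) + de * mean P (fun w => \1_B w * p2 (X w)).
    rewrite /lin (meanD (rv_integrableD i0 i1) i2) (meanD i0 i1) e1 e2 D2 -/de.
    rewrite [mean P (fun w => D w ^+ 1)](_ : _ = 0); last first.
      by rewrite -[RHS]D1; congr mean; apply/funext => w; rewrite expr1.
    by rewrite mulr0 addr0 [de * _]mulrC.
  rewrite -(meanZ _ ip2) -(meanZ _ iG) -(meanZ _ i20).
  rewrite -(meanD i0 (rv_integrableZ _ ip2)) -(meanD (rv_integrableZ _ iG) (rv_integrableZ _ i20)).
  by congr mean; apply/funext => w; rewrite /p0 /p2 /generator; ring.
have E20 : `|mean P (fun w => \1_B w * f20 (X w) tau)| <= A.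
  apply: (le_trans (mean_norm_le i20)); rewrite -[leRHS](mean_cst P A); apply: mean_le.
  - by have := integrable_abse i20; apply: eq_integrable.
  - exact: rv_integrable_cst.
  - by move=> w; exact: indM_le.
have iDX := iDel _ mXH.
have Ed : `|mean P (Del (fun w => X w + H w)) - mean P lin| <= mean P Bnd.
  rewrite -meanB//; have iB := rv_integrableB iDX ilin.
  apply: (le_trans (mean_norm_le iB)); apply: mean_le => //.
  by have := integrable_abse iB; apply: eq_integrable.
rewrite -[X in mean P X]/(Del X') EDel /dynkinC.
have -> : mean P (Del (fun w => X w + H w)) - de * mean P (fun w => \1_B w * generator (X w) tau) =
  (mean P (Del (fun w => X w + H w)) - mean P lin) +
  (m * de) ^+ 2 / 2 * mean P (fun w => \1_B w * f20 (X w) tau) by rewrite Elin; ring.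
apply: le_trans (ler_normD _ _) _; rewrite mulrDl lerD ?(le_trans Ed)//.
rewrite normrM ger0_norm ?divr_ge0 ?sqr_ge0//.
apply: (@le_trans _ _ ((m * de) ^+ 2 / 2 * A)).
  by rewrite ler_wpM2l ?divr_ge0 ?sqr_ge0.
have -> : (m * de) ^+ 2 / 2 * A = A * m ^+ 2 * (de ^+ 2 / 2) by ring.
apply: ler_wpM2l; first by rewrite mulr_ge0// sqr_ge0.
have -> : de ^+ 2 = s * (de * s) by rewrite mulrCA -expr2 s2 expr2.
have := ler_wpM2r (mulr_ge0 (ltW de0) (ltW s0)) s1.
have : 0 <= de * s by rewrite mulr_ge0// ltW.
rewrite mul1r; lra.
Qed.

End one_step.

(** The last node is exempt because only left ends of cells are tested below. *)
Lemma grid_crossing {R : realType} (g : nat -> R) (N : nat) (x : R) :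
  (forall k, (k < N)%N -> g k <= g k.+1) ->
  exists2 K, (K <= N)%N & forall k, (k <= N)%N -> k != N -> (g k < x) = (k < K)%N.
Proof.
elim: N => [_|N ih gle].
  by exists 0%N => // k; rewrite leqn0 => /eqP ->; rewrite eqxx.
have [k kN|K KN hK] := ih; first by apply: gle; exact: ltnW.
have [xN|xN] := ltP (g N) x.
  exists N.+1 => // k; rewrite leq_eqVlt => /orP[/eqP -> /eqP//|kN _]; rewrite kN.
  apply: le_lt_trans xN; elim: N {ih hK KN} gle kN => [|N ih] gle; first by rewrite ltnS leqn0 => /eqP ->.
  rewrite ltnS leq_eqVlt => /orP[/eqP -> //|kN]; apply: (le_trans (ih _ kN)).
    by move=> j jN; apply: gle; exact: ltnW.
  by apply: gle.
exists K => [|k]; first exact: leqW.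
rewrite leq_eqVlt => /orP[/eqP -> /eqP//|]; rewrite ltnS leq_eqVlt => /orP[/eqP -> _|kN _].
  by rewrite ltNge xN ltnNge KN.
by apply: hK; [exact: ltnW|rewrite ltn_eqF].
Qed.

Section stopped_telescope.
Context {R : realType}.
Variables (t T : R) (tT : t < T) (a : R -> R) (x : R).
Hypothesis tx : t <= x <= T.
Local Notation g n := (ugrid t T n.+1).
Local Notation stopped n := (\sum_(k < n.+1) (g n k < x)%R%:R * (a (g n k.+1) - a (g n k))).

(** The cells starting before [x] form an initial segment, so the sum telescopes to a node at most
    one mesh beyond [x]. *)
Lemma stopped_sum n : exists2 K, (K <= n.+1)%N &
  `|x - g n K| <= (T - t) / n.+1%:R /\ stopped n = a (g n K) - a t.
Proof.
have gg := ugrid_grid (ltW tT) (ltn0Sn n); have [g0 gN gle] := gg.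
have [K KN hK] := grid_crossing x gle; exists K => //; split; last first.
  rewrite (eq_bigr (fun k : 'I_n.+1 => if (k < K)%N then a (g n k.+1) - a (g n k) else 0)).
    rewrite -big_mkcond/= -(big_mkord (fun k => k < K)%N (fun k => a (g n k.+1) - a (g n k))).
    have := @big_nat_widen R 0 +%R 0%N K n.+1 xpredT (fun k => a (g n k.+1) - a (g n k)) KN.
    by rewrite (telescope_sumr (fun k => a (g n k)))// g0 => ->.
  move=> k _; rewrite hK ?(ltnW (ltn_ord k)) ?ltn_eqF//.
  by case: (k < K)%N; rewrite ?mul1r ?mul0r.
have h1 : x <= g n K.
  move: KN; rewrite leq_eqVlt => /orP[/eqP ->|KN]; first by rewrite gN; case/andP: tx.
  by rewrite leNgt hK ?ltnn// ?ltn_eqF// ltnW.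
rewrite distrC ger0_norm ?subr_ge0// -(ugrid_step t T n.+1 K.-1).
case: K KN hK h1 => [|K] KN hK h1 /=.
  apply: (@le_trans _ _ 0); last by rewrite subr_ge0 gle.
  by rewrite g0 subr_le0; case/andP: tx.
by rewrite lerD2l lerN2 ltW// hK ?(ltnW KN)// ltn_eqF.
Qed.

Lemma stopped_telescope : {within `[t, T], continuous a} ->
  stopped n @[n --> \oo] --> a x - a t.
Proof.
move=> a_cont; apply/cvgrPdist_le => e e0.
have := (within_continuous_eps _ _).1 a_cont x; rewrite /= in_itv/= => /(_ tx e e0)[dl dl0 hdl].
have := @near_natinv R (T - t) dl dl0; apply: filterS => n hn.
have [K KN [xK ->]] := stopped_sum n.
rewrite [X in `|X|](_ : _ = a x - a (g n K)); last by ring.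
apply/ltW/hdl; last exact: le_lt_trans hn.
by rewrite /= in_itv/=; exact: grid_in (ugrid_grid (ltW tT) (ltn0Sn n)) KN.
Qed.

End stopped_telescope.

(** No integrability is assumed: the positive part vanishes, and an infinite negative part has
    [fine] value 0. *)
Lemma mean_le0 {R : realType} {d : measure_display} {Omega : measurableType d}
    (P : probability Omega R) (X : Omega -> R) : (forall w, X w <= 0) -> mean P X <= 0.
Proof.
move=> X0; apply: fine_le0; rewrite integralE [X in (X - _)%E](_ : _ = 0%E).
  by rewrite sub0e oppe_le0 integral_ge0.
by apply: integral0_eq => w _; rewrite funeposE max_r// lee_fin.
Qed.

Section dynkin_stopped.
Context {R : realType} {d : measure_display} {Omega : measurableType d}.
Variables (P : probability Omega R) (F : R -> set (set Omega)) (W : R -> Omega -> R).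
Hypotheses (F_filt : filtration F) (W_bm : brownian_motion P F W).
Variables (f f10 f20 f01 : R -> R -> R) (A m sigma r : R).
Hypotheses (A0 : 0 <= A) (r0 : 0 <= r).
Hypotheses (fA : forall x tau, `|f x tau| <= A) (f10A : forall x tau, `|f10 x tau| <= A)
  (f20A : forall x tau, `|f20 x tau| <= A) (f01A : forall x tau, `|f01 x tau| <= A).
Hypotheses
  (f_lip : forall x tau h, `|f (x + h) tau - f x tau| <= A * `|h|)
  (f_lip_t : forall x tau h, `|f x (tau + h) - f x tau| <= A * `|h|)
  (f10_lip : forall x tau h, `|f10 (x + h) tau - f10 x tau| <= A * `|h|)
  (f20_lip : forall x tau h, `|f20 (x + h) tau - f20 x tau| <= A * `|h|)
  (f01_lip : forall x tau h, `|f01 (x + h) tau - f01 x tau| <= A * `|h|).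
Hypothesis f_taylor_x : forall x tau h,
  `|f (x + h) tau - f x tau - f10 x tau * h - f20 x tau * (h ^+ 2 / 2)| <= A * `|h| ^+ 3.
Hypothesis f_taylor_t : forall x tau h,
  `|f x (tau + h) - f x tau - f01 x tau * h| <= A * h ^+ 2.
Variables (t T : R) (X : R -> Omega -> R) (theta : Omega -> R).
Hypotheses (t0 : 0 <= t) (tT : t < T).
Hypotheses (X_adapted : forall u, t <= u <= T -> measurable_wrt (F u) (X u))
  (X_cont : forall w, {within `[t, T], continuous (fun u => X u w)}).
Hypothesis X_incr : forall u v, t <= u -> u < v -> v <= T ->
  {ae P, forall w, X v w - X u w = m * (v - u) + sigma * (W v w - W u w)}.
Hypothesis theta_stop : stopping_times F t T theta.

Local Notation G := (generator f f10 f20 f01 m sigma r).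
Local Notation g n := (ugrid t T n.+1).

Definition discounted u w := expR (- r * (u - t)) * f (X u w) (T - u).

Let gg n : grid_on t T n.+1 (g n). Proof. by apply: ugrid_grid => //; exact: ltW. Qed.

Let gin n k : (k <= n.+1)%N -> t <= g n k <= T. Proof. exact: grid_in. Qed.

Let g_ge0 n k : (k <= n.+1)%N -> 0 <= g n k.
Proof. by move=> /gin/andP[+ _]; exact: le_trans. Qed.

Let De n := (T - t) / n.+1%:R.
Let De0 n : 0 < De n. Proof. by rewrite divr_gt0// subr_gt0. Qed.
Let gS n k : g n k.+1 - g n k = De n. Proof. exact: ugrid_step. Qed.
Let glt n k : g n k < g n k.+1. Proof. by rewrite -subr_gt0 gS. Qed.

(** The strict inequality puts the event in [F (g n k)], as the complement of a stopping event:
    whether the next cell is entered is decided at its left end. *)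
Let B n k := [set w | g n k < theta w].

Let FB n k : (k <= n.+1)%N -> F (g n k) (B n k).
Proof.
move=> kn; have Fs := filtration_sigma F_filt (g_ge0 kn).
have -> : B n k = ~` [set w | theta w <= g n k].
  by apply/seteqP; split=> w /=; rewrite /B/= ltNge => /negP.
apply: (sub_sigma_algebraC Fs); case: theta_stop => _; apply; exact: g_ge0.
Qed.

Lemma continuous_discounted w : {within `[t, T], continuous (discounted^~ w)}.
Proof.
have ec : {within `[t, T], continuous (fun u : R => expR (- r * (u - t)))}.
  apply: continuous_subspaceT => u; apply: continuous_comp; last exact: continuous_expR.
  by apply: cvgM; [exact: cvg_cst|apply: cvgB; [exact: cvg_id|exact: cvg_cst]].
move=> u; apply: cvgM; first exact: ec.
move: u; apply/within_continuous_eps => u uI e e0.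
have A1 : 0 < A + 1 by rewrite ltr_wpDl.
have e2 : 0 < e / 2 / (A + 1) by rewrite !divr_gt0.
have [dl dl0 hdl] := (within_continuous_eps _ _).1 (@X_cont w) u uI _ e2.
exists (Num.min dl (e / 2 / (A + 1))) => [|v vI]; first by rewrite lt_min dl0.
rewrite /ball/= lt_min => /andP[uv uv2].
have h1 := f_lip (X u w) (T - u) (X v w - X u w); rewrite subrKC in h1.
have h2 := f_lip_t (X v w) (T - u) (u - v).
have Tuv : T - u + (u - v) = T - v by ring.
rewrite Tuv distrC in h2; have h3 := hdl v vI uv; rewrite distrC in h1.
have k1 (y : R) : `|y| < e / 2 / (A + 1) -> A * `|y| < e / 2.
  move=> hy; apply: (@le_lt_trans _ _ ((A + 1) * `|y|)); first by rewrite ler_wpM2r// lerDl.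
  by rewrite mulrC -ltr_pdivlMr.
have k3 : A * `|X v w - X u w| < e / 2 by apply: k1; rewrite distrC.
have := k1 _ uv2; move: k3.
have := ler_distD (f (X v w) (T - u)) (f (X u w) (T - u)) (f (X v w) (T - v)).
move: h1 h2; lra.
Qed.

Let Gsum n := \sum_(k < n.+1) expR (- r * (g n k - t)) *
  (De n * mean P (fun w => \1_(B n k) w * G (X (g n k) w) (T - g n k))).

Let Dsum n w := \sum_(k < n.+1) \1_(B n k) w * (discounted (g n k.+1) w - discounted (g n k) w).

Let exp1 u : t <= u -> 0 <= expR (- r * (u - t)) <= 1.
Proof.
by move=> tu; rewrite expR_ge0 -[leRHS]expR0 ler_expR mulNr oppr_le0 mulr_ge0// subr_ge0.
Qed.

Let disc_bound u w : t <= u -> `|discounted u w| <= A.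
Proof.
move=> /exp1/andP[h0 h1]; rewrite normrM ger0_norm// -[leRHS]mul1r.
by rewrite ler_pM.
Qed.

Let mX u : t <= u <= T -> measurable_fun setT (X u).
Proof.
move=> uI; apply: (measurable_wrt_measurable _ (X_adapted uI)).
by apply: (filtration_sub F_filt); case/andP: uI => h _; exact: le_trans h.
Qed.

Lemma measurable_discounted u : t <= u <= T -> measurable_fun setT (discounted u).
Proof.
move=> uI; apply: measurable_funM => //.
by apply: (measurableT_comp (f := f^~ (T - u))); [apply: (@lipschitz_measurable _ _ A) => x h|exact: mX].
Qed.

Let mB n k : (k <= n.+1)%N -> measurable (B n k).
Proof. by move=> kn; apply: (filtration_sub F_filt (g_ge0 kn)); exact: FB. Qed.

Let term_int n k : (k < n.+1)%N ->
  rv_integrable P (fun w => \1_(B n k) w * (discounted (g n k.+1) w - discounted (g n k) w)).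
Proof.
move=> kn; apply: (@rv_integrable_bounded _ _ _ _ _ (A + A)).
  apply: measurable_funM; first exact/measurable_indic/mB/ltnW.
  by apply: measurable_funB; apply: measurable_discounted; apply: gin => //; exact: ltnW.
move=> w; rewrite normrM -[leRHS]mul1r ler_pM//.
  by rewrite indicE; case: (_ \in _); rewrite ?normr0 ?normr1.
apply: le_trans (ler_normB _ _) _; rewrite lerD// disc_bound//.
  by case/andP: (gin kn).
by case/andP: (gin (ltnW kn)).
Qed.

Let C := dynkinC A m sigma r.

(** Each of the n+1 steps costs De * sqrt De, and n+1 times De is T - t. Discount factors up to the
    left end are at most 1. *)
Let sum_step n : De n <= 1 -> `|mean P (Dsum n) - Gsum n| <= C * (T - t) * Num.sqrt (De n).
Proof.
move=> D1; rewrite /Dsum mean_sum; last by move=> k _; exact: term_int.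
rewrite /Gsum -sumrB; apply: le_trans (ler_norm_sum _ _ _) _.
apply: (@le_trans _ _ (\sum_(k < n.+1) C * (De n * Num.sqrt (De n)))).
  apply: ler_sum => k _; have kn := ltn_ord k; have kn' := ltnW kn.
  have /andP[tk kT] := gin kn'; have /andP[tk1 kT1] := gin kn.
  have mXk := X_adapted (gin kn'); have mXk1 := mX (gin kn).
  have D1' : g n k.+1 - g n k <= 1 by rewrite gS.
  have := one_step F_filt W_bm A0 r0 fA f10A f20A f01A f_lip f10_lip f20_lip f01_lip
    f_taylor_x f_taylor_t (T - g n k) (g_ge0 kn') (glt n k) D1' mXk mXk1 (FB kn')
    (X_incr tk (glt n k) kT1).
  rewrite gS => H.
  have e0 : 0 <= expR (- r * (g n k - t)) by exact: expR_ge0.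
  have e1 : expR (- r * (g n k - t)) <= 1 by case/andP: (exp1 tk).
  set mG := mean P (fun w => _ * G _ _).
  have -> : mean P (fun w => \1_(B n k) w * (discounted (g n k.+1) w - discounted (g n k) w)) =
    expR (- r * (g n k - t)) * mean P (fun w => \1_(B n k) w *
       (expR (- r * De n) * f (X (g n k.+1) w) (T - g n k - De n) - f (X (g n k) w) (T - g n k))).
    rewrite -meanZ; last first.
      apply: (@rv_integrable_bounded _ _ _ _ _ (A + A)).
        apply: measurable_funM; first exact/measurable_indic/mB.
        apply: measurable_funB; last first.
          by apply: (measurableT_comp (f := f^~ (T - g n k))); [apply: (@lipschitz_measurable _ _ A) => x h|exact: (mX (gin kn'))].
        apply: measurable_funM => //.
        by apply: (measurableT_comp (f := f^~ (T - g n k - De n))); [apply: (@lipschitz_measurable _ _ A) => x h|exact: (mX (gin kn))].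
      move=> w; rewrite normrM -[leRHS]mul1r ler_pM//.
        by rewrite indicE; case: (_ \in _); rewrite ?normr0 ?normr1.
      apply: le_trans (ler_normB _ _) _; rewrite lerD// normrM ger0_norm ?expR_ge0// -[leRHS]mul1r.
      by rewrite ler_pM ?expR_ge0// -expR0 ler_expR mulNr oppr_le0 mulr_ge0// ltW.
    congr mean; apply/funext => w; rewrite /discounted -(gS n k).
    have -> : - r * (g n k.+1 - t) = - r * (g n k - t) + - r * (g n k.+1 - g n k) by ring.
    have -> : T - g n k - (g n k.+1 - g n k) = T - g n k.+1 by ring.
    by rewrite expRD; ring.
  rewrite -mulrBr normrM ger0_norm// -[leRHS]mul1r ler_pM//.
rewrite sumr_const card_ord -[leLHS]mulr_natl /De le_eqVlt; apply/orP; left; apply/eqP.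
move: (Num.sqrt _) => z; have n0 : n.+1%:R != 0 :> R by rewrite pnatr_eq0.
by move: n.+1%:R n0 => y y0; field.
Qed.

Let thetaI w : t <= theta w <= T. Proof. by case: theta_stop. Qed.

Let DsumE n w : Dsum n w = \sum_(k < n.+1) (g n k < theta w)%R%:R *
  (discounted (g n k.+1) w - discounted (g n k) w).
Proof.
apply: eq_bigr => k _; congr (_ * _); rewrite indicE; congr (_%:R); congr nat_of_bool.
by apply/idP/idP => [/set_mem//|h]; exact/mem_set.
Qed.

(** By telescoping, the sum together with its initial term is the discounted value at a single node,
    hence bounded by [A]; bounded convergence applies. *)
Let Dsum_cvg : mean P (fun w => Dsum n w + discounted t w) @[n --> \oo] -->
  mean P (fun w => discounted (theta w) w).
Proof.
have tI : t <= t <= T by rewrite lexx ltW.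
apply: (@mean_cvg _ _ _ P _ _ A).
- move=> n; apply: measurable_funD; last exact: measurable_discounted.
  by apply: measurable_sum => k; have := rv_integrable_measurable (term_int (ltn_ord k)).
- move=> n w; have [K KN [_ E]] := stopped_sum tT (discounted^~ w) (thetaI w) n.
  rewrite DsumE E subrK disc_bound//; by case/andP: (gin KN).
- move=> w; rewrite -[X in _ --> X](subrK (discounted t w)).
  apply: cvgD; last exact: cvg_cst.
  have := stopped_telescope tT (thetaI w) (@continuous_discounted w).
  by apply: cvg_trans; apply: near_eq_cvg; apply: nearW => n; rewrite DsumE.
Qed.

Let Gsum_cvg : Gsum n @[n --> \oo] -->
  mean P (fun w => discounted (theta w) w) - mean P (discounted t).
Proof.
have tI : t <= t <= T by rewrite lexx ltW.
have it : rv_integrable P (discounted t).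
  apply: (@rv_integrable_bounded _ _ _ _ _ A); first exact: measurable_discounted.
  by move=> w; rewrite disc_bound.
have iS n : rv_integrable P (Dsum n).
  by apply: rv_integrable_sum => k _; exact: term_int.
have H : mean P (Dsum n) @[n --> \oo] --> mean P (fun w => discounted (theta w) w) - mean P (discounted t).
  have : mean P (fun w => Dsum n w + discounted t w) - mean P (discounted t) @[n --> \oo] -->
      mean P (fun w => discounted (theta w) w) - mean P (discounted t).
    by apply: cvgB; [exact: Dsum_cvg|exact: cvg_cst].
  by apply: cvg_trans; apply: near_eq_cvg; apply: nearW => n; rewrite meanD// addrK.
have De_cvg : De n @[n --> \oo] --> (0 : R).
  rewrite -[X in _ --> X](mulr0 (T - t)); apply: cvgM; first exact: cvg_cst.
  exact: cvg_harmonic.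
apply: (@cvg_dist_le _ _ (fun n => mean P (Dsum n)) (fun n => C * (T - t) * Num.sqrt (De n))).
- have := @near_natinv R (T - t) 1 ltr01; apply: filterS => n hn.
  by rewrite distrC sum_step// ltW.
- rewrite -[X in _ --> X](mulr0 (C * (T - t))); apply: cvgM; first exact: cvg_cst.
  rewrite -[X in _ --> X](@sqrtr0 R); apply: (@cvg_comp _ _ _ De (@Num.sqrt R) _ (nbhs 0)).
    exact: De_cvg.
  exact: sqrt_continuous.
- exact: H.
Qed.

(** The sign of the generator is required strictly before [theta] only, and the indicators of
    [B n k] retain exactly those times. *)
Lemma dynkin_stopped : (forall u w, t <= u -> u < theta w -> G (X u w) (T - u) <= 0) ->
  mean P (fun w => discounted (theta w) w) <= mean P (discounted t).
Proof.
move=> G0; rewrite -subr_le0; apply: (cvgr_to_le Gsum_cvg); apply: nearW => n.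
apply: sumr_le0 => k _; apply: mulr_ge0_le0; first exact: expR_ge0.
apply: mulr_ge0_le0; first exact: ltW.
apply: mean_le0 => w; have [hB|hB] := pselect (B n k w); last by rewrite indicE memNset ?mul0r.
by rewrite mulr_ge0_le0// G0//; have /andP[] := gin (ltnW (ltn_ord k)).
Qed.

End dynkin_stopped.

(** * Entry times of continuous adapted processes *)

Section stopped_processes.
Context {R : realType} {d : measure_display} {Omega : measurableType d}.
Variables (P : probability Omega R) (F : R -> set (set Omega)).
Hypothesis F_filt : filtration F.
Variables (t T : R) (a : R -> Omega -> R).
Hypotheses (t0 : 0 <= t) (tT : t <= T).
Hypothesis a_cont : forall w, {within `[t, T], continuous (a^~ w)}.

(** The value at a random time is the limit of its telescoping grid sums, each of which uses only
    deterministic times and events of [theta]. *)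
Lemma measurable_stopped (theta : Omega -> R) :
  (forall u, t <= u <= T -> measurable_fun setT (a u)) ->
  measurable_fun setT theta -> (forall w, t <= theta w <= T) ->
  measurable_fun setT (fun w => a (theta w) w).
Proof.
move=> ma mth thI; have [tT'|Tt] := ltP t T; last first.
  have -> : (fun w => a (theta w) w) = a t.
    apply/funext => w; congr a; apply/eqP; rewrite eq_le.
    by have /andP[h1 h2] := thI w; rewrite h1 (le_trans h2).
  by apply: ma; rewrite lexx.
pose g n := ugrid t T n.+1.
pose Z n w := a t w + \sum_(k < n.+1) (g n k < theta w)%R%:R * (a (g n k.+1) w - a (g n k) w).
apply: (measurable_fun_cvg (h := Z)) => [n|w _].
  have gin k : (k <= n.+1)%N -> t <= g n k <= T.
    exact: grid_in (ugrid_grid tT (ltn0Sn n)).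
  apply: measurable_funD; first by apply: ma; rewrite lexx.
  apply: measurable_sum => k; apply: measurable_funM; last first.
    by apply: measurable_funB; apply: ma; apply: gin; rewrite ?(ltnW (ltn_ord k)) ?ltn_ord.
  have -> : (fun w => (g n k < theta w)%R%:R) = \1_[set w | g n k < theta w] :> (Omega -> R).
    apply/funext => w; rewrite indicE; congr (_%:R); congr nat_of_bool.
    by apply/idP/idP => [h|/set_mem//]; exact/mem_set.
  by apply: measurable_indic; exact: measurable_gt_rv.
rewrite -[X in _ --> X](subrKC (a t w)); apply: cvgD; first exact: cvg_cst.
exact: (stopped_telescope tT' (thI w) (@a_cont w)).
Qed.

Definition entry w := inf [set u | t <= u <= T /\ a u w <= 0].

Hypothesis a_end : forall w, a T w <= 0.

Let entry_lb w : lbound [set u | t <= u <= T /\ a u w <= 0] t.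
Proof. by move=> u /= [/andP[]]. Qed.

Let entry_hasinf w : has_inf [set u | t <= u <= T /\ a u w <= 0].
Proof. by split; [exists T => /=; rewrite lexx tT a_end|exists t]. Qed.

Lemma entry_itv w : t <= entry w <= T.
Proof.
apply/andP; split; first by apply: lb_le_inf; [case: (entry_hasinf w)|exact: entry_lb].
by apply: ge_inf; [exists t|rewrite /= lexx tT a_end].
Qed.

Lemma entry_before u w : t <= u -> u < entry w -> 0 < a u w.
Proof.
move=> tu ue; rewrite ltNge; apply/negP => au.
have : entry w <= u.
  apply: ge_inf; first by exists t.
  by rewrite /= tu au (le_trans (ltW ue))//; case/andP: (entry_itv w).
by rewrite leNgt ue.
Qed.

Lemma entry_le0 w : a (entry w) w <= 0.
Proof.
rewrite leNgt; apply/negP => ae.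
have := (within_continuous_eps _ _).1 (@a_cont w) (entry w).
rewrite /= in_itv/= => /(_ (entry_itv w) _ ae)[dl dl0 hdl].
have [u [/= /andP[tu uT] au] ul] := inf_adherent dl0 (entry_hasinf w).
have eu : entry w <= u by apply: ge_inf; [exists t|rewrite /= tu uT].
have := hdl u; rewrite /= in_itv/= tu uT /ball/= => /(_ isT).
rewrite distrC ger0_norm ?subr_ge0// ltrBlDl => /(_ ul).
rewrite ltr_norml => /andP[_]; lra.
Qed.

Lemma entry_le u w : t <= u <= T -> a u w <= 0 -> entry w <= u.
Proof. by move=> uI au; apply: ge_inf; [exists t|]. Qed.

(** Continuity carries positivity over to the entry time itself, with a weak inequality. Estimates
    valid on the closed level set thus hold at the stopped point. *)
Lemma entry_ge0 u w : 0 < a t w -> t <= u -> u <= entry w -> 0 <= a u w.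
Proof.
move=> at0 tu; rewrite le_eqVlt => /predU1P[->|ue]; last exact/ltW/entry_before.
rewrite leNgt; apply/negP => ae; have ae' : 0 < - a (entry w) w by rewrite oppr_gt0.
have /andP[te eT] := entry_itv w.
have te' : t < entry w.
  by rewrite lt_neqAle te andbT; apply/eqP => E; move: ae; rewrite -E ltNge ltW.
have := (within_continuous_eps _ _).1 (@a_cont w) (entry w).
rewrite /= in_itv/= => /(_ (entry_itv w) _ ae')[dl dl0 hdl].
pose v := Num.max t (entry w - dl / 2).
have tv : t <= v by rewrite le_max lexx.
have ve : v < entry w by rewrite gt_max te' ltrBlDr ltrDl divr_gt0.
have := hdl v; rewrite /= in_itv/= tv (le_trans (ltW ve) eT) => /(_ isT).
have vd : `|entry w - v| < dl.
  rewrite ger0_norm ?subr_ge0 ?(ltW ve)//.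
  have : entry w - dl / 2 <= v by rewrite le_max lexx orbT.
  lra.
move=> /(_ vd); have := entry_before tv ve.
move: (a v w) (a (entry w) w) => x z x0; rewrite distrC => /(le_lt_trans (ler_norm _)); lra.
Qed.

Lemma entry_eq_t w : a t w <= 0 -> entry w = t.
Proof.
move=> at0; apply/eqP; rewrite eq_le; have /andP[-> _] := entry_itv w; rewrite andbT.
by apply: ge_inf; [exists t|rewrite /= lexx tT].
Qed.

Hypothesis a_adapted : forall u, t <= u <= T -> measurable_wrt (F u) (a u).

Let pos v m w := forall n k, (k <= n.+1)%N -> m.+1%:R^-1 <= a (ugrid t v n.+1 k) w.

(** Entry after [v] means a positive minimum on the compact [t, v]. By continuity it is enough to
    see a uniform lower bound on the countably many nodes of uniform grids, which turns the event
    into a countable combination of events of [F v]. *)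
Let posE v w : t <= v -> v < T -> (v < entry w) <-> exists m, pos v m w.
Proof.
move=> tv vT; have sub : `[t, v] `<=` `[t, T]%classic by apply: subset_itvl; rewrite bnd_simp ltW.
have gin n k : (k <= n.+1)%N -> t <= ugrid t v n.+1 k <= v.
  exact: grid_in (ugrid_grid tv (ltn0Sn n)).
split=> [ve|[m hm]].
  have [c cI hc] := EVT_min tv (continuous_subspaceW sub (@a_cont w)).
  rewrite in_itv/= in cI; have ac : 0 < a c w.
    by case/andP: cI => tc cv; apply: entry_before => //; exact: le_lt_trans ve.
  have [m _ hm] := @near_natinv R 1 _ ac; exists m => n k kn.
  apply: le_trans (hc _ _); last by rewrite in_itv/= gin.
  by apply/ltW; have := hm m (leqnn m); rewrite mul1r.
rewrite ltNge; apply/negP => ev.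
have /andP[te eT] := entry_itv w.
have m0 : 0 < m.+1%:R^-1 :> R by rewrite invr_gt0.
have := (within_continuous_eps _ _).1 (@a_cont w) (entry w).
rewrite /= in_itv/= => /(_ (entry_itv w) _ m0)[dl dl0 hdl].
have [n [k kn nk]] : exists n, exists2 k, (k <= n.+1)%N & `|entry w - ugrid t v n.+1 k| < dl.
  have [tv'|vt] := ltP t v; last first.
    exists 0%N, 0%N => //; rewrite /ugrid mul0r mulr0 addr0.
    have -> : entry w = t by apply/eqP; rewrite eq_le te (le_trans ev).
    by rewrite subrr normr0.
  have [n _ hn] := @near_natinv R (v - t) _ dl0.
  have eI : t <= entry w <= v by rewrite te.
  have [K KN [h _]] := stopped_sum tv' (a^~ w) eI n.
  by exists n, K => //; apply: le_lt_trans h (hn n (leqnn n)).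
have /andP[h1 h2] := gin n k kn.
have := hdl (ugrid t v n.+1 k); rewrite /= in_itv/= h1 (le_trans h2 (ltW vT)) => /(_ isT nk).
have := hm n k kn; have := entry_le0 w.
move: (a (entry w) w) (a (ugrid t v n.+1 k) w) (m.+1%:R^-1) => x y z.
rewrite distrC => x0 zy /(le_lt_trans (ler_norm _)); lra.
Qed.

Lemma entry_stopping : stopping_times F t T entry.
Proof.
split=> [w|v v0]; first exact: entry_itv.
have Fs := filtration_sigma F_filt v0.
have [vt|tv] := ltP v t.
  rewrite (_ : [set w | _] = set0); last first.
    by rewrite -subset0 => w /=; have /andP[h _] := entry_itv w; rewrite leNgt (lt_le_trans vt h).
  by rewrite -setCT; apply: (sub_sigma_algebraC Fs); exact: sub_sigma_algebraT.
have [Tv|vT] := leP T v.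
  rewrite (_ : [set w | _] = setT); first exact: sub_sigma_algebraT.
  by rewrite -subTset => w _ /=; have /andP[_ h] := entry_itv w; exact: le_trans Tv.
rewrite (_ : [set w | _] = ~` (\bigcup_m \bigcap_n \bigcap_(k in [set k | (k <= n.+1)%N])
   [set w | m.+1%:R^-1 <= a (ugrid t v n.+1 k) w])); last first.
  apply/seteqP; split=> w /=.
    move=> ev [m _ h]; have : v < entry w by apply/(posE w tv vT); exists m => n k kn; exact: h n I k kn.
    by rewrite ltNge ev.
  move=> h; rewrite leNgt; apply/negP => /(posE w tv vT)[m hm]; apply: h.
  by exists m => // n _ k kn; exact: hm.
apply: (sub_sigma_algebraC Fs); apply: (sub_sigma_algebra_bigcup Fs) => m.
apply: (sub_sigma_algebra_bigcap Fs) => n; rewrite bigcap_mkcond.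
apply: (sub_sigma_algebra_bigcap Fs) => k; case: ifPn => [/set_mem/= kn|_]; last exact: sub_sigma_algebraT.
have /andP[h1 h2] : t <= ugrid t v n.+1 k <= v by exact: grid_in (ugrid_grid tv (ltn0Sn n)) kn.
have := measurable_wrt_le F_filt (le_trans t0 h1) h2 (@a_adapted (ugrid t v n.+1 k) _).
rewrite h1 (le_trans h2 (ltW vT)) => /(_ isT) H.
have := H `[m.+1%:R^-1, +oo[%classic (measurable_itv _).
by congr (F v _); apply/seteqP; split=> w /=; rewrite in_itv/= andbT.
Qed.

End stopped_processes.

Lemma within_continuous_min {R : realType} (D : set R) (f g : R -> R) :
  {within D, continuous f} -> {within D, continuous g} ->
  {within D, continuous (fun x => Num.min (f x) (g x))}.
Proof. by move=> cf cg x; apply: (@continuous_min R (subspace D) f g x); [exact: cf|exact: cg]. Qed.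

Lemma mean_le_ae {R : realType} {d : measure_display} {Omega : measurableType d}
    (P : probability Omega R) (X Y : Omega -> R) : rv_integrable P X -> rv_integrable P Y ->
  {ae P, forall w, X w <= Y w} -> mean P X <= mean P Y.
Proof.
move=> iX iY XY; have mX := rv_integrable_measurable iX; have mY := rv_integrable_measurable iY.
have mm : measurable_fun setT (fun w => Num.min (X w) (Y w)) by exact: measurable_minr.
have aem : {ae P, forall w, X w = Num.min (X w) (Y w)}.
  by apply: filterS XY => w XYw; rewrite min_l.
rewrite (mean_ae mX mm aem); apply: mean_le => //; last by move=> w; rewrite ge_min lexx orbT.
exact: rv_integrable_ae iX mm aem.
Qed.

Lemma stopping_times_min {R : realType} {d : measure_display} {Omega : measurableType d}
    (F : R -> set (set Omega)) (t T : R) (theta kappa : Omega -> R) : filtration F ->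
  stopping_times F t T theta -> stopping_times F t T kappa ->
  stopping_times F t T (fun w => Num.min (theta w) (kappa w)).
Proof.
move=> F_filt [h1 h2] [k1 k2]; split=> [w|u u0].
  have /andP[a1 a2] := h1 w; have /andP[b1 b2] := k1 w.
  by rewrite le_min a1 b1 ge_min a2.
have -> : [set w | Num.min (theta w) (kappa w) <= u] = [set w | theta w <= u] `|` [set w | kappa w <= u].
  by apply/seteqP; split=> w /=; rewrite ge_min => /orP.
by apply: (sub_sigma_algebraU (filtration_sigma F_filt u0)); [exact: h2|exact: k2].
Qed.

Lemma measurable_stopping_time {R : realType} {d : measure_display} {Omega : measurableType d}
    (F : R -> set (set Omega)) (t T : R) (theta : Omega -> R) : filtration F -> 0 <= t ->
  stopping_times F t T theta -> measurable_fun setT theta.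
Proof.
move=> F_filt t0 [h1 h2]; move=> mD; apply: (measurability _ (RGenOInfty.measurableE R)) => //.
move=> _ [_ [a ->] <-]; rewrite setTI.
have -> : theta @^-1` `]a, +oo[ = ~` [set w | theta w <= a].
  by apply/seteqP; split=> w /=; rewrite in_itv/= andbT ltNge => /negP.
apply: measurableC; have [a0|a0] := leP 0 a; first by apply: (filtration_sub F_filt a0); exact: h2.
rewrite (_ : [set w | _] = set0)// -subset0 => w /=; have /andP[h _] := h1 w.
by rewrite leNgt (lt_le_trans a0)// (le_trans t0 h).
Qed.

(** * From the mollified function back to the solution *)

Section stopped_inequality.
Context {R : realType} {d : measure_display} {Omega : measurableType d}.
Local Notation mu2 := ((@lebesgue_measure R) \x (@lebesgue_measure R))%E.
Local Notation mu := (@lebesgue_measure R).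
Variables (P : probability Omega R) (F : R -> set (set Omega)) (W : R -> Omega -> R).
Hypotheses (F_filt : filtration F) (W_bm : brownian_motion P F W).
Variables (r q sigma T t s : R) (S : R -> Omega -> R).
Hypotheses (r0 : 0 <= r) (t0 : 0 <= t) (tT : t < T).
Hypothesis S_price : price_process P F W r q sigma T t s S.

Local Notation X u w := (ln (S u w)).
Let x0 := ln s.
Let m := r - q - sigma ^+ 2 / 2.

Let S_gt0 u w : t <= u <= T -> 0 < S u w.
Proof. by case: S_price => h _ _ _ _; apply: h. Qed.

Let X_cont w : {within `[t, T], continuous (fun u => X u w)}.
Proof.
have [_ h _ _ _] := S_price.
apply/within_continuous_eps => u uI e e0; have := uI; rewrite /= in_itv/= => uI'.
have /cvgrPdist_lt/(_ _ e0) := continuous_ln (S_gt0 w uI').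
move=> /nbhs_ballP[e' /= e'0 he].
have [dl dl0 hdl] := (within_continuous_eps _ _).1 (h w) u uI e' e'0.
by exists dl => // v vI uv; apply: he; exact: hdl.
Qed.

Let X_adapted u : t <= u <= T -> measurable_wrt (F u) (fun w => X u w).
Proof.
move=> uI; have [_ _ h _ _] := S_price.
by apply: (measurable_wrt_comp (g := @ln R)); [exact: measurable_ln|exact: h].
Qed.

Let X_start : {ae P, forall w, X t w = x0}.
Proof. by have [_ _ _ h _] := S_price; apply: filterS h => w ->. Qed.

Let X_from_t u : t <= u <= T -> {ae P, forall w, X u w - x0 = m * (u - t) + sigma * (W u w - W t w)}.
Proof.
move=> /andP[]; rewrite le_eqVlt => /predU1P[<- _|tu uT].
  by apply: filterS X_start => w ->; rewrite !subrr !mulr0 addr0.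
apply: filterS (price_log F_filt W_bm t0 tu uT S_price) => w ->; rewrite /m; ring.
Qed.

Let X_incr u v : t <= u -> u < v -> v <= T ->
  {ae P, forall w, X v w - X u w = m * (v - u) + sigma * (W v w - W u w)}.
Proof.
move=> tu uv vT; have uI : t <= u <= T by rewrite tu (le_trans (ltW uv)).
have vI : t <= v <= T by rewrite vT (le_trans tu (ltW uv)).
apply: filterS2 (X_from_t uI) (X_from_t vI) => w hu hv.
have -> : X v w - X u w = (X v w - x0) - (X u w - x0) by ring.
by rewrite hu hv; ring.
Qed.

Section path_functions.
Variable Z : R * R -> R.
Hypothesis Z_cont : {within setT `*` `[0, T], continuous Z}.

Let Z_eps x tau e : 0 <= tau <= T -> 0 < e -> exists2 dl, 0 < dl &
  forall y v, 0 <= v <= T -> `|x - y| < dl -> `|tau - v| < dl -> `|Z (x, tau) - Z (y, v)| < e.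
Proof.
move=> tauI e0; have [|dl dl0 hdl] := (within_continuous_eps _ _).1 Z_cont (x, tau) _ e e0.
  by split=> //=; rewrite in_itv.
by exists dl => // y v vI xy tv; apply: hdl => //; split=> //=; rewrite in_itv.
Qed.

Lemma path_continuous w : {within `[t, T], continuous (fun u => Z (X u w, T - u))}.
Proof.
apply/within_continuous_eps => u; rewrite /= in_itv/= => uI e e0.
have TI v : t <= v <= T -> 0 <= T - v <= T.
  by move=> /andP[tv vT]; rewrite subr_ge0 vT lerBlDr lerDl (le_trans t0).
have [dl dl0 hdl] := Z_eps (X u w) (TI _ uI) e0.
have := (within_continuous_eps _ _).1 (@X_cont w) u; rewrite /= in_itv/= => /(_ uI dl dl0)[dl' dl'0 hdl'].
exists (Num.min dl dl') => [|v vI]; first by rewrite lt_min dl0.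
rewrite /ball/= lt_min => /andP[uv uv']; apply: hdl.
- by apply: TI; move: vI; rewrite in_itv.
- exact: hdl'.
- by rewrite (_ : T - u - (T - v) = - (u - v)) ?normrN//; ring.
Qed.

Lemma path_adapted u : t <= u <= T -> measurable_wrt (F u) (fun w => Z (X u w, T - u)).
Proof.
move=> uI; have TI : 0 <= T - u <= T.
  by case/andP: uI => tu uT; rewrite subr_ge0 uT lerBlDr lerDl (le_trans t0).
apply: (measurable_wrt_comp (g := fun x => Z (x, T - u))); last exact: X_adapted.
apply: continuous_measurable_fun => x; apply/cvgrPdist_lt => e e0.
have [dl dl0 hdl] := Z_eps x TI e0; apply/nbhs_ballP; exists dl => //= y xy.
by apply: hdl => //; rewrite subrr normr0.
Qed.

End path_functions.

Variables (Y psi : R * R -> R) (A : R).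
Hypotheses (Y_meas : measurable_fun ([set: measurableTypeR R] `*` `]0, T[) Y)
  (YA : forall x tau, 0 <= tau <= T -> `|Y (x, tau)| <= A).
Hypotheses (Y_cont : {within setT `*` `[0, T], continuous Y})
  (psi_cont : {within setT `*` `[0, T], continuous psi}).

Definition bump_at (ep : R) (b : R -> R) := [/\ smooth b, forall x, 0 <= b x,
  forall x, ~ (ep <= x <= 2 * ep) -> b x = 0 & forall x, (\int[mu]_y (b (x - y))%:E = 1)%E].

(** All that is used about the equation, so that one argument serves two choices of [psi] and both
    signs of [Y]. Positivity of [psi] is asked on a rectangle reaching up to (x, tau), larger than
    [box], so that it connects the box with the path. *)
Definition moll_subsolution := forall (Q : set (measurableTypeR R * measurableTypeR R)) ep b x tau,
  measurable Q -> (mu2 Q < +oo)%E -> measurable_fun Q Y -> (forall z, Q z -> `|Y z| <= A) ->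
  0 < ep -> bump_at ep b -> box ep x tau `<=` Q -> tau <= T ->
  (forall y v, x - 2 * ep <= y <= x -> tau - 2 * ep <= v <= tau -> 0 < v /\ 0 < psi (y, v)) ->
  generator (moll Q Y b 0 0) (moll Q Y b 1 0) (moll Q Y b 2 0) (moll Q Y b 0 1) m sigma r x tau <= 0.

Hypothesis Y_gen : moll_subsolution.

(** Positive exactly where [psi] and the remaining time exceed 1/(n+1) and the log-price is below
    n+1 in modulus: a quantitative margin inside a bounded region. *)
Definition level_gap (n : nat) u w : R :=
  Num.min (Num.min (psi (X u w, T - u)) (T - u) - n.+1%:R^-1) (n.+1%:R - `|X u w|).

(** The time to maturity in the minimum makes [T] an entry in any case, so the entry time is defined
    on every path. *)
Definition gap u w : R := Num.min (psi (X u w, T - u)) (T - u).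

Local Notation kappa n := (entry t T (level_gap n)).

Let A0 : 0 <= A. Proof. by apply: le_trans (normr_ge0 (Y (0, 0))) (YA _ _); rewrite lexx (le_trans t0) ?ltW. Qed.

Let lin_cont : {within `[t, T], continuous (fun u : R => T - u)}.
Proof. by apply: continuous_subspaceT => u; apply: cvgB; [exact: cvg_cst|exact: cvg_id]. Qed.

Lemma gap_continuous w : {within `[t, T], continuous (gap^~ w)}.
Proof. by apply: within_continuous_min; [exact: path_continuous|exact: lin_cont]. Qed.

Let level_gap_cont n w : {within `[t, T], continuous (level_gap n ^~ w)}.
Proof.
apply: within_continuous_min => u; apply: cvgB.
- exact: gap_continuous.
- exact: cvg_cst.
- exact: cvg_cst.
- by apply: cvg_norm; exact: X_cont.
Qed.

Lemma gap_end w : gap T w <= 0. Proof. by rewrite ge_min subrr lexx orbT. Qed.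

Let level_gap_end n w : level_gap n T w <= 0.
Proof.
rewrite ge_min; apply/orP; left; rewrite subr_le0 (le_trans (gap_end w))// invr_ge0//.
Qed.

Let level_gap_gt0 n u w : 0 < level_gap n u w ->
  [/\ n.+1%:R^-1 < psi (X u w, T - u), n.+1%:R^-1 < T - u & `|X u w| < n.+1%:R].
Proof. by rewrite lt_min !subr_gt0 lt_min => /andP[/andP[]]. Qed.

Let level_gap_ge0 n u w : 0 <= level_gap n u w ->
  [/\ n.+1%:R^-1 <= psi (X u w, T - u), n.+1%:R^-1 <= T - u & `|X u w| <= n.+1%:R].
Proof. by rewrite le_min !subr_ge0 le_min => /andP[/andP[]]. Qed.

Lemma gap_adapted u : t <= u <= T -> measurable_wrt (F u) (gap u).
Proof.
move=> uI; have Fs := filtration_sigma F_filt (le_trans t0 (proj1 (andP uI))).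
apply/(measurable_wrtP Fs); apply: measurable_minr; last exact: measurable_cst.
by apply/measurable_wrtP => //; exact: path_adapted.
Qed.

Let level_gap_adapted n u : t <= u <= T -> measurable_wrt (F u) (level_gap n u).
Proof.
move=> uI; have Fs := filtration_sigma F_filt (le_trans t0 (proj1 (andP uI))).
apply/(measurable_wrtP Fs); apply: measurable_minr.
  apply/(measurable_wrtP Fs); apply: measurable_wrtB => //; first exact: gap_adapted.
  exact: measurable_wrt_cst.
apply/(measurable_wrtP Fs); apply: measurable_wrtB => //; first exact: measurable_wrt_cst.
by apply: (measurable_wrt_comp (g := fun x => `|x|)); [exact: normr_measurable|exact: X_adapted].
Qed.

Let kappa_stop n : stopping_times F t T (kappa n).
Proof.
apply: (entry_stopping F_filt t0 (ltW tT)).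
- by move=> w; exact: level_gap_cont.
- by move=> w; exact: level_gap_end.
- by move=> u uI; exact: level_gap_adapted.
Qed.

Variable theta : Omega -> R.
Hypothesis theta_stop : stopping_times F t T theta.

Let sig n w := Num.min (theta w) (kappa n w).

Let sig_stop n : stopping_times F t T (sig n).
Proof. exact: stopping_times_min. Qed.

Definition disc_value u w : R := expR (- r * (u - t)) * Y (X u w, T - u).

Let exp_cont : {within `[t, T], continuous (fun u : R => expR (- r * (u - t)))}.
Proof.
apply: continuous_subspaceT => u; apply: continuous_comp; last exact: continuous_expR.
by apply: cvgM; [exact: cvg_cst|apply: cvgB; [exact: cvg_id|exact: cvg_cst]].
Qed.

Let exp1 u : t <= u -> 0 <= expR (- r * (u - t)) <= 1.
Proof.
by move=> tu; rewrite expR_ge0 -[leRHS]expR0 ler_expR mulNr oppr_le0 mulr_ge0// subr_ge0.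
Qed.

Lemma disc_value_continuous w : {within `[t, T], continuous (disc_value ^~ w)}.
Proof. by move=> u; apply: cvgM; [exact: exp_cont|exact: path_continuous]. Qed.

Lemma disc_value_bound u w : t <= u <= T -> `|disc_value u w| <= A.
Proof.
move=> /andP[tu uT]; have /andP[h0 h1] := exp1 tu.
rewrite normrM ger0_norm// -[leRHS]mul1r ler_pM// YA//.
by rewrite subr_ge0 uT lerBlDr lerDl (le_trans t0).
Qed.

Lemma disc_value_measurable u : t <= u <= T -> measurable_fun setT (disc_value u).
Proof.
move=> uI; apply: measurable_funM => //.
apply: (measurable_wrt_measurable _ (path_adapted Y_cont uI)).
by apply: (filtration_sub F_filt); case/andP: uI => h _; exact: le_trans h.
Qed.

Let stopped_int (rho : Omega -> R) : stopping_times F t T rho ->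
  rv_integrable P (fun w => disc_value (rho w) w).
Proof.
move=> rs; have [rI _] := rs; apply: (@rv_integrable_bounded _ _ _ _ _ A).
  apply: (measurable_stopped (ltW tT) disc_value_continuous) => //.
    exact: disc_value_measurable.
  exact: (measurable_stopping_time F_filt t0 rs).
by move=> w; exact: disc_value_bound.
Qed.

Section level.
Variables (n : nat) (eta : R).
Hypotheses (eta0 : 0 < eta) (gap0 : n.+1%:R^-1 < Num.min (psi (x0, T - t)) (T - t))
  (x0n : `|x0| < n.+1%:R).

(** One unit wider than the level set: boxes have width below 1, so both the box and its tip stay in
    this compact set. *)
Let Kc : set (R * R) := `[- n.+2%:R, n.+2%:R] `*` `[0, T].

Let scale : exists2 ep : R, 0 < ep & [/\ 2 * ep < n.+1%:R^-1, 2 * ep < 1,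
  forall x y v v', Kc (x, v) -> Kc (y, v') -> `|x - y| <= 2 * ep -> `|v - v'| <= 2 * ep ->
    `|psi (x, v) - psi (y, v')| < n.+1%:R^-1 &
  forall x y v v', Kc (x, v) -> Kc (y, v') -> `|x - y| <= 2 * ep -> `|v - v'| <= 2 * ep ->
    `|Y (x, v) - Y (y, v')| < eta].
Proof.
have n0 : 0 < n.+1%:R^-1 :> R by rewrite invr_gt0.
have cK : compact Kc by apply: compact_setX; exact: segment_compact.
have sub : Kc `<=` setT `*` `[0, T] by move=> z [].
have [d1 d10 h1] := compact_unif cK (continuous_subspaceW sub psi_cont) n0.
have [d2 d20 h2] := compact_unif cK (continuous_subspaceW sub Y_cont) eta0.
pose e := Num.min (Num.min d1 d2) (Num.min n.+1%:R^-1 1).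
have e0 : 0 < e by rewrite !lt_min d10 d20 n0 ltr01.
have [e1 e2 e3 e4] : [/\ e <= d1, e <= d2, e <= n.+1%:R^-1 & e <= 1].
  by rewrite /e; split; rewrite !ge_min lexx ?orbT.
exists (e / 4); first by rewrite divr_gt0.
have E : 2 * (e / 4) < e by lra.
split=> [||x y v v' xK yK xy vv|x y v v' xK yK xy vv].
- exact: lt_le_trans E e3.
- exact: lt_le_trans E e4.
- by apply: h1 => //; split=> /=; rewrite /ball/=; apply: (lt_le_trans _ e1); exact: le_lt_trans E.
- by apply: h2 => //; split=> /=; rewrite /ball/=; apply: (lt_le_trans _ e2); exact: le_lt_trans E.
Qed.

(** Dynkin's inequality holds for the mollified function, which is within [eta] of [Y] on the level
    set. The replacement is made twice, at the start and at the stopped point; hence 2 eta. *)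
Lemma level_inequality : mean P (fun w => disc_value (sig n w) w) <= Y (x0, T - t) + 2 * eta.
Proof.
have [ep ep0 [epn ep1 psi_osc Y_osc]] := scale.
have [b [b_smooth b_ge0 b_out b_int]] := bump_exists ep0.
(* A fixed bounded set containing all boxes with tip in the level set, so that one mollified
   function with global bounds serves all times and positions. *)
pose Q : set (measurableTypeR R * measurableTypeR R) := `]- n.+3%:R, n.+3%:R[ `*` `]0, T[.
have mQ : measurable Q by apply: measurableX; exact: measurable_itv.
have Q_fin : (mu2 Q < +oo)%E.
  rewrite /Q product_measure1E; [|exact: measurable_itv..].
  have fin (a c : R) : (mu `]a, c[%classic < +oo)%E.
    by rewrite lebesgue_measure_itv/=; case: ifP => _; rewrite ?ltry// -EFinB ltry.
  apply: lte_mul_pinfty; [exact: measure_ge0| |exact: fin].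
  by rewrite ge0_fin_numE ?measure_ge0//; exact: fin.
have Y_mQ : measurable_fun Q Y.
  apply: measurable_funS Y_meas; last by move=> z [].
  by apply: measurableX => //; exact: measurable_itv.
have YAQ z : Q z -> `|Y z| <= A.
  by case: z => y v [_ /=]; rewrite in_itv/= => /andP[/ltW v0 /ltW vT]; rewrite YA// v0.
have [M hM] : exists M, forall i x, (i <= 3)%N -> `|derive1n i b x| <= M.
  have lohi : ep <= 2 * ep by rewrite ler_peMl ?ler1n// ltW.
  have /choice[Mi hMi] i : exists Mi : R, forall x, `|derive1n i b x| <= Mi.
    by have [Mi _ h] := smooth_bounded b_smooth b_out i lohi; exists Mi.
  exists (\sum_(i < 4) `|Mi i|) => i x i3; apply: (le_trans (hMi i x)).
  by rewrite (bigD1 (Ordinal (i3 : (i < 4)%N)))//= (le_trans (ler_norm _))// lerDl sumr_ge0.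
pose C := mollC Q A M.
pose f := moll Q Y b.
have n12 : n.+1%:R + 1 = n.+2%:R :> R by rewrite natr1.
have n13 : n.+2%:R + 1 = n.+3%:R :> R by rewrite natr1.
have boxQ x tau : `|x| <= n.+1%:R -> n.+1%:R^-1 <= tau -> tau <= T -> box ep x tau `<=` Q.
  rewrite ler_norml => /andP[xn1 xn2] ntau tauT [y v] [/=]; rewrite !in_itv/= => /andP[y1 y2] /andP[v1 v2].
  split=> /=; rewrite in_itv/=; first by move: xn1 xn2 y1 y2 n12 n13 ep1 (ep0); lra.
  by move: (n.+1%:R^-1) v1 v2 ntau epn (ep0) tauT => iv; lra.
have inK x tau y v : `|x| <= n.+1%:R -> n.+1%:R^-1 <= tau -> tau <= T ->
    x - 2 * ep <= y <= x -> tau - 2 * ep <= v <= tau ->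
    [/\ Kc (x, tau), Kc (y, v), `|x - y| <= 2 * ep, `|tau - v| <= 2 * ep & 0 < v].
  rewrite ler_norml => /andP[xn1 xn2] ntau tauT /andP[y1 y2] /andP[v1 v2].
  have v0 : 0 < v by move: (n.+1%:R^-1) v1 ntau epn => iv; lra.
  split=> //.
  - split; rewrite /= in_itv/=; first by move: xn1 xn2 n12; lra.
    by move: v1 v2 tauT v0; lra.
  - split; rewrite /= in_itv/=; first by move: xn1 xn2 n12 y1 y2 ep1; lra.
    by move: v1 v2 tauT v0; lra.
  - by rewrite ger0_norm ?subr_ge0//; move: y1; lra.
  - by rewrite ger0_norm ?subr_ge0//; move: v1; lra.
have approx x tau : `|x| <= n.+1%:R -> n.+1%:R^-1 <= tau -> tau <= T -> `|f 0%N 0%N x tau - Y (x, tau)| <= eta.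
  move=> xn ntau tauT.
  apply: (moll_approx mQ Q_fin Y_mQ YAQ b_smooth b_ge0 b_out b_int hM (boxQ _ _ xn ntau tauT)).
  move=> [y v] [/=]; rewrite !in_itv/= => /andP[y1 y2] /andP[v1 v2].
  have y1' : x - 2 * ep <= y <= x by rewrite y1 (le_trans y2)// lerBlDr lerDl ltW.
  have v1' : tau - 2 * ep <= v <= tau by rewrite v1 (le_trans v2)// lerBlDr lerDl ltW.
  have [k1 k2 d1 d2 _] := inK _ _ _ _ xn ntau tauT y1' v1'.
  by rewrite distrC ltW// Y_osc.
have C0 : 0 <= C by apply: le_trans (normr_ge0 (f 0%N 0%N 0 0)) _; exact: moll_bound.
have dyn : mean P (fun w => discounted (f 0 0)%N r t T (fun u w => X u w) (sig n w) w) <=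
    mean P (discounted (f 0 0)%N r t T (fun u w => X u w) t).
  apply: (@dynkin_stopped _ _ _ P F W F_filt W_bm (f 0 0)%N (f 1 0)%N (f 2 0)%N (f 0 1)%N C m sigma r) => //.
  1-4: by move=> x tau; exact: moll_bound.
  2: by move=> x tau h; exact: (moll_lip_t mQ Q_fin Y_mQ YAQ b_smooth hM).
  1-4: by move=> x tau h; exact: (moll_lip_x mQ Q_fin Y_mQ YAQ b_smooth hM).
  - by move=> x tau h; exact: moll_taylor_x.
  - by move=> x tau h; exact: moll_taylor_t.
  move=> u w tu us.
  have uk : u < kappa n w by apply: lt_le_trans us _; rewrite ge_min lexx orbT.
  have kI := entry_itv (ltW tT) (level_gap_end n) w.
  have uT : u < T by apply: lt_le_trans uk _; case/andP: kI.
  have [pn Tn xn] := level_gap_gt0 (entry_before (ltW tT) (level_gap_end n) tu uk).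
  have Tu : T - u <= T by rewrite lerBlDr lerDl (le_trans t0).
  apply: (Y_gen mQ Q_fin Y_mQ YAQ ep0) => //; first exact: boxQ (ltW xn) (ltW Tn) Tu.
  move=> y v yI vI; have [k1 k2 d1 d2 v0] := inK _ _ _ _ (ltW xn) (ltW Tn) Tu yI vI.
  split=> //; have := psi_osc _ _ _ _ k1 k2 d1 d2 => /(le_lt_trans (ler_norm _)).
  by move: (n.+1%:R^-1) pn => iv; lra.
have tI : t <= t <= T by rewrite lexx ltW.
have TI : T - t <= T by rewrite lerBlDr lerDl.
have flx x tau h : `|f 0%N 0%N (x + h) tau - f 0%N 0%N x tau| <= C * `|h|.
  exact: (moll_lip_x mQ Q_fin Y_mQ YAQ b_smooth hM).
have flt x tau h : `|f 0%N 0%N x (tau + h) - f 0%N 0%N x tau| <= C * `|h|.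
  exact: (moll_lip_t mQ Q_fin Y_mQ YAQ b_smooth hM).
have fC x tau : `|f 0%N 0%N x tau| <= C by exact: moll_bound.
have dcont := continuous_discounted (r := r) C0 flx flt X_cont.
have dmeas u : t <= u <= T ->
    measurable_fun setT (discounted (f 0 0)%N r t T (fun u w => X u w) u).
  exact: (measurable_discounted F_filt r flx t0 X_adapted).
have dbound u w : t <= u -> `|discounted (f 0 0)%N r t T (fun u w => X u w) u w| <= C.
  move=> tu; have /andP[h0 h1] := exp1 tu.
  by rewrite normrM ger0_norm// -[leRHS]mul1r ler_pM.
have iS : rv_integrable P (fun w => discounted (f 0 0)%N r t T (fun u w => X u w) (sig n w) w).
  have [sI _] := sig_stop n; apply: (@rv_integrable_bounded _ _ _ _ _ C).
    apply: (measurable_stopped (ltW tT) dcont) => //.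
    exact: (measurable_stopping_time F_filt t0 (sig_stop n)).
  by move=> w; apply: dbound; have /andP[] := sI w.
have it : rv_integrable P (discounted (f 0 0)%N r t T (fun u w => X u w) t).
  by apply: (@rv_integrable_bounded _ _ _ _ _ C); [exact: dmeas|move=> w; exact: dbound].
have e_t : expR (- r * (t - t)) = 1 by rewrite subrr mulr0 expR0.
have st : mean P (discounted (f 0 0)%N r t T (fun u w => X u w) t) <= Y (x0, T - t) + eta.
  rewrite -[leRHS](mean_cst P); apply: mean_le_ae => //; first exact: rv_integrable_cst.
  apply: filterS X_start => w Xw; rewrite /discounted e_t mul1r Xw.
  have n_t : n.+1%:R^-1 <= T - t by apply: ltW; apply: lt_le_trans gap0 _; rewrite ge_min lexx orbT.
  by have := approx _ _ (ltW x0n) n_t TI; rewrite ler_norml => /andP[_]; rewrite lerBlDl.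
have sS : mean P (fun w => disc_value (sig n w) w) <=
    mean P (fun w => discounted (f 0 0)%N r t T (fun u w => X u w) (sig n w) w) + eta.
  rewrite -[Z in _ <= _ + Z](mean_cst P eta) -meanD//; last exact: rv_integrable_cst.
  apply: mean_le_ae; first exact: stopped_int (sig_stop n).
    by apply: rv_integrableD => //; exact: rv_integrable_cst.
  apply: filterS X_start => w Xw.
  have [sI _] := sig_stop n; have /andP[ts sT] := sI w.
  (* Starting strictly inside the level set ensures that the stopped point is still in its closure,
     where the approximation is valid. *)
  have g0 : 0 < level_gap n t w.
    by rewrite lt_min !subr_gt0 Xw gap0.
  have sk : sig n w <= kappa n w by rewrite ge_min lexx orbT.
  have gk := entry_ge0 (ltW tT) (@level_gap_cont n) (level_gap_end n) g0 ts sk.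
  have [_ ns xs] := level_gap_ge0 gk.
  have Ts : T - sig n w <= T by rewrite lerBlDr lerDl (le_trans t0).
  have := approx _ _ xs ns Ts; have /andP[h0 h1] := exp1 ts.
  rewrite /disc_value /discounted.
  move: (expR _) (f 0%N 0%N _ _) (Y _) h0 h1 => z x y z0 z1; rewrite distrC => /(le_trans (ler_norm _)) xy.
  rewrite -lerBlDl -mulrBr; apply: (@le_trans _ _ (z * eta)); first by rewrite ler_wpM2l.
  by rewrite ler_piMl// ltW.
apply: (le_trans sS); have -> : Y (x0, T - t) + 2 * eta = Y (x0, T - t) + eta + eta by ring.
by rewrite lerD2r; exact: le_trans dyn st.
Qed.

End level.

Local Notation kappa_oo := (entry t T gap).
Let sig_oo w := Num.min (theta w) (kappa_oo w).

Let kappa_le n w : kappa n w <= kappa_oo w.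
Proof.
apply: (entry_le (entry_itv (ltW tT) gap_end w)).
rewrite /level_gap ge_min; apply/orP; left; rewrite subr_le0.
apply: (le_trans (entry_le0 (ltW tT) gap_continuous gap_end w)).
by rewrite invr_ge0.
Qed.

(** On [t, v] with v before the limiting exit, the gap has a positive minimum and the log-price is
    bounded; for large [n] the level exit therefore comes after [v]. *)
Let kappa_cvg w : kappa n w @[n --> \oo] --> kappa_oo w.
Proof.
apply/cvgrPdist_le => e e0.
have kn n := entry_itv (ltW tT) (level_gap_end n) w.
have [k1|k1] := leP (kappa_oo w - e) t.
  apply: nearW => n; rewrite ger0_norm ?subr_ge0//; have /andP[] := kn n; lra.
pose v := kappa_oo w - e.
have tv : t <= v by exact: ltW.
have vk : v < kappa_oo w by rewrite ltrBlDr ltrDl.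
have vT : v <= T by apply: ltW; apply: lt_le_trans vk _; have /andP[] := entry_itv (ltW tT) gap_end w.
have sub : `[t, v] `<=` `[t, T]%classic by apply: subset_itvl; rewrite bnd_simp.
have [c cI hc] := EVT_min tv (continuous_subspaceW sub (@gap_continuous w)).
rewrite in_itv/= in cI; have /andP[tc cv] := cI.
have gc := entry_before (ltW tT) gap_end tc (le_lt_trans cv vk).
have [M hM] := within_continuous_bounded tv (continuous_subspaceW sub (@X_cont w)).
near=> n; rewrite ger0_norm ?subr_ge0// lerBlDl -lerBlDr leNgt; apply/negP => kv.
have /andP[tk kT] := kn n; have kI : kappa n w \in `[t, v] by rewrite in_itv/= tk ltW.
have := entry_le0 (ltW tT) (@level_gap_cont n) (level_gap_end n) w.
apply/negP; rewrite -ltNge lt_min !subr_gt0; apply/andP; split.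
  apply: lt_le_trans (hc _ kI); rewrite -[ltLHS]mul1r.
  by near: n; exact: near_natinv.
have kI' : t <= kappa n w <= v by move: kI; rewrite in_itv.
apply: (le_lt_trans (hM _ kI')).
have nM : M / n.+1%:R < 1 by near: n; exact: near_natinv.
by move: nM; rewrite ltr_pdivrMr ?ltr0n// mul1r.
Unshelve. all: by end_near. Qed.

Lemma stopped_inequality : mean P (fun w => disc_value (sig_oo w) w) <= Y (x0, T - t).
Proof.
have sI w : t <= sig_oo w <= T.
  have [h _] := theta_stop; have /andP[a1 a2] := h w.
  by have /andP[b1 b2] := entry_itv (ltW tT) gap_end w; rewrite le_min a1 b1 ge_min a2.
(* Starting outside the region, almost every path stops at once and the claim is an equality; no
   level set contains the start in this case. *)
have [g0|g0] := leP (Num.min (psi (x0, T - t)) (T - t)) 0.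
  have -> : mean P (fun w => disc_value (sig_oo w) w) = mean P (fun=> Y (x0, T - t)).
    apply: mean_ae => //.
      apply: (measurable_stopped (ltW tT) disc_value_continuous) => //; first exact: disc_value_measurable.
      apply: measurable_minr; first exact: (measurable_stopping_time F_filt t0 theta_stop).
      apply: (measurable_stopping_time F_filt t0 (T := T)).
      apply: (entry_stopping F_filt t0 (ltW tT) gap_continuous gap_end).
      by move=> u uI; exact: gap_adapted.
    apply: filterS X_start => w Xw.
    have kt : kappa_oo w = t by apply: (entry_eq_t (ltW tT) gap_end); rewrite /gap Xw.
    have -> : sig_oo w = t.
      have [h _] := theta_stop; have /andP[a1 a2] := h w.
      by rewrite /sig_oo kt min_r.
    by rewrite /disc_value subrr mulr0 expR0 mul1r Xw.
  by rewrite mean_cst.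
have cvg_m : mean P (fun w => disc_value (sig n w) w) @[n --> \oo] -->
    mean P (fun w => disc_value (sig_oo w) w).
  apply: (@mean_cvg _ _ _ P _ _ A).
  - by move=> n; exact: rv_integrable_measurable (stopped_int (sig_stop n)).
  - by move=> n w; have [h _] := sig_stop n; exact: disc_value_bound.
  - move=> w; apply/cvgrPdist_le => e e0.
    have := (within_continuous_eps _ _).1 (@disc_value_continuous w) (sig_oo w).
    rewrite /= in_itv/= => /(_ (sI w) e e0)[dl dl0 hdl].
    have /cvgrPdist_lt/(_ _ dl0) := @kappa_cvg w; apply: filterS => n hn.
    have [h _] := sig_stop n; apply/ltW/hdl; first by rewrite in_itv/=.
    apply: le_lt_trans hn; rewrite /sig_oo /sig.
    have := kappa_le n w; rewrite !minEle; move: (kappa n w) (kappa_oo w) (theta w) => a c x ac.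
    rewrite [leRHS]ger0_norm ?subr_ge0//.
    by case: (leP x a) => xa; case: (leP x c) => xc; rewrite ler_norml; apply/andP; split; lra.
apply/ler_addgt0Pl => e e0; rewrite addrC.
have e2 : 0 < e / 2 by rewrite divr_gt0.
apply: (cvgr_to_le cvg_m); near=> n.
have -> : e = 2 * (e / 2) by field.
apply: level_inequality => //.
  by rewrite -[ltLHS]mul1r; near: n; exact: near_natinv.
have nM : `|x0| / n.+1%:R < 1 by near: n; exact: near_natinv.
by move: nM; rewrite ltr_pdivrMr ?ltr0n// mul1r.
Unshelve. all: by end_near. Qed.

End stopped_inequality.

(** * The condor *)

Section condor_facts.
Context {R : realType}.
Variables (K1 k1 k2 K2 : R).
Hypotheses (K1_gt0 : 0 < K1) (K1k1 : K1 < k1) (k1k2 : k1 < k2) (k2K2 : k2 < K2).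
Local Notation V0 := (condor_payoff K1 k1 k2 K2).

Lemma condor_payoff_le s : 0 <= V0 s <= K2 - K1.
Proof.
rewrite /condor_payoff !maxEle; move: (K1k1) (k1k2) (k2K2).
by case: (leP (s - K1) 0); case: (leP (K2 - s) 0); case: (leP (k1 - s) 0); case: (leP (s - k2) 0) => *;
  apply/andP; split; lra.
Qed.

Lemma condor_payoff_mid s : k1 <= s <= k2 -> V0 s = K2 - K1.
Proof.
move=> /andP[h1 h2]; rewrite /condor_payoff !maxEle; move: (K1k1) (k1k2) (k2K2).
by case: (leP (s - K1) 0); case: (leP (K2 - s) 0); case: (leP (k1 - s) 0); case: (leP (s - k2) 0) => *; lra.
Qed.

Lemma continuous_condor_payoff : continuous V0.
Proof.
have c (f : R -> R) : continuous f -> continuous (fun s => Num.max (f s) 0).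
  by move=> cf s; apply: (@continuous_max R R f (cst 0) s); [exact: cf|exact: cst_continuous].
have c1 k : continuous (fun s : R => Num.max (s - k) 0).
  by apply: (c (fun s => s - k)) => s; apply: cvgB; [exact: cvg_id|exact: cvg_cst].
have c2 k : continuous (fun s : R => Num.max (k - s) 0).
  by apply: (c (fun s => k - s)) => s; apply: cvgB; [exact: cvg_cst|exact: cvg_id].
move=> s; apply: cvgB; last exact: c1.
by apply: cvgB; last exact: c2; apply: cvgD; [exact: c1|exact: c2].
Qed.

Lemma continuous_log_payoff (A : set (R * R)) :
  {within A, continuous (fun z : R * R => log_payoff K1 k1 k2 K2 z.1)}.
Proof.
have cl : continuous (log_payoff K1 k1 k2 K2).
  move=> x; apply: (@continuous_comp _ _ _ (@expR R) V0); first exact: continuous_expR.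
  exact: continuous_condor_payoff.
apply: continuous_subspaceT => z.
apply: (@cvg_comp _ _ _ fst (log_payoff K1 k1 k2 K2) _ (nbhs z.1)); first exact: cvg_fst.
exact: cl.
Qed.

End condor_facts.

Section log_solution.
Context {R : realType}.
Local Notation mu2 := ((@lebesgue_measure R) \x (@lebesgue_measure R))%E.
Variables (K1 k1 k2 K2 sigma r q T p : R) (Y : R * R -> R).
Hypotheses (K1_gt0 : 0 < K1) (K1k1 : K1 < k1) (k1k2 : k1 < k2) (k2K2 : k2 < K2).
Hypotheses (T_gt0 : 0 < T).
Hypothesis Y_sol : log_piecewise_strong_solution K1 k1 k2 K2 sigma r q T p Y.
Local Notation Y0 := (log_payoff K1 k1 k2 K2).
Local Notation side I := (exists e c, strong_solution_on K1 k1 k2 K2 sigma r q T p I e c Y).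

Let k1_gt0 : 0 < k1. Proof. exact: lt_trans K1k1. Qed.
Let k2_gt0 : 0 < k2. Proof. exact: lt_trans k1k2. Qed.

Let left_side : side `]-oo, ln k1[%classic.
Proof. by have [_ _ _ h _] := Y_sol; exists (ln k1), (ln K1). Qed.

Let right_side : side `]ln k2, +oo[%classic.
Proof. by have [_ _ _ _ h] := Y_sol; exists (ln k2), (ln K2). Qed.

Let mid_payoff x : ln k1 <= x <= ln k2 -> Y0 x = K2 - K1.
Proof.
move=> /andP[h1 h2]; apply: condor_payoff_mid => //.
by rewrite -(lnK (k1_gt0 : k1 \is Num.pos)) ler_expR h1 -(lnK (k2_gt0 : k2 \is Num.pos)) ler_expR.
Qed.

Let side_cases x : [\/ x < ln k1, ln k1 <= x <= ln k2 | ln k2 < x].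
Proof.
have [h|h] := ltP x (ln k1); first by constructor 1.
by have [h'|h'] := leP x (ln k2); [constructor 2|constructor 3].
Qed.

Let side_ge (I : set R) x tau : side I -> I x -> 0 <= tau <= T -> Y0 x <= Y (x, tau).
Proof.
move=> [e [c [Yx [Yxx [Yt [_ h _ _ [h0 _]]]]]]] Ix /andP[].
rewrite le_eqVlt => /predU1P[<- _|t0 tT]; first by rewrite h0.
by apply: h => //; rewrite t0.
Qed.

Lemma log_solution_ge x tau : 0 <= tau <= T -> Y0 x <= Y (x, tau).
Proof.
move=> tI; case: (side_cases x) => hx.
- by apply: (side_ge left_side) => //=; rewrite in_itv.
- by have [_ _ h _ _] := Y_sol; rewrite h// mid_payoff.
- by apply: (side_ge right_side) => //=; rewrite in_itv/= andbT.
Qed.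

Lemma log_solution_start x : Y (x, 0) = Y0 x.
Proof.
have tI : 0 <= (0 : R) <= T by rewrite lexx ltW.
case: (side_cases x) => hx.
- by have [e [c [Yx [Yxx [Yt [_ _ _ _ [h0 _]]]]]]] := left_side; rewrite h0//= in_itv.
- by have [_ _ h _ _] := Y_sol; rewrite h// mid_payoff.
- by have [e [c [Yx [Yxx [Yt [_ _ _ _ [h0 _]]]]]]] := right_side; rewrite h0//= in_itv/= andbT.
Qed.

(** Membership in L^p includes measurability, but only off a disc around the corner and in a bounded
    range. Since the discs are centred at time 0, such sets exhaust the strip. *)
Let side_measurable (I : set R) : measurable (I : set (measurableTypeR R)) -> side I ->
  measurable_fun ((I : set (measurableTypeR R)) `*` `]0, T[) Y.
Proof.
move=> mI [e [c [Yx [Yxx [Yt [[_ _ _ _ hp] _ _ _ _]]]]]].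
pose E (n : nat) : set (measurableTypeR R * measurableTypeR R) :=
  ((I `&` `]- n.+1%:R, n.+1%:R[) `*` `]0, T[) `\` disc (c, 0) n.+1%:R^-1.
have mdisc (rho : R) : measurable (disc (c, 0) rho : set (measurableTypeR R * measurableTypeR R)).
  have mg : measurable_fun [set: measurableTypeR R * measurableTypeR R]
      (fun z => (z.1 - c) ^+ 2 + (z.2 - 0) ^+ 2).
    by apply: measurable_funD; apply: measurable_funX; apply: measurable_funB.
  have := mg measurableT _ (measurable_itv `]-oo, (rho ^+ 2)[); rewrite setTI.
  by congr measurable; apply/seteqP; split=> z /=; rewrite in_itv.
have mE n : measurable (E n).
  apply: measurableD; last exact: mdisc.
  apply: measurableX; last exact: measurable_itv.
  by apply: measurableI => //; exact: measurable_itv.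
have -> : (I : set (measurableTypeR R)) `*` `]0, T[ = \bigcup_n E n.
  apply/seteqP; split=> [[x v] [Ix /= vI]|z [n _ [[[h1 h2] h3] h4]]]; last by [].
  have v0 : 0 < v by move: vI; rewrite in_itv => /andP[].
  have [n1 _ h1] := @near_natinv R `|x| 1 ltr01.
  have [n2 _ h2] := @near_natinv R 1 v v0.
  exists (maxn n1 n2) => //; split.
    split=> //; split=> //=; rewrite in_itv/= -ltr_norml.
    by have := h1 _ (leq_maxl n1 n2); rewrite ltr_pdivrMr ?ltr0n// mul1r.
  rewrite /disc/= subr0 => hd; have := h2 _ (leq_maxr n1 n2); rewrite mul1r ltNge => /negP; apply.
  rewrite leNgt; apply/negP => vn; move: hd; rewrite ltNge => /negP; apply.
  apply: (@le_trans _ _ (v ^+ 2)); last by rewrite lerDr sqr_ge0.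
  by rewrite ler_pXn2r ?nnegrE ?invr_ge0// ltW.
apply/measurable_fun_bigcup => // n.
have n0 : 0 < n.+1%:R :> R by rewrite ltr0n.
have n0' : 0 < n.+1%:R^-1 :> R by rewrite invr_gt0.
by have [[h _] _ _ _] := hp _ _ n0 n0'.
Qed.

Lemma log_solution_measurable : measurable_fun ([set: measurableTypeR R] `*` `]0, T[) Y.
Proof.
pose L : set (measurableTypeR R * measurableTypeR R) := `]-oo, ln k1[%classic `*` `]0, T[.
pose C : set (measurableTypeR R * measurableTypeR R) := `[ln k1, ln k2] `*` `]0, T[.
pose U : set (measurableTypeR R * measurableTypeR R) := `]ln k2, +oo[%classic `*` `]0, T[.
have mL : measurable L by apply: measurableX; exact: measurable_itv.
have mC : measurable C by apply: measurableX; exact: measurable_itv.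
have mU : measurable U by apply: measurableX; exact: measurable_itv.
have -> : [set: measurableTypeR R] `*` `]0, T[ = L `|` C `|` U.
  apply/seteqP; split=> [[x v] [_ vI]|z [[]|] []//].
  by case: (side_cases x) => hx; [left; left|left; right|right]; split=> //=; rewrite in_itv/= ?andbT.
apply/measurable_funU => //; first exact: measurableU.
split; last exact: side_measurable (measurable_itv _) right_side.
apply/measurable_funU => //; split; first exact: side_measurable (measurable_itv _) left_side.
apply: (eq_measurable_fun (cst (K2 - K1))) => //.
move=> [x v] /set_mem[/=]; rewrite !in_itv/= => xI /andP[v0 vT].
by have [_ _ h _ _] := Y_sol; rewrite h// ltW// ltW.
Qed.

(** As [psi] is not positive on the middle strip, the rectangle below (x, tau) misses that strip,
    and being an interval in x it lies on one side. So a single weak equation governs the whole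
    box. *)
Let box_side (psi : R * R -> R) ep x tau : 0 < ep -> tau <= T ->
  (forall y v, ln k1 <= y <= ln k2 -> 0 <= v <= T -> psi (y, v) <= 0) ->
  (forall y v, x - 2 * ep <= y <= x -> tau - 2 * ep <= v <= tau -> 0 < v /\ 0 < psi (y, v)) ->
  exists2 I, side I & box ep x tau `<=` (I : set R) `*` `]0, T[.
Proof.
move=> ep0 tauT psi0 hpsi.
have ep2 : 0 < 2 * ep by rewrite mulr_gt0.
have tauI : tau - 2 * ep <= tau <= tau by rewrite lexx andbT gerBl ltW.
have xI : x - 2 * ep <= x <= x by rewrite lexx andbT gerBl ltW.
have out y : x - 2 * ep <= y <= x -> ~ (ln k1 <= y <= ln k2).
  move=> yI ym; have [v0 hp] := hpsi y tau yI tauI.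
  by have := psi0 y tau ym; rewrite tauT (ltW v0) leNgt hp => /(_ isT).
have inT v : tau - 2 * ep <= v -> v <= tau - ep -> 0 < v < T.
  move=> v1 v2; have vt : v <= tau by move: v2 ep0; lra.
  have [-> _] := hpsi x v xI (introT andP (conj v1 vt)).
  by move: v2 ep0 tauT; lra.
have [xk|xk] := ltP x (ln k1).
  exists `]-oo, ln k1[%classic; first exact: left_side.
  move=> [y v] [/=]; rewrite !in_itv/= => /andP[y1 y2] /andP[v1 v2].
  by split; [move: xk y2 ep0; lra|exact: inT].
have xk2 : ln k2 < x.
  by rewrite ltNge; apply/negP => h; apply: (out x xI); rewrite xk.
exists `]ln k2, +oo[%classic; first exact: right_side.
move=> [y v] [/=]; rewrite !in_itv/= => /andP[y1 y2] /andP[v1 v2].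
rewrite andbT; split; [|exact: inT]; rewrite ltNge; apply/negP => h.
(* If the box reached across, the point ln k2 itself would lie in the range of the rectangle. *)
apply: (out (ln k2)); first by rewrite (le_trans y1 h) ltW.
by rewrite lexx andbT ler_ln ?posrE// ltW.
Qed.

Lemma log_solution_super A :
  moll_subsolution r q sigma T Y (fun z => K2 - K1 - Y0 z.1) A.
Proof.
move=> Q ep b x tau mQ Q_fin mY YA ep0 [b_smooth b_ge0 b_out b_int] bQ tauT hpsi.
have [y v ym _|I [e [c [Yx [Yxx [Yt [[_ wx wxx wt _] _ hae _ _]]]]]] bI] :=
  box_side (psi := fun z => K2 - K1 - Y0 z.1) ep0 tauT _ hpsi.
  by rewrite /= mid_payoff ?subrr.
apply: (moll_supersolution mQ Q_fin mY YA b_smooth b_ge0 b_out (ltW ep0) wx wxx wt bQ bI).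
apply: (@filterS _ _ (ae_filter_ringOfSetsType mu2) _ _ _ hae) => z hz /bI[Iz]; rewrite /= in_itv/= => /andP[z0 zT].
by apply: hz; split=> //=; rewrite in_itv/= z0 ltW.
Qed.

Let solution_eq A (Q : set (measurableTypeR R * measurableTypeR R)) ep b x tau :
  measurable Q -> (mu2 Q < +oo)%E -> measurable_fun Q Y -> (forall z, Q z -> `|Y z| <= A) ->
  0 < ep -> bump_at ep b -> box ep x tau `<=` Q -> tau <= T ->
  (forall y v, x - 2 * ep <= y <= x -> tau - 2 * ep <= v <= tau -> 0 < v /\ 0 < Y (y, v) - Y0 y) ->
  generator (moll Q Y b 0 0) (moll Q Y b 1 0) (moll Q Y b 2 0) (moll Q Y b 0 1)
    (r - q - sigma ^+ 2 / 2) sigma r x tau = 0.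
Proof.
move=> mQ Q_fin mY YA ep0 [b_smooth b_ge0 b_out b_int] bQ tauT hpsi.
have [y v ym vT|I [e [c [Yx [Yxx [Yt [[_ wx wxx wt _] _ _ hae _]]]]]] bI] :=
  box_side (psi := fun z => Y z - Y0 z.1) ep0 tauT _ hpsi.
  by have [_ _ h _ _] := Y_sol; rewrite /= h// mid_payoff ?subrr.
apply: (moll_solution mQ Q_fin mY YA b_smooth b_out (ltW ep0) wx wxx wt bQ bI).
apply: (@filterS _ _ (ae_filter_ringOfSetsType mu2) _ _ _ hae) => -[y v] hz /[dup] /bI[Iz]; rewrite /= in_itv/= => /andP[z0 zT].
move=> [/=]; rewrite !in_itv/= => /andP[y1 y2] /andP[v1 v2].
apply: hz; first by split=> //=; rewrite in_itv/= z0 ltW.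
have yI : x - 2 * ep <= y <= x by rewrite y1 (le_trans y2)// gerBl ltW.
have vI : tau - 2 * ep <= v <= tau by rewrite v1 (le_trans v2)// gerBl ltW.
by have [_] := hpsi y v yI vI; rewrite subr_gt0.
Qed.

Lemma log_solution_sub A : moll_subsolution r q sigma T Y (fun z => Y z - Y0 z.1) A.
Proof.
move=> Q ep b x tau mQ Q_fin mY YA ep0 hb bQ tauT hpsi.
by rewrite (solution_eq mQ Q_fin mY YA ep0 hb bQ tauT hpsi).
Qed.

(** The mollified equation is an equality here and is linear in [Y], so it survives the change of
    sign. *)
Lemma log_solution_oppsub A :
  moll_subsolution r q sigma T (fun z => - Y z) (fun z => Y z - Y0 z.1) A.
Proof.
move=> Q ep b x tau mQ Q_fin mYN YAN ep0 hb bQ tauT hpsi.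
have mY : measurable_fun Q Y.
  by have := measurable_funN mYN; apply: eq_measurable_fun => z _ /=; rewrite opprK.
have YA z : Q z -> `|Y z| <= A by move=> /YAN; rewrite normrN.
have [b_smooth _ b_out _] := hb.
have lohi : ep <= 2 * ep by rewrite ler_peMl ?ler1n// ltW.
have mollN i j : moll Q (fun z => - Y z) b i j x tau = - moll Q Y b i j x tau.
  rewrite /moll /pairing -mulN1r -RintegralZl//; last first.
    apply: (integrable_pairing mQ Q_fin mY YA).
    split; first exact: (measurable_bump_kernel b_smooth).
    have [Mi _ hMi] := smooth_bounded b_smooth b_out i lohi.
    have [Mj _ hMj] := smooth_bounded b_smooth b_out j lohi.
    by exists (Mi * Mj) => z; rewrite normrM ler_pM.
  by apply: eq_Rintegral => z _; rewrite mulN1r mulNr.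
have := solution_eq mQ Q_fin mY YA ep0 hb bQ tauT hpsi.
rewrite /generator (mollN 2%N 0%N) (mollN 1%N 0%N) (mollN 0%N 1%N) (mollN 0%N 0%N) !mulrN opprK.
move: (_ * moll Q Y b 2 0 x tau) (_ * moll Q Y b 1 0 x tau) (moll Q Y b 0 1 x tau) (_ * moll Q Y b 0 0 x tau).
by move=> m1 m2 m3 m4; lra.
Qed.

End log_solution.

Section maturity.
Context {R : realType} {d : measure_display} {Omega : measurableType d}.
Variables (P : probability Omega R) (F : R -> set (set Omega)) (W : R -> Omega -> R).
Hypothesis F_filt : filtration F.

Lemma stopping_times_cst (t T : R) : t <= T -> stopping_times F t T (fun=> T).
Proof.
move=> tT; split=> [w|u u0]; first by rewrite lexx andbT.
have Fs := filtration_sigma F_filt u0.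
have [Tu|uT] := leP T u.
  by rewrite (_ : [set _ | _] = setT); [exact: sub_sigma_algebraT|apply/seteqP; split].
rewrite (_ : [set _ | _] = set0); last by apply/seteqP; split.
by rewrite -setCT; apply: (sub_sigma_algebraC Fs); exact: sub_sigma_algebraT.
Qed.

(** At maturity the only stopping time is [T], and the price equals [s] almost surely, so every
    reward is the payoff itself. *)
Lemma stopped_reward_maturity (r q sigma T s : R) (S : R -> Omega -> R) (g : R -> R) theta :
  0 <= T -> continuous g -> price_process P F W r q sigma T T s S ->
  stopping_times F T T theta -> stopped_reward P r T g S theta = (g s)%:E.
Proof.
move=> T0 g_cont [_ _ S_adapted S_start _] [thetaI _].
have thetaE w : theta w = T by apply: le_anti; rewrite andbC; exact: thetaI.
rewrite /stopped_reward unlock (ae_eq_integral (cst (g s)%:E))//=.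
- by have := expectation_cst P (g s); rewrite unlock.
- apply/measurable_EFinP; rewrite (_ : (fun _ => _) = g \o S T); last first.
    by apply/funext => w; rewrite /= thetaE subrr mulr0 expR0 mul1r.
  apply: measurableT_comp; first exact: continuous_measurable_fun.
  move=> _ B mB; rewrite setTI; have [_ Fm _] := F_filt.
  by apply: (Fm T T0); apply: S_adapted => //; rewrite lexx.
- by apply: filterS S_start => w /= E _; rewrite thetaE E subrr mulr0 expR0 mul1r.
Qed.

End maturity.

Section value_function.
Context {R : realType} {d : measure_display} {Omega : measurableType d}.
Variables (K1 k1 k2 K2 sigma r q T p : R) (Y : R * R -> R).
Hypotheses (K1_gt0 : 0 < K1) (K1k1 : K1 < k1) (k1k2 : k1 < k2) (k2K2 : k2 < K2).
Hypotheses (r_ge0 : 0 <= r) (T_gt0 : 0 < T).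
Hypothesis Y_sol : log_piecewise_strong_solution K1 k1 k2 K2 sigma r q T p Y.
Variables (P : probability Omega R) (F : R -> set (set Omega)) (W : R -> Omega -> R).
Hypotheses (F_filt : filtration F) (W_bm : brownian_motion P F W).
Variables (s t : R) (S : R -> Omega -> R).
Hypotheses (s_gt0 : 0 < s) (t0 : 0 <= t) (tT : t < T).
Hypothesis S_price : price_process P F W r q sigma T t s S.
Local Notation V0 := (condor_payoff K1 k1 k2 K2).
Local Notation Y0 := (log_payoff K1 k1 k2 K2).

Let Y_cont : {within setT `*` `[0, T], continuous Y}. Proof. by case: Y_sol. Qed.

Let Y_bound : exists A, forall x tau, 0 <= tau <= T -> `|Y (x, tau)| <= A.
Proof. by case: Y_sol. Qed.

Let Y_meas := log_solution_measurable Y_sol.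
Let Y_ge := log_solution_ge K1_gt0 K1k1 k1k2 k2K2 Y_sol.
Let Y_start := log_solution_start K1_gt0 K1k1 k1k2 k2K2 T_gt0 Y_sol.

Let S_gt0 u w : t <= u <= T -> 0 < S u w. Proof. by case: S_price => h _ _ _ _; apply: h. Qed.

Let price_payoff u w : t <= u <= T -> V0 (S u w) = Y0 (ln (S u w)).
Proof. by move=> uI; rewrite /log_payoff lnK// posrE S_gt0. Qed.

Let time_left u : t <= u <= T -> 0 <= T - u <= T.
Proof. by move=> /andP[tu uT]; rewrite subr_ge0 uT lerBlDr lerDl (le_trans t0). Qed.

Let reward := disc_value r T t S (fun z => Y0 z.1).

Let reward_int theta : stopping_times F t T theta -> rv_integrable P (fun w => reward (theta w) w).
Proof.
move=> ts; have [tI _] := ts.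
have Y0_cont := @continuous_log_payoff R K1 k1 k2 K2 (setT `*` `[0, T]).
apply: (@rv_integrable_bounded _ _ _ _ _ (K2 - K1)).
  apply: (measurable_stopped (ltW tT) (disc_value_continuous t0 S_price Y0_cont)) => //.
    exact: (disc_value_measurable F_filt t0 S_price Y0_cont).
  exact: (measurable_stopping_time F_filt t0 ts).
have Y0_bound x tau : 0 <= tau <= T -> `|Y0 (x, tau).1| <= K2 - K1.
  by move=> _; have /andP[h1 h2] := condor_payoff_le K1k1 k1k2 k2K2 (expR x); rewrite /= ger0_norm.
by move=> w; exact: (disc_value_bound (Y := fun z => Y0 z.1) S r_ge0 t0 Y0_bound).
Qed.

Let stopped_rewardE theta : stopping_times F t T theta ->
  stopped_reward P r t V0 S theta = (mean P (fun w => reward (theta w) w))%:E.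
Proof.
move=> ts; have [tI _] := ts.
rewrite /stopped_reward unlock /mean /Rintegral fineK; last first.
  by apply: integrable_fin_num => //; exact: reward_int.
by apply: eq_integral => w _; rewrite /reward /disc_value price_payoff.
Qed.

Let value_int theta : stopping_times F t T theta ->
  rv_integrable P (fun w => disc_value r T t S Y (theta w) w).
Proof.
move=> ts; have [tI _] := ts; have [A YA] := Y_bound.
apply: (@rv_integrable_bounded _ _ _ _ _ A).
  apply: (measurable_stopped (ltW tT) (disc_value_continuous t0 S_price Y_cont)) => //.
    exact: (disc_value_measurable F_filt t0 S_price Y_cont).
  exact: (measurable_stopping_time F_filt t0 ts).
by move=> w; exact: disc_value_bound.
Qed.

Let entry_stop (psi : R * R -> R) : {within setT `*` `[0, T], continuous psi} ->
  stopping_times F t T (entry t T (gap T S psi)).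
Proof.
move=> psi_cont; apply: (entry_stopping F_filt t0 (ltW tT)).
- exact: (gap_continuous t0 S_price psi_cont).
- exact: gap_end.
- exact: (gap_adapted F_filt t0 S_price psi_cont).
Qed.

Lemma reward_le_value theta : stopping_times F t T theta ->
  (stopped_reward P r t V0 S theta <= (Y (ln s, T - t))%:E)%E.
Proof.
move=> ts; rewrite (stopped_rewardE ts) lee_fin; have [A YA] := Y_bound.
pose psi (z : R * R) := K2 - K1 - Y0 z.1.
have psi_cont : {within setT `*` `[0, T], continuous psi}.
  by move=> z; apply: cvgB; [exact: cvg_cst|exact: continuous_log_payoff].
have := stopped_inequality F_filt W_bm r_ge0 t0 tT S_price Y_meas YA Y_cont psi_cont
  (log_solution_super K1_gt0 K1k1 k1k2 k2K2 Y_sol (A := A)) ts.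
apply: le_trans; have ks := entry_stop psi_cont; have ms := stopping_times_min F_filt ts ks.
apply: mean_le; [exact: reward_int|exact: value_int ms|move=> w].
have [h _] := ts; have [h' _] := ks; have tI := h w; have kI := h' w.
have [tk|kt] := leP (theta w) (entry t T (gap T S psi) w).
  by rewrite /reward /disc_value ler_wpM2l ?expR_ge0// Y_ge// time_left.
rewrite /reward /disc_value; set k := entry _ _ _ w in kI kt *.
(* Being strictly before [T], the exit is due to the payoff reaching its maximum and not to the
   vanishing remaining time. *)
have kT : k < T by apply: lt_le_trans kt _; case/andP: tI.
have gk : gap T S psi k w <= 0.
  by apply: (entry_le0 (ltW tT) (gap_continuous t0 S_price psi_cont)); exact: gap_end.
have cY0 : K2 - K1 <= Y0 (ln (S k w)).
  by move: gk; rewrite /gap ge_min => /orP[|]; rewrite /psi/= ?subr_le0// leNgt kT.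
have cY : K2 - K1 <= Y (ln (S k w), T - k) by rewrite (le_trans cY0)// Y_ge// time_left.
have c0 : 0 <= K2 - K1 by move: (K1k1) (k1k2) (k2K2); lra.
apply: (@le_trans _ _ (expR (- r * (theta w - t)) * (K2 - K1))).
  rewrite ler_wpM2l ?expR_ge0//.
  by have /andP[] := condor_payoff_le K1k1 k1k2 k2K2 (expR (ln (S (theta w) w))).
rewrite ler_pM ?expR_ge0// ler_expR !mulNr lerN2 ler_wpM2l// lerB// ltW//.
Qed.

Let psi (z : R * R) := Y z - Y0 z.1.

Let psi_cont : {within setT `*` `[0, T], continuous psi}.
Proof. by move=> z; apply: cvgB; [exact: Y_cont|exact: continuous_log_payoff]. Qed.

(** The time component of [gap] adds only the entry at [T], and there the initial condition of [Y]
    puts every price in the exercise set. *)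
Lemma first_entryE : first_entry (exercise_set K1 k1 k2 K2 T (fun s t => Y (ln s, T - t))) t T S =
  entry t T (gap T S psi).
Proof.
apply/funext => w; congr inf; apply/seteqP; split=> u /= [uI].
  case=> _ _ /= E; split=> //; rewrite ge_min; apply/orP; left.
  by rewrite /psi/= E price_payoff// subrr.
move=> gu; split=> //; have /andP[tu uT] := uI.
split=> /=; [exact: S_gt0|by rewrite uT (le_trans t0)|].
rewrite price_payoff//; apply/eqP; rewrite eq_le Y_ge ?time_left// andbT.
move: gu; rewrite /gap ge_min => /orP[|]; first by rewrite /psi/= subr_le0.
rewrite subr_le0 => Tu; have -> : u = T by apply/eqP; rewrite eq_le uT.
by rewrite subrr Y_start.
Qed.

Lemma entry_stopping_time : stopping_times F t T (entry t T (gap T S psi)).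
Proof. exact: entry_stop. Qed.

Lemma entry_optimal :
  stopped_reward P r t V0 S (entry t T (gap T S psi)) = (Y (ln s, T - t))%:E.
Proof.
have ks := entry_stop psi_cont; have [kI _] := ks; rewrite stopped_rewardE//; congr EFin.
have [A YA] := Y_bound; set k := entry t T (gap T S psi).
(* The inequality is used with the constant stopping time [T], so that the minimum is the entry
   time. *)
have Ek w : Num.min T (k w) = k w by rewrite min_r//; case/andP: (kI w).
have rE w : reward (k w) w = disc_value r T t S Y (k w) w.
  have gk : gap T S psi (k w) w <= 0.
    by apply: (entry_le0 (ltW tT) (gap_continuous t0 S_price psi_cont)); exact: gap_end.
  rewrite /reward /disc_value; congr (_ * _); apply/eqP; rewrite eq_le Y_ge ?time_left//=.
  move: gk; rewrite /gap ge_min => /orP[|]; first by rewrite /psi/= subr_le0.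
  rewrite subr_le0 => Tk; have -> : k w = T by apply/eqP; rewrite eq_le Tk; case/andP: (kI w) => _ ->.
  by rewrite subrr Y_start.
have -> : (fun w => reward (k w) w) = (fun w => disc_value r T t S Y (k w) w) by apply/funext.
have up := stopped_inequality F_filt W_bm r_ge0 t0 tT S_price Y_meas YA Y_cont psi_cont
  (log_solution_sub K1_gt0 K1k1 k1k2 k2K2 Y_sol (A := A)) (stopping_times_cst F_filt (ltW tT)).
have YN_meas := measurable_funN Y_meas.
have YNA x tau : 0 <= tau <= T -> `|- Y (x, tau)| <= A by rewrite normrN; exact: YA.
have YN_cont : {within setT `*` `[0, T], continuous (fun z => - Y z)}.
  by move=> z; apply: cvgN; exact: Y_cont.
have lo := stopped_inequality F_filt W_bm r_ge0 t0 tT S_price YN_meas YNA YN_cont psi_cont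
  (log_solution_oppsub K1_gt0 K1k1 k1k2 k2K2 Y_sol (A := A)) (stopping_times_cst F_filt (ltW tT)).
apply/eqP; rewrite eq_le; apply/andP; split.
  by move: up; under [fun w => _]funext do rewrite Ek.
rewrite -lerN2; apply: le_trans lo; rewrite -mulN1r -meanZ; last exact: value_int ks.
rewrite le_eqVlt; apply/orP; left; apply/eqP; congr mean; apply/funext => w.
by rewrite Ek /disc_value mulN1r mulrN.
Qed.

End value_function.

Lemma first_entry_eq (R : realType) (d : measure_display) (Omega : measurableType d)
    (E E' : set (R * R)) (t T : R)
    (S : R -> Omega -> R) :
  (forall z, E z <-> E' z) -> first_entry E t T S = first_entry E' t T S.
Proof. by move=> EE'; congr (first_entry _ _ _ _); apply/seteqP; split=> z /EE'. Qed.

Theorem theorem2p4 (R : realType) (K1 k1 k2 K2 sigma r q T p : R)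
    (K1_gt0 : 0 < K1) (K1k1 : K1 < k1) (k1k2 : k1 < k2) (k2K2 : k2 < K2)
    (sigma_gt0 : 0 < sigma) (r_gt0 : 0 < r) (q_ge0 : 0 <= q) (T_gt0 : 0 < T)
    (p_gt3 : 3 < p)
    (V : R -> R -> R)
    (V_sol : piecewise_strong_solution K1 k1 k2 K2 sigma r q T p V)
    (d : measure_display) (Omega : measurableType d) (P : probability Omega R)
    (F : R -> set (set Omega)) (F_filt : filtration F)
    (W : R -> Omega -> R) (W_bm : brownian_motion P F W)
    (s t : R) (s_gt0 : 0 < s) (t_itv : 0 <= t <= T)
    (S : R -> Omega -> R) (S_price : price_process P F W r q sigma T t s S) :
  let V0 := condor_payoff K1 k1 k2 K2 in
  let tau_star := first_entry (exercise_set K1 k1 k2 K2 T V) t T S in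
  (V s t)%:E = optimal_value P F r t T V0 S /\
  (t < T ->
   stopping_times F t T tau_star /\
   stopped_reward P r t V0 S tau_star = optimal_value P F r t T V0 S).
Proof.
move=> V0 tau_star; have [Y Y_sol VE] := V_sol; have /andP[t0 tT] := t_itv.
have r0 := ltW r_gt0; rewrite VE//.
(* Maturity is treated apart: the time grids need an interval of positive length. *)
have [tT'|Tt] := ltP t T; last first.
  have {Tt tT t0} tE : t = T by apply/eqP; rewrite eq_le tT.
  subst t; split=> [|//]; rewrite subrr.
  rewrite (log_solution_start K1_gt0 K1k1 k1k2 k2K2 T_gt0 Y_sol) /log_payoff lnK ?posrE//.
  have rewardE theta : stopping_times F T T theta -> stopped_reward P r T V0 S theta = (V0 s)%:E.
    apply: (stopped_reward_maturity F_filt (ltW T_gt0) _ S_price); exact: continuous_condor_payoff.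
  apply/eqP; rewrite eq_le; apply/andP; split.
    apply: ereal_sup_ubound; exists (fun=> T); first exact: stopping_times_cst.
    exact/rewardE/stopping_times_cst.
  by apply: ge_ereal_sup => _ [theta ts <-]; rewrite rewardE.
(* [V] is prescribed by [Y] only for positive prices and times in [0, T]; the exercise set is
   confined to these. *)
have tauE : tau_star = first_entry (exercise_set K1 k1 k2 K2 T (fun s t => Y (ln s, T - t))) t T S.
  apply: first_entry_eq => -[x u]; rewrite /exercise_set/=.
  by split=> -[x0 uI E]; split=> //; move: E; rewrite VE.
have fE := first_entryE K1_gt0 K1k1 k1k2 k2K2 T_gt0 Y_sol t0 S_price.
have ts := entry_stopping_time Y_sol F_filt t0 tT' S_price.
have opt := entry_optimal K1_gt0 K1k1 k1k2 k2K2 r0 T_gt0 Y_sol F_filt W_bm t0 tT' S_price.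
rewrite tauE fE.
suff -> : optimal_value P F r t T V0 S = (Y (ln s, T - t))%:E by [].
apply/eqP; rewrite eq_le; apply/andP; split.
  apply: ge_ereal_sup => _ [theta mtheta <-].
  exact: (reward_le_value K1_gt0 K1k1 k1k2 k2K2 r0 Y_sol F_filt W_bm t0 tT' S_price mtheta).
by apply: ereal_sup_ubound; exact: (ex_intro2 _ _ _ ts opt).
Qed.
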